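(* Let $\Lambda\in\widehat P$ and let $V(\boldsymbol\pi)$ be the finite-dimensional simple $\widehat{\mathbf U}_q'$-module corresponding to an $\ell$-tuple $\boldsymbol\pi=(\pi_i(u))_{i\in I}$ of polynomials in one variable over $\mathbb C(q)$ with constant term $1$. Then $X(\Lambda)\otimes V(\boldsymbol\pi)$ is a simple $\widehat{\mathbf U}_q'$-module.
   Context: $\mathbb N=\{0,1,2,\dots\}$. $\mathfrak g$ is a finite-dimensional complex simple Lie algebra of rank $\ell$, $I=\{1,\dots,\ell\}$, with Cartan subalgebra $\mathfrak h$, simple roots $\alpha_i$, fundamental weights $\varpi_i$, weight lattice $P$, $Q^+=\sum_{i\in I}\mathbb N\alpha_i$, highest root $\theta=\sum_{i\in I}a_i\alpha_i$. $\widehat{\mathfrak g}=\mathfrak g\otimes\mathbb C[t^{\pm1}]\oplus\mathbb Cc\oplus\mathbb Cd$ is the untwisted affine algebra, $\widehat I=I\cup\{0\}$, $\widehat{\mathfrak h}=\mathfrak h\oplus\mathbb Cc\oplus\mathbb Cd$; $\mathfrak h^*\subset\widehat{\mathfrak h}^*$ (zero on $c,d$); $\delta$ vanishes on $\mathfrak h\oplus\mathbb Cc$ and $\delta(d)=1$; $\alpha_0=\delta-\theta$, $\alpha_0^\vee=c-\theta^\vee$. $(a_{ij})_{i,j\in\widehat I}$ is the Cartan matrix, $d_i$ are coprime positive integers with $(d_ia_{ij})$ symmetric, $q_i=q^{d_i}$, $[n]_i=(q_i^n-q_i^{-n})/(q_i-q_i^{-1})$. $\omega_i$ ($i\in\widehat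 I$) is defined by $\omega_i(\alpha_j^\vee)=\delta_{ij}$, $\omega_i(d)=0$; $\widehat P=\sum_{i\in\widehat I}\mathbb Z\omega_i\oplus\mathbb Z\delta$. $\widehat{\mathbf U}_q$ is the quantum affine algebra over $\mathbb C(q)$ with generators $E_i,F_i,K_i^{\pm1}$ ($i\in\widehat I$), $D^{\pm1}$ and central $C^{\pm1/2}$, with $C=K_0\prod_{i\in I}K_i^{a_i}$, the $K_i,D$ commuting, $K_iE_jK_i^{-1}=q_i^{a_{ij}}E_j$, $K_iF_jK_i^{-1}=q_i^{-a_{ij}}F_j$, $DE_jD^{-1}=q^{\delta_{j0}}E_j$, $DF_jD^{-1}=q^{-\delta_{j0}}F_j$, $[E_i,F_j]=\delta_{ij}(K_i-K_i^{-1})/(q_i-q_i^{-1})$ and the quantum Serre relations. It is a Hopf algebra with $\Delta(E_i)=E_i\otimes1+K_i\otimes E_i$, $\Delta(F_i)=F_i\otimes K_i^{-1}+1\otimes F_i$, and $K_i,D,C^{1/2}$ group-like. By Drinfeld, Beck and Jing it is also generated by $x_{i,r}^\pm,h_{i,k}$ ($i\in I$, $r\in\mathbb Z$, $k\in\mathbb Z\setminus\{0\}$), $K_i^{\pm1}$ ($i\in I$), $C^{\pm1/2},D^{\pm1}$ with the usual relations of Drinfeld's realization, normalised by $[h_{i,r},x_{j,s}^\pm]=\pm\frac1r[ra_{ij}]_iC^{\mp|r|/2}x_{j,r+s}^\pm$, $[x_{i,r}^+,x_{j,s}^-]=\delta_{ij}\frac{C^{(r-s)/2}\psi^+_{i,r+s}-C^{-(r-s)/2}\psi^-_{i,r+s}}{q_i-q_i^{-1}}$,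 $\sum_{r\ge0}\psi^\pm_{i,\pm r}u^{\pm r}=K_i^{\pm1}\exp(\pm(q_i-q_i^{-1})\sum_{s\ge1}h_{i,\pm s}u^{\pm s})$; here $E_i=x_{i,0}^+$, $F_i=x_{i,0}^-$ for $i\in I$. $\widehat{\mathbf U}_q'$ is the (Hopf) subalgebra generated by all $E_i,F_i,K_i^{\pm1}$ ($i\in\widehat I$) and $C^{\pm1/2}$. $M(\Lambda)$, $\Lambda\in\widehat P$, is the Verma module: generated by $m_\Lambda$ of weight $\Lambda$ ($K_im_\Lambda=q_i^{\Lambda(\alpha_i^\vee)}m_\Lambda$, $Dm_\Lambda=q^{\Lambda(d)}m_\Lambda$) with defining relations $E_im_\Lambda=0$, $i\in\widehat I$. $X(\Lambda)$ is its unique simple quotient, also regarded as a $\widehat{\mathbf U}_q'$-module. ($C^{1/2}$ acts by a fixed square root of the scalar by which $C$ acts, enlarging the field by $q^{1/2}$ if needed.) For $\boldsymbol\pi$ as in the claim, $\lambda_{\boldsymbol\pi}=\sum_i(\deg\pi_i)\varpi_i$; $P_{i,\pm r}$ is the coefficient of $u^r$ in $\exp(-\sum_{k\ge1}\frac{q^{\pm k}h_{i,\pm k}}{[k]_i}u^k)$; $\pi_i^+=\pi_i$ and $\pi_i^-(u)=u^{\deg\pi_i}\pi_i(u^{-1})/(\text{leading coefficient of }\pi_i)$, $\pi_i^\pm(u)=\sum_s\pi_{i,s}^\pm u^s$. $W(\boldsymbol\pi)$ is the $\widehat{\mathbf U}_q'$-module generated by $v_{\boldsymbol\pi}$ with relations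 $x_{i,r}^+v_{\boldsymbol\pi}=0$, $(x_{i,r}^-)^{\lambda_{\boldsymbol\pi}(\alpha_i^\vee)+1}v_{\boldsymbol\pi}=0$, $K_iv_{\boldsymbol\pi}=q_i^{\lambda_{\boldsymbol\pi}(\alpha_i^\vee)}v_{\boldsymbol\pi}$, $C^{1/2}v_{\boldsymbol\pi}=v_{\boldsymbol\pi}$, $P_{i,\pm s}v_{\boldsymbol\pi}=\pi^\pm_{i,s}v_{\boldsymbol\pi}$ ($i\in I$, $r\in\mathbb Z$, $s\in\mathbb N$). It is finite-dimensional with a unique simple quotient $V(\boldsymbol\pi)$. *)

(* Defs.v *)
From HB Require Import structures.
From mathcomp Require Import all_boot all_order all_algebra all_fingroup.
From mathcomp Require Import boolp reals.
From mathcomp Require Export complex.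

Set Implicit Arguments.
Unset Strict Implicit.
Unset Printing Implicit Defensive.

Import GRing.Theory.
Local Open Scope ring_scope.

Definition restr (A B : pzRingType) (f : {rmorphism A -> B}) (M : lmodType B) :
  Type := M.

Section Restr.
Variables (A B : pzRingType) (f : {rmorphism A -> B}) (M : lmodType B).

HB.instance Definition _ := GRing.Zmodule.on (restr f M).

Let scale (a : A) (m : restr f M) : restr f M := f a *: (m : M).

Fact restr_scaleA a b m : scale a (scale b m) = scale (a * b) m.
Proof. by rewrite /scale scalerA rmorphM. Qed.
Fact restr_scale1 : left_id 1 scale.
Proof. by move=> m; rewrite /scale rmorph1 scale1r. Qed.
Fact restr_scaleDr : right_distributive scale +%R.
Proof. by move=> a m n; rewrite /scale scalerDr. Qed.
Fact restr_scaleDl m : {morph scale^~ m : a b / a + b}.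
Proof. by move=> a b; rewrite /scale rmorphD scalerDl. Qed.

HB.instance Definition _ := GRing.Zmodule_isLmodule.Build A (restr f M)
  restr_scaleA restr_scale1 restr_scaleDr restr_scaleDl.
End Restr.

(* The vector space underlying a module over a K-algebra. *)
Notation vect A M := (restr (GRing.in_alg A) M).

Section Modules.
Variables (K : fieldType) (A : algType K).
Implicit Types M N T X V : lmodType A.

Definition simple_module M : Prop :=
  (exists m : M, m != 0) /\
  forall N : {pred M}, submod_closed N ->
    (forall m, m \in N -> m = 0) \/ (forall m, m \in N).

Definition fin_dim M : Prop :=
  exists (n : nat) (e : 'I_n -> M),
    forall m : M, exists c : 'I_n -> K, m = \sum_(k < n) (c k)%:A *: e k.

Definition simple_quotient M X : Prop :=
  simple_module X /\
  exists p : {linear M -> X}, forall x : X, exists m : M, p m = x.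

Definition left_ideal (rel : A -> Prop) (u : A) : Prop :=
  exists (n : nat) (a r : 'I_n -> A),
    (forall k, rel (r k)) /\ u = \sum_(k < n) a k * r k.

(* [M] is generated by [m] with defining relations [r *: m = 0] for [rel r]. *)
Definition presented_module (rel : A -> Prop) M (m : M) : Prop :=
  (forall x : M, exists u : A, x = u *: m) /\
  (forall u : A, u *: m = 0 <-> left_ideal rel u).

Definition bilinear_map (X V Z : lmodType K) (b : X -> V -> Z) : Prop :=
  (forall x, linear (b x)) /\ (forall v, linear (b^~ v)).

(* Universal property of the tensor product of [X] and [V] over [K]. *)
Definition tensor_product (X V T : lmodType K) (tau : X -> V -> T) : Prop :=
  bilinear_map tau /\
  forall (Z : lmodType K) (b : X -> V -> Z), bilinear_map b ->
    exists f : {linear T -> Z},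
      (forall x v, f (tau x v) = b x v) /\
      forall f' : {linear T -> Z}, (forall x v, f' (tau x v) = b x v) ->
        f' =1 f.

End Modules.

(* [U] is the algebra with generators [g] and defining relations [rel], where
   [rel B f] says that the family [f] of elements of [B] satisfies them. *)
Definition presented_algebra (K : fieldType) (G : Type)
    (rel : forall B : algType K, (G -> B) -> Prop)
    (U : algType K) (g : G -> U) : Prop :=
  rel U g /\
  forall (B : algType K) (f : G -> B), rel B f ->
    exists phi : {lrmorphism U -> B},
      (forall y, phi (g y) = f y) /\
      forall phi' : {lrmorphism U -> B}, (forall y, phi' (g y) = f y) ->
        phi' =1 phi.

Section Subalgebra.
Variables (K : fieldType) (U : algType K) (G : Type) (g : G -> U).

Definition gen_subalg : {pred U} := fun x =>
  `[< forall S : {pred U}, subalg_closed S -> (forall y, g y \in S) -> x \in S >].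

Fact gen_subalg_closed : GRing.subsemialg_closed gen_subalg.
Proof.
have memE x : reflect (forall S : {pred U}, subalg_closed S ->
    (forall y, g y \in S) -> x \in S) (x \in gen_subalg).
  exact: asboolP.
split.
- by apply/memE => S [].
- split=> [|x y /memE xS /memE yS]; apply/memE => S Scl Sg;
    case: (Scl) => S1 Slin _.
    by rewrite -(addNr (1 : U)) -scaleN1r; apply: Slin.
  by rewrite -[x]scale1r; apply: Slin; [exact: xS|exact: yS].
- move=> a x /memE xS; apply/memE => S Scl Sg.
  case: (Scl) => S1 Slin _.
  have S0 : 0 \in S by rewrite -(addNr (1 : U)) -scaleN1r; apply: Slin.
  by rewrite -[a *: x]addr0; apply: Slin => //; apply: xS.
- move=> x y /memE xS /memE yS; apply/memE => S Scl Sg.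
  by case: (Scl) => _ _; apply; [exact: xS|exact: yS].
Qed.

Fact gen_subalg_gen y : g y \in gen_subalg.
Proof. by apply/asboolP => S _; apply. Qed.

HB.instance Definition _ := GRing.isSubalgClosed.Build K U gen_subalg
  gen_subalg_closed.

Record subalg : Type := Subalg {
  subalg_val : U;
  subalg_valP : subalg_val \in gen_subalg }.

HB.instance Definition _ := [isSub for subalg_val].
HB.instance Definition _ := [Choice of subalg by <:].
HB.instance Definition _ := [SubChoice_isSubAlgebra of subalg by <:].

Definition subalg_gen (y : G) : subalg := Subalg (gen_subalg_gen y).

Definition subalg_incl : {rmorphism subalg -> U} :=
  (\val : {rmorphism subalg -> U}).

End Subalgebra.

Section Cartan.
Variables (l : nat) (A : 'M[int]_l).

Definition symmetrizes n (B : 'M[int]_n) (d : 'I_n -> nat) : Prop :=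
  (forall i, (0 < d i)%N) /\
  forall i j, (d i)%:Z * B i j = (d j)%:Z * B j i.

(* [A] is the Cartan matrix [A i j = alpha_j(alpha_i^vee)] of a
   finite-dimensional complex simple Lie algebra. *)
Definition simple_cartan : Prop :=
  [/\ (0 < l)%N,
      (forall i, A i i = 2),
      (forall i j, i != j -> (A i j <= 0)%R),
      (forall J : {set 'I_l}, J != set0 -> J != setT ->
         exists i j, [/\ i \in J, j \notin J & A i j != 0]) &
      exists d : 'I_l -> nat, symmetrizes A d /\
        forall x : 'rV[int]_l, x != 0 ->
          (0 < \sum_i \sum_j (d i)%:Z * A i j * x 0 i * x 0 j)%R].

(* [root b b'] : [\sum_i b_i alpha_i] is a root, with coroot
   [\sum_i b'_i alpha_i^vee]; every root of a simple Lie algebra is conjugate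
   to a simple one under the Weyl group. *)
Inductive root : 'rV[int]_l -> 'rV[int]_l -> Prop :=
| root_simple i : root (delta_mx 0 i) (delta_mx 0 i)
| root_reflection i b b' : root b b' ->
    root (b - (\sum_j b 0 j * A i j) *: delta_mx 0 i)
         (b' - (\sum_j b' 0 j * A j i) *: delta_mx 0 i).

Definition highest_root (t t' : 'rV[int]_l) : Prop :=
  root t t' /\ forall b b', root b b' -> forall i, (b 0 i <= t 0 i)%R.

(* Cartan matrix of the untwisted affine algebra, from [alpha_0 = delta - theta]
   and [alpha_0^vee = c - theta^vee]. *)
Definition affine_cartan (t t' : 'rV[int]_l) : 'M[int]_l.+1 :=
  \matrix_(i, j)
    match unlift ord0 i, unlift ord0 j with
    | Some i', Some j' => A i' j'
    | Some i', None => - \sum_k t 0 k * A i' k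
    | None, Some j' => - \sum_k t' 0 k * A k j'
    | None, None => 2
    end.

End Cartan.

(* The simple Lie algebra g enters only through these data. *)
Record simple_datum (l : nat) := SimpleDatum {
  cartan : 'M[int]_l;
  theta : 'rV[int]_l;
  theta_check : 'rV[int]_l;
  symd : 'I_l.+1 -> nat;
  simple_datum_cartan : simple_cartan cartan;
  simple_datum_theta : highest_root cartan theta theta_check;
  simple_datum_symd :
    symmetrizes (affine_cartan cartan theta theta_check) symd;
  simple_datum_coprime : \big[gcdn/0%N]_i symd i = 1%N }.

Definition acartan l (g : simple_datum l) : 'M[int]_l.+1 :=
  affine_cartan (cartan g) (theta g) (theta_check g).

(* [Weight n k] is the element [\sum_i n_i omega_i + k delta] of the affine
   weight lattice, whose values at [alpha_i^vee] and [d] are [n_i] and [k]. *)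
Record weight (l : nat) := Weight {
  at_coroot : 'I_l.+1 -> int;
  at_d : int }.

Section Quantum.
Variable K : fieldType.
Implicit Type p : K.

Definition qnum p (n : int) : K := (p ^ n - p ^ (- n)) / (p - p^-1).
Definition qfact p (n : nat) : K := \prod_(k < n) qnum p k.+1%:Z.
Definition qbin p (n k : nat) : K := qfact p n / (qfact p k * qfact p (n - k)).

Variable A : algType K.

(* Integer powers of an element [x] with prescribed inverse [xV]. *)
Definition zpow (x xV : A) (n : int) : A :=
  match n with Posz k => x ^+ k | Negz k => xV ^+ k.+1 end.

(* Coefficient of [u ^ r] in the [n]-th power and in the exponential of
   [\sum_(k >= 1) f k * u ^ k]. *)
Fixpoint ser_pow (f : nat -> A) (n r : nat) : A :=
  if n is n'.+1 then \sum_(1 <= k < r.+1) f k * ser_pow f n' (r - k)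
  else (r == 0%N)%:R.

Definition ser_exp (f : nat -> A) (r : nat) : A :=
  \sum_(n < r.+1) ((n`!)%:R^-1 : K) *: ser_pow f n r.

End Quantum.

Definition comm_br (A : pzRingType) (x y : A) : A := x * y - y * x.

Definition sgn_int (e : bool) : int := if e then 1 else -1.

(* Generators [E_i], [F_i], [K_i], [K_i^-1], [C^(1/2)], [C^(-1/2)] of U'_q. *)
Variant cgen' (l : nat) :=
| GE of 'I_l.+1 | GF of 'I_l.+1 | GK of 'I_l.+1 | GKV of 'I_l.+1 | GC | GCV.

Arguments GC {l}.
Arguments GCV {l}.

(* The generators of U_q : those of U'_q, and [D], [D^-1]. *)
Variant cgen (l : nat) := G' of cgen' l | GD | GDV.

Arguments GD {l}.
Arguments GDV {l}.

(* [DX true i r], [DX false i r] and [DH i k] stand for [x^+_{i,r}],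
   [x^-_{i,r}] and [h_{i,k}]; the spurious [DH i 0] is set to [0] by the
   relations. *)
Variant dgen (l : nat) :=
| DX of bool & 'I_l & int | DH of 'I_l & int
| DK of 'I_l | DKV of 'I_l | DC | DCV | DD | DDV.

Arguments DC {l}.
Arguments DCV {l}.
Arguments DD {l}.
Arguments DDV {l}.

Section QuantumAffine.
Variables (l : nat) (g : simple_datum l) (K : fieldType) (q : K).

Local Notation a := (acartan g).
Local Notation fin i := (lift ord0 i).
Local Notation qq i := (q ^+ symd g i).

Definition chevalley_relations (A : algType K) (f : cgen l -> A) : Prop :=
  let E i := f (G' (GE i)) in
  let F i := f (G' (GF i)) in
  let k i := f (G' (GK i)) in
  let kV i := f (G' (GKV i)) in
  let Ch := f (G' GC) in
  let ChV := f (G' GCV) in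
  let D := f GD in
  let DV := f GDV in
  let serre (x : 'I_l.+1 -> A) i j :=
    let m := `|1 - a i j|%N in
    \sum_(n < m.+1) ((-1) ^+ n * qbin (qq i) m n) *:
       (x i ^+ (m - n) * x j * x i ^+ n) in
  [/\ [/\ (forall i, k i * kV i = 1 /\ kV i * k i = 1),
          D * DV = 1 /\ DV * D = 1,
          Ch * ChV = 1 /\ ChV * Ch = 1,
          (forall y, Ch * f y = f y * Ch) &
          Ch ^+ 2 = k ord0 * \prod_i zpow (k (fin i)) (kV (fin i)) (theta g 0 i)],
      [/\ (forall i j, k i * k j = k j * k i),
          (forall i, D * k i = k i * D),
          (forall i j, k i * E j * kV i = (qq i ^ a i j) *: E j) &
          (forall i j, k i * F j * kV i = (qq i ^ (- a i j)) *: F j)],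
      (forall j, D * E j * DV = (q ^+ (j == ord0)) *: E j /\
                 D * F j * DV = (q ^- (j == ord0)) *: F j),
      (forall i j, comm_br (E i) (F j) =
         if i == j then (qq i - (qq i)^-1)^-1 *: (k i - kV i) else 0) &
      (forall i j, i != j -> serre E i j = 0 /\ serre F i j = 0)].

Section Currents.
Variables (A : algType K) (h : 'I_l -> int -> A).

(* The coefficients [psi^+_{i,r}] and [psi^-_{i,r}], which vanish for [r < 0],
   respectively [r > 0]; [k] and [kV] are the families [K_i] and [K_i^-1]. *)
Variables (k kV : 'I_l -> A).

Definition psi_plus (i : 'I_l) (r : int) : A :=
  if (0 <= r)%R then
    k i * ser_exp (fun s => (qq (fin i) - (qq (fin i))^-1) *: h i s%:Z) `|r|%N
  else 0.

Definition psi_minus (i : 'I_l) (r : int) : A :=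
  if (r <= 0)%R then
    kV i * ser_exp (fun s => - (qq (fin i) - (qq (fin i))^-1) *: h i (- s%:Z))
             `|r|%N
  else 0.

(* [P_{i,r}] for [e = true] and [P_{i,-r}] for [e = false]. *)
Definition Pcoef (e : bool) (i : 'I_l) (r : nat) : A :=
  ser_exp (fun n => - ((q ^ (sgn_int e * n%:Z) / qnum (qq (fin i)) n%:Z) *:
                       h i (sgn_int e * n%:Z))) r.

End Currents.

Definition drinfeld_relations (A : algType K) (f : dgen l -> A) : Prop :=
  let x e i r := f (DX e i r) in
  let h i r := f (DH i r) in
  let k i := f (DK i) in
  let kV i := f (DKV i) in
  let C2 := zpow (f DC) (f DCV) in (* [C2 n] is [C ^ (n / 2)] *)
  let D := f DD in
  let DV := f DDV in
  let b i j := cartan g i j in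
  let p i := qq (fin i) in
  [/\ [/\ (forall i, k i * kV i = 1 /\ kV i * k i = 1),
          D * DV = 1 /\ DV * D = 1,
          f DC * f DCV = 1 /\ f DCV * f DC = 1,
          (forall y, f DC * f y = f y * f DC) &
          (forall i, h i 0 = 0)],
      [/\ (forall i j, k i * k j = k j * k i),
          (forall i, D * k i = k i * D),
          (forall i j r, k i * h j r = h j r * k i),
          (forall e i j r, k i * x e j r * kV i =
                           (p i ^ (sgn_int e * b i j)) *: x e j r) &
          (forall i r, D * h i r * DV = (q ^ r) *: h i r) /\
          (forall e i r, D * x e i r * DV = (q ^ r) *: x e i r)],
      [/\ (forall i j r s, r != 0 -> s != 0 -> comm_br (h i r) (h j s) =
             if r + s == 0 then
               (r%:~R^-1 * qnum (p i) (r * b i j) / (p j - (p j)^-1)) *: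
                 (C2 (2 * r) - C2 (- (2 * r)))
             else 0),
          (forall e i j r s, r != 0 -> comm_br (h i r) (x e j s) =
             ((sgn_int e)%:~R * r%:~R^-1 * qnum (p i) (r * b i j)) *:
               (C2 (- (sgn_int e * `|r|)) * x e j (r + s))) &
          (forall i j r s, comm_br (x true i r) (x false j s) =
             if i == j then
               (p i - (p i)^-1)^-1 *:
                 (C2 (r - s) * psi_plus h k i (r + s) -
                  C2 (- (r - s)) * psi_minus h kV i (r + s))
             else 0)],
      (forall e i j r s,
         x e i (r + 1) * x e j s
           - (p i ^ (sgn_int e * b i j)) *: (x e j s * x e i (r + 1)) =
         (p i ^ (sgn_int e * b i j)) *: (x e i r * x e j (s + 1))
           - x e j (s + 1) * x e i r) &
      (forall e i j, i != j ->
         let m := `|1 - b i j|%N in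
         forall (r : 'I_m -> int) (s : int),
         \sum_(w : 'S_m) \sum_(n < m.+1) ((-1) ^+ n * qbin (p i) m n) *:
           ((\prod_(t < m | (t < n)%N) x e i (r (w t))) * x e j s *
            (\prod_(t < m | (n <= t)%N) x e i (r (w t)))) = 0)].

Variables (U : algType K) (c : cgen l -> U).

Definition quantum_affine : Prop := presented_algebra chevalley_relations c.

Definition Uprime : Type := subalg (c \o @G' l).
HB.instance Definition _ := GRing.Algebra.on Uprime.

Definition cU' (y : cgen' l) : Uprime := subalg_gen (c \o @G' l) y.
Definition incl : {rmorphism Uprime -> U} := subalg_incl (c \o @G' l).

(* The elements [x^+-_{i,r}], [h_{i,k}] of U'_q, together with [K_i], [C^(1/2)]
   and [D], form the generators of Drinfeld's realization of U_q. *)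
Definition drinfeld_gens (x : bool -> 'I_l -> int -> Uprime)
    (h : 'I_l -> int -> Uprime) (y : dgen l) : U :=
  match y with
  | DX e i r => incl (x e i r)
  | DH i r => incl (h i r)
  | DK i => c (G' (GK (fin i)))
  | DKV i => c (G' (GKV (fin i)))
  | DC => c (G' GC)
  | DCV => c (G' GCV)
  | DD => c GD
  | DDV => c GDV
  end.

Definition drinfeld_realization (x : bool -> 'I_l -> int -> Uprime)
    (h : 'I_l -> int -> Uprime) : Prop :=
  [/\ presented_algebra drinfeld_relations (drinfeld_gens x h),
      (forall i, x true i 0 = cU' (GE (fin i))) &
      (forall i, x false i 0 = cU' (GF (fin i)))].

(* [C] acts on the highest weight vector of M(L) by [C_scalar L]. *)
Definition C_scalar (L : weight l) : K :=
  qq ord0 ^ at_coroot L ord0 *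
  \prod_i (qq (fin i) ^ at_coroot L (fin i)) ^ theta g 0 i.

(* Defining relations of M(L), with [C^(1/2)] acting by [s]. *)
Variant verma_relator (L : weight l) (s : K) : U -> Prop :=
| verma_E i : verma_relator L s (c (G' (GE i)))
| verma_K i : verma_relator L s
    (c (G' (GK i)) - (qq i ^ at_coroot L i)%:A)
| verma_D : verma_relator L s (c GD - (q ^ at_d L)%:A)
| verma_C : verma_relator L s (c (G' GC) - s%:A).

Definition verma_module (L : weight l) (s : K) (M : lmodType U) (m : M) : Prop :=
  presented_module (verma_relator L s) m.

Definition poly_minus (F : fieldType) (p : {poly F}) : {poly F} :=
  \poly_(s < size p) (p`_((size p).-1 - s) / lead_coef p).

(* Defining relations of W(pi); the value of [lambda_pi] at [alpha_i^vee] is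
   the degree [(size (pi i)).-1]. *)
Variant weyl_relator (x : bool -> 'I_l -> int -> Uprime)
    (h : 'I_l -> int -> Uprime) (pi : 'I_l -> {poly K}) : Uprime -> Prop :=
| weyl_xp i r : weyl_relator x h pi (x true i r)
| weyl_xm i r : weyl_relator x h pi (x false i r ^+ (size (pi i)).-1.+1)
| weyl_K i : weyl_relator x h pi
    (cU' (GK (fin i)) - (qq (fin i) ^+ (size (pi i)).-1)%:A)
| weyl_C : weyl_relator x h pi (cU' GC - 1)
| weyl_Pp i s : weyl_relator x h pi (Pcoef h true i s - ((pi i)`_s)%:A)
| weyl_Pm i s : weyl_relator x h pi
    (Pcoef h false i s - ((poly_minus (pi i))`_s)%:A).

Definition weyl_module (x : bool -> 'I_l -> int -> Uprime)
    (h : 'I_l -> int -> Uprime) (pi : 'I_l -> {poly K})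
    (W : lmodType Uprime) (w : W) : Prop :=
  presented_module (weyl_relator x h pi) w.

(* [tau] exhibits [T] as the U'_q-module [X (x) V] : the underlying vector space
   is the tensor product, and the generators act through the coproduct. *)
Definition tensor_module (X V T : lmodType Uprime) (tau : X -> V -> T) : Prop :=
  let k i := cU' (GK i) in
  let kV i := cU' (GKV i) in
  [/\ tensor_product (tau : vect Uprime X -> vect Uprime V -> vect Uprime T),
      (forall i x v, cU' (GE i) *: tau x v =
         tau (cU' (GE i) *: x) v + tau (k i *: x) (cU' (GE i) *: v)),
      (forall i x v, cU' (GF i) *: tau x v =
         tau (cU' (GF i) *: x) (kV i *: v) + tau x (cU' (GF i) *: v)),
      (forall i x v, k i *: tau x v = tau (k i *: x) (k i *: v) /\
                     kV i *: tau x v = tau (kV i *: x) (kV i *: v)) &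
      (forall x v, cU' GC *: tau x v = tau (cU' GC *: x) (cU' GC *: v) /\
                   cU' GCV *: tau x v = tau (cU' GCV *: x) (cU' GCV *: v))].

End QuantumAffine.

Notation Cq R := {fraction {poly R[i]}}.
Definition qvar (R : realType) : Cq R := tofrac 'X.

(* [K] is obtained from [F] by adjoining the square root [s] of [z]; thus
   [K] is [F] itself when [z] is a square in [F]. *)
Definition adjoins_sqrt (F K : fieldType) (iota : {rmorphism F -> K})
    (z : F) (s : K) : Prop :=
  s ^+ 2 = iota z /\ forall y : K, exists a b : F, y = iota a + iota b * s.

(* Main.v *)
Require Import Defs.
From HB Require Import structures.
From mathcomp Require Import all_boot all_order all_algebra.
From mathcomp Require Import boolp reals complex.
From mathcomp Require Import ring zify.

(* Both factors are only cut down by elementary [sl_2]-theory, applied to each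
   simple root of the affine algebra.

   On [V] the central element [C = \prod_i K_i ^ theta_i] acts by [1].  If a
   subspace [S] of [V] is stable under all [E_i] and [K_i], then for each [i] the
   sum [w_i] of the [K_i]-weights of [S] is nonnegative, because [E_i ^ k] embeds
   the weight space [-k] into the weight space [k]; since [C = 1] forces
   [\sum_i theta_i w_i = 0], all [w_i] vanish and [S] is stable under the [F_i].
   So [V] is already irreducible for the Borel subalgebra.  For the same reason a
   vector of a finite-dimensional level zero module that is killed by all long
   products of [E_i]'s is killed by every [E_i].

   Let [N <> 0] be a submodule of [X (x) V], and [n] the least length such that [N]
   meets [X_n (x) V], where [X_n] is spanned by the [F]-words of length at most [n]
   applied to the highest weight vector.  Since [K_i^-1 E_i] has coproduct
   [K_i^-1 E_i (x) K_i^-1 + 1 (x) K_i^-1 E_i], the coordinate along a word of length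
   [n] is Borel-linear from [N] to [V]; on a minimal piece of [N] it is bijective.
   The other coordinates, composed with its inverse, are endomorphisms of [V]
   killed by long products of the [ad E_i], hence by every [ad E_i]; this says
   that this piece of [N] lies in [X_0 (x) V].  So [N] contains [m (x) v] for some
   [v <> 0], hence [m (x) V] by Borel irreducibility, hence everything. *)

Set Implicit Arguments.
Unset Strict Implicit.
Unset Printing Implicit Defensive.

Import Order.TTheory GRing.Theory Num.Theory.
Local Open Scope ring_scope.

(** * Weight strings for quantum [sl_2] *)

Section QPowers.
Variables (K : fieldType) (q : K).
Hypotheses (q0 : q != 0) (q_nroot : forall n, (0 < n)%N -> q ^+ n != 1).

Lemma expfz_eq1 (n : int) : (q ^ n == 1) = (n == 0).
Proof.
apply/idP/eqP => [|->]; last by rewrite expr0z.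
case: n => [[|n]|n] //; first by rewrite -exprnP (negbTE (q_nroot _)).
by rewrite NegzE -exprnN invr_eq1 (negbTE (q_nroot _)).
Qed.

Lemma expfz_inj : injective (fun n : int => q ^ n).
Proof.
move=> a b /= ab; apply/eqP; rewrite -subr_eq0 -expfz_eq1 expfzDr // ab.
by rewrite -expfzDr // subrr expr0z.
Qed.

(* [qdiff n / (q - q^-1)] is the quantum integer [n]. *)
Definition qdiff (n : int) : K := q ^ n - q ^ (- n).

Lemma qdiff_eq0 n : (qdiff n == 0) = (n == 0).
Proof.
rewrite /qdiff subr_eq0; apply/eqP/eqP => [/expfz_inj|->]; last by rewrite oppr0.
by move=> /eqP; rewrite -subr_eq0 opprK -mulr2n -mulr_natl mulf_eq0 => /orP[|/eqP].
Qed.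

(** The addition rule for quantum integers behind every string computation: it gives the recursion
    for [strc] and, in [iterE_inj], factors a sum of two structure constants. *)
Lemma qdiffD a b c :
  qdiff a * qdiff (a + c) + qdiff b * qdiff (c - b) =
  qdiff (a + b) * qdiff (a - b + c).
Proof.
have Vx x : q ^ (- x) = (q ^ x)^-1 by rewrite -invr_expz.
rewrite /qdiff !(Vx, expfzDr) //.
have := expfz_neq0 a q0; have := expfz_neq0 b q0; have := expfz_neq0 c q0.
by move=> hc hb ha; field; rewrite ha hb hc.
Qed.
End QPowers.

(* The weight spaces of a [U_q(sl_2)]-module with [q_i = q ^ d] are encoded by
   [wt]; the weight of [y] is [n] when [K_i] acts by [q ^ n]. *)
Section SL2.
Variables (K : fieldType) (q : K).
Hypotheses (q0 : q != 0) (q_nroot : forall n, (0 < n)%N -> q ^+ n != 1).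
Variables (d : nat) (d_gt0 : (0 < d)%N).
Variables (Y : lmodType K) (E F : {linear Y -> Y}) (wt : int -> Y -> Prop).
Hypotheses (wtE : forall n y, wt n y -> wt (n + (2 * d)%:Z) (E y))
  (wtF : forall n y, wt n y -> wt (n - (2 * d)%:Z) (F y))
  (wtD : forall n y z, wt n y -> wt n z -> wt n (y + z))
  (wtZ : forall n a y, wt n y -> wt n (a *: y))
  (EF : forall n y, wt n y ->
     E (F y) - F (E y) = (qdiff q n / qdiff q d%:Z) *: y)
  (B : nat) (wt_bound : forall n y, wt n y -> (B < `|n|)%N -> y = 0).

Let qd := qdiff q.

Let qd0 : qd d%:Z != 0.
Proof. by rewrite /qd qdiff_eq0 // -lt0n. Qed.

(** With quantum integers in [q ^ d] this is $[k][n/d-k+1]$, the factor picked up when [E] moves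
    through [F ^ k] on a singular vector of weight [n]. No division of [n] by [d] occurs, since
    divisibility of weights is itself a consequence ([wt_dvd]). *)
Definition strc (k : nat) (n : int) : K :=
  qd (d * k)%:Z * qd (n - (d * k)%:Z + d%:Z) / qd d%:Z ^+ 2.

Let strcS k n :
  strc k.+1 n = strc k n + qd (n - (2 * d * k)%:Z) / qd d%:Z.
Proof.
rewrite /strc; have := qdiffD q0 (d * k)%:Z d%:Z (n - (2 * d * k)%:Z + d%:Z).
rewrite (_ : (d * k)%:Z + (n - (2 * d * k)%:Z + d%:Z) = n - (d * k)%:Z + d%:Z);
  last by lia.
rewrite (_ : n - (2 * d * k)%:Z + d%:Z - d%:Z = n - (2 * d * k)%:Z); last by lia.
rewrite (_ : (d * k)%:Z + d%:Z = (d * k.+1)%:Z); last by lia.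
rewrite (_ : (d * k)%:Z - d%:Z + (n - (2 * d * k)%:Z + d%:Z) =
   n - (d * k.+1)%:Z + d%:Z); last by lia.
by rewrite -/qd => <-; field.
Qed.

Let strc0 n : strc 0 n = 0.
Proof. by rewrite /strc muln0 /qd /qdiff oppr0 subrr !mul0r. Qed.

Lemma wt_iterE k n y : wt n y -> wt (n + (2 * d * k)%:Z) (iter k E y).
Proof.
move=> yn; elim: k => [|k IHk]; first by rewrite muln0 addr0.
by rewrite mulnS addnC PoszD addrA; apply: wtE.
Qed.

Lemma wt_iterF k n y : wt n y -> wt (n - (2 * d * k)%:Z) (iter k F y).
Proof.
move=> yn; elim: k => [|k IHk]; first by rewrite muln0 subr0.
by rewrite mulnS addnC PoszD opprD addrA; apply: wtF.
Qed.

(** Each commutator adds the weight term of [strcS]; an initial eigenvalue [c] of [F E] merely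
    shifts all structure constants, the highest weight case being [c = 0]. *)
Lemma E_iterF c k n y : wt n y -> F (E y) = c *: y ->
  E (iter k.+1 F y) = (c + strc k.+1 n) *: iter k F y.
Proof.
move=> yn FEy; elim: k => [|k IHk].
  have /eqP := EF yn; rewrite subr_eq FEy -scalerDl => /eqP /= ->.
  by rewrite addrC strcS strc0 add0r muln0 subr0.
have /eqP := EF (wt_iterF k.+1 yn); rewrite subr_eq IHk linearZ -scalerDl.
by rewrite -!iterS => /eqP ->; rewrite [in RHS]strcS [_ / _ + _]addrC addrA.
Qed.

Lemma iterE_F j n y : wt n y ->
  iter j.+1 E (F y) = F (iter j.+1 E y) +
    strc j.+1 (n + (2 * d * j)%:Z) *: iter j E y.
Proof.
move=> yn; elim: j => [|j IHj].
  have /eqP := EF yn; rewrite subr_eq => /eqP /= ->.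
  by rewrite strcS strc0 add0r muln0 addr0 subr0 addrC.
rewrite iterS IHj linearD linearZ /= -!iterS.
have /eqP := EF (wt_iterE j.+1 yn); rewrite subr_eq => /eqP ->.
rewrite addrAC -scalerDl addrC -iterS; congr (_ + _ *: _).
(* The two constants are taken at different weights, so [strcS] does not apply and the addition rule
   is used directly. *)
have := qdiffD q0 d%:Z (d * j.+1)%:Z (n + (2 * d * j.+1)%:Z - d%:Z).
rewrite (_ : d%:Z + _ = n + (2 * d * j.+1)%:Z); last by lia.
rewrite (_ : _ - d%:Z - (d * j.+1)%:Z =
  n + (2 * d * j)%:Z - (d * j.+1)%:Z + d%:Z); last by lia.
rewrite (_ : d%:Z + (d * j.+1)%:Z = (d * j.+2)%:Z); last by lia.
rewrite (_ : d%:Z - (d * j.+1)%:Z + (n + (2 * d * j.+1)%:Z - d%:Z) =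
   n + (2 * d * j.+1)%:Z - (d * j.+2)%:Z + d%:Z); last by lia.
by rewrite -/qd /strc => <-; field.
Qed.

(** Some power of [F] pushes the weight out of the bounded range and so kills [y]; applying [E] then
    strips off the powers of [F] one by one, no factor being zero. *)
Lemma FE_eigen_eq0 c n y : wt n y -> F (E y) = c *: y ->
  (forall k, c + strc k.+1 n != 0) -> y = 0.
Proof.
move=> yn FEy c_neq0.
have : iter (B + `|n|).+1 F y = 0 by apply: (wt_bound (wt_iterF _ yn)); nia.
move: (B + `|n|).+1 => k; elim: k => // k IHk yk; apply: IHk.
have := E_iterF k yn FEy; rewrite yk linear0 => /esym/eqP.
by rewrite scaler_eq0 (negbTE (c_neq0 k)) => /eqP.
Qed.

Let strc_eq0 k n : (strc k.+1 n == 0) = (n == (d * k)%:Z).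
Proof.
rewrite /strc !mulf_eq0 invr_eq0 expf_eq0 /= (negbTE qd0) orbF !qdiff_eq0 //.
rewrite eqz_nat muln_eq0 (gtn_eqF d_gt0) /=; apply/eqP/eqP; lia.
Qed.

Lemma lowest_eq0 n y : wt n y -> F (E y) = 0 -> n < 0 -> y = 0.
Proof.
move=> yn FEy n_lt0; apply: (@FE_eigen_eq0 0 n) => //; first by rewrite scale0r.
by move=> k; rewrite add0r strc_eq0; apply/eqP; lia.
Qed.

(** In weight 0 the commutator vanishes, so [F y] is again killed by [E], yet has negative
    weight. *)
Lemma highest_weight0 y : wt 0 y -> E y = 0 -> F y = 0.
Proof.
move=> y0 Ey; apply: (lowest_eq0 (wtF y0)); last by lia.
have /eqP := EF y0; rewrite Ey linear0 subr0 => /eqP ->.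
by rewrite {1}/qdiff oppr0 subrr mul0r scale0r linear0.
Qed.

Lemma highest_dvd n y : wt n y -> E y = 0 -> ~~ (d%:Z %| n)%Z -> y = 0.
Proof.
move=> yn Ey dn; apply: (@FE_eigen_eq0 0 n) => //.
  by rewrite Ey linear0 scale0r.
by move=> k; rewrite add0r strc_eq0; apply: contra dn => /eqP ->; rewrite PoszM dvdz_mulr.
Qed.

(** The [E]-string of [y] ends, and its last nonzero vector would be a highest vector whose weight
    is still not a multiple of [d], since [E] changes weights by [2 * d]. *)
Lemma wt_dvd n y : wt n y -> ~~ (d%:Z %| n)%Z -> y = 0.
Proof.
move=> yn dn; have : iter (B + `|n|).+1 E y = 0.
  by apply: (wt_bound (wt_iterE _ yn)); nia.
move: (B + `|n|).+1 => j; elim: j n y yn dn => // j IHj n y yn dn.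
rewrite iterSr => Ej; apply: (highest_dvd yn) => //.
apply: (IHj _ _ (wtE yn)) => //; apply: contra dn => h.
by rewrite -[n](addrK (2 * d)%:Z) rpredB // PoszM dvdz_mull.
Qed.

(** The bound [d * j <= w] keeps the target weight at most the opposite weight [w]. By induction on
    [j], a kernel vector is an eigenvector of [F E] whose shifted structure constants are all
    nonzero. *)
Lemma iterE_inj j w y : wt (- w%:Z) y -> (0 < w)%N -> (d * j <= w)%N ->
  iter j E y = 0 -> y = 0.
Proof.
move=> + w_gt0; elim: j y => // j IHj y yw djw Ey.
(* By [iterE_F], this is the scalar for which [E ^ j] kills [F (E y) - c *: y] when [E ^ (j + 1)]
   kills [y]. *)
pose c := strc j (- w%:Z + (2 * d * j)%:Z).
have yw' : wt (- w%:Z) (F (E y) - c *: y).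
  rewrite -scaleNr; apply: wtD; last exact: wtZ.
  by have := wtF (wtE yw); rewrite addrK.
have /eqP : F (E y) - c *: y = 0.
  apply: (IHj _ yw'); first by lia.
  have iterB k a b e : iter k E (a - e *: b) = iter k E a - e *: iter k E b.
    by elim: k => //= k ->; rewrite linearB linearZ.
  rewrite iterB /c; case: j Ey {IHj djw yw' c} => [|j] Ey.
    by rewrite /= in Ey *; rewrite Ey linear0 strc0 scale0r subrr.
  rewrite (iterE_F _ (wtE yw)) -iterSr Ey linear0 add0r -iterSr.
  by rewrite (_ : - w%:Z + _ + _ = - w%:Z + (2 * d * j.+1)%:Z) ?subrr //; lia.
rewrite subr_eq0 => /eqP FEy; apply: (FE_eigen_eq0 yw FEy) => k.
have := qdiffD q0 (d * j)%:Z (d * k.+1)%:Z (d%:Z - w%:Z).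
rewrite /c /strc -/qd => h.
rewrite -mulrDl (_ : - w%:Z + (2 * d * j)%:Z - _ + _ =
  (d * j)%:Z + (d%:Z - w%:Z)); last by lia.
rewrite (_ : - w%:Z - (d * k.+1)%:Z + d%:Z = d%:Z - w%:Z - (d * k.+1)%:Z); last by lia.
rewrite h !mulf_eq0 invr_eq0 expf_eq0 /= (negbTE qd0) orbF !qdiff_eq0 //.
(* The exponents are [d * (j + k + 1)], positive, and [d * (j - k) - w], negative because
   [d * (j + 1) <= w]. *)
rewrite negb_or; apply/andP; split; apply/eqP; nia.
Qed.
End SL2.

(** * Level zero modules over a Borel subalgebra *)

(** Grouped by absolute value, the sum adds up [k] times the excess of the multiplicity of [k] over
    that of [-k], and every such term is nonnegative. *)
Lemma sum_int_sym r (w : 'I_r -> int) :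
  (forall k : nat, (0 < k)%N ->
     (#|[pred t | w t == - k%:Z]| <= #|[pred t | w t == k%:Z]|)%N) ->
  0 <= \sum_t w t /\
  (\sum_t w t = 0 -> forall k : nat, (0 < k)%N ->
     #|[pred t | w t == - k%:Z]| = #|[pred t | w t == k%:Z]|).
Proof.
move=> le_w; pose M := (\max_t `|w t|)%N.
pose c k : int := #|[pred t | w t == k]|%:Z.
have cE k : c k = \sum_t (w t == k)%:Z.
  rewrite /c -sum1_card big_mkcond /= (big_morph Posz PoszD (erefl 0)).
  by apply: eq_bigr => t _; rewrite inE; case: eqP.
have wE t : w t = \sum_(k < M) k.+1%:Z * ((w t == k.+1%:Z)%:Z - (w t == - k.+1%:Z)%:Z).
  have wM : (`|w t| <= M)%N by apply: (leq_bigmax t).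
  have [->|w_neq0] := eqVneq (w t) 0.
    rewrite big1 // => k _; have -> : (0 == k.+1%:Z :> int) = false by [].
    by have -> : (0 == - k.+1%:Z :> int) = false; rewrite ?subrr ?mulr0.
  have wlt : (`|w t|.-1 < M)%N by lia.
  rewrite (bigD1 (Ordinal wlt)) //= big1 ?addr0 => [|k /eqP kw].
    rewrite prednK ?absz_gt0 //; case: (lerP 0 (w t)) => w0.
      have -> : (w t == `|w t|%:Z) = true by apply/eqP; clear -w0; lia.
      have -> : (w t == - `|w t|%:Z) = false by apply/eqP; clear -w0 w_neq0; lia.
      by rewrite subr0 mulr1; clear -w0; lia.
    have -> : (w t == `|w t|%:Z) = false by apply/eqP; clear -w0; lia.
    have -> : (w t == - `|w t|%:Z) = true by apply/eqP; clear -w0; lia.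
    by rewrite sub0r; clear -w0; lia.
  have {}kw : k <> `|w t|.-1 :> nat by move=> kw'; apply: kw; apply: val_inj.
  have -> : (w t == k.+1%:Z) = false by apply/eqP; lia.
  have -> : (w t == - k.+1%:Z) = false by apply/eqP; lia.
  by rewrite subrr mulr0.
have sumE : \sum_t w t = \sum_(k < M) k.+1%:Z * (c k.+1%:Z - c (- k.+1%:Z)).
  rewrite (eq_bigr _ (fun t _ => wE t)) exchange_big; apply: eq_bigr => k _ /=.
  by rewrite -mulr_sumr sumrB !cE.
have ge0 (k : 'I_M) : true -> 0 <= k.+1%:Z * (c k.+1%:Z - c (- k.+1%:Z)).
  by move=> _; rewrite mulr_ge0 // subr_ge0 lez_nat le_w.
split; first by rewrite sumE sumr_ge0.
rewrite sumE => sum0 k k_gt0.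
(* Beyond the largest absolute value both multiplicities are zero; up to it, a vanishing sum of
   nonnegative terms vanishes termwise. *)
have [kM|Mk] := leqP k M; last first.
  have none e : `|e|%N = k -> #|[pred t | w t == e]| = 0%N.
    move=> ek; apply: eq_card0 => t; rewrite !inE; apply/eqP => wt.
    by have := leq_bigmax (F := fun t => `|w t|%N) t; rewrite -/M wt; lia.
  by rewrite !none //; lia.
have kM' : (k.-1 < M)%N by lia.
have /eqP := psumr_eq0P ge0 sum0 (i := Ordinal kM') isT.
rewrite /= prednK // mulf_eq0 eqz_nat -[k == 0%N]negbK -lt0n k_gt0 /= subr_eq0.
by rewrite eqz_nat => /eqP ->.
Qed.

Section LevelZero.
Variables (K : fieldType) (q : K).
Hypotheses (q0 : q != 0) (q_nroot : forall n, (0 < n)%N -> q ^+ n != 1).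
Variables (I : finType) (D theta : I -> nat) (a : I -> I -> int).
Hypotheses (D_gt0 : forall i, (0 < D i)%N) (theta_gt0 : forall i, (0 < theta i)%N)
  (a_diag : forall i, a i i = (2 * D i)%:Z).

(* A finite-dimensional level zero module in a basis of weight vectors, acting
   on row vectors: [K_i] acts on the [t]-th basis vector by [q ^ chi i t]. *)
Variables (d : nat) (e f : I -> 'M[K]_d) (chi : I -> 'I_d -> int).
Hypotheses
  (chi_e : forall i j s t, e j s t != 0 -> chi i t = chi i s + a i j)
  (chi_f : forall i j s t, f j s t != 0 -> chi i t = chi i s - a i j)
  (ef : forall i, f i *m e i - e i *m f i =
     diag_mx (\row_t (qdiff q (chi i t) / qdiff q (D i)%:Z)))
  (level0 : forall t, \sum_i (theta i)%:Z * chi i t = 0).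

Definition kmx i := diag_mx (\row_t q ^ chi i t).
Definition kVmx i := diag_mx (\row_t q ^ (- chi i t)).

Definition wtv i n (v : 'rV[K]_d) := forall t, v 0 t != 0 -> chi i t = n.
Definition wtm i n (phi : 'M[K]_d) :=
  forall s t, phi s t != 0 -> chi i t = chi i s + n.

Let B i := (\max_t `|chi i t|)%N.

Let leB i t : (`|chi i t| <= B i)%N.
Proof. exact: (leq_bigmax t). Qed.

Lemma mulmx_neq0 m n p (u : 'M[K]_(m, n)) (v : 'M[K]_(n, p)) s t :
  (u *m v) s t != 0 -> exists r, u s r != 0 /\ v r t != 0.
Proof.
apply: contraPP => /forallNP uv; apply/negP; rewrite negbK mxE big1 // => r _.
have [->|u0] := eqVneq (u s r) 0; first by rewrite mul0r.
have [->|v0] := eqVneq (v r t) 0; first by rewrite mulr0.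
by case: (uv r).
Qed.

Lemma wtv_e i j n v : wtv i n v -> wtv i (n + a i j) (v *m e j).
Proof. by move=> vn t /mulmx_neq0[s [/vn <- /chi_e ->]]. Qed.
Lemma wtv_f i j n v : wtv i n v -> wtv i (n - a i j) (v *m f j).
Proof. by move=> vn t /mulmx_neq0[s [/vn <- /chi_f ->]]. Qed.

Lemma add_neq0 (x y : K) : x + y != 0 -> x != 0 \/ y != 0.
Proof.
by case: (eqVneq x 0) => [->|]; [rewrite add0r; right|left].
Qed.

Lemma wtv_D i n u v : wtv i n u -> wtv i n v -> wtv i n (u + v).
Proof. by move=> un vn t; rewrite mxE => /add_neq0[/un|/vn]. Qed.
Lemma wtv_Z i n b v : wtv i n v -> wtv i n (b *: v).
Proof. by move=> vn t; rewrite mxE mulf_eq0 negb_or => /andP[_ /vn]. Qed.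
Lemma wtv_bound i n v : wtv i n v -> (B i < `|n|)%N -> v = 0.
Proof.
move=> vn Bn; apply/rowP => t; rewrite mxE; apply/eqP; apply: contraTT Bn.
by move=> /vn <-; rewrite -leqNgt.
Qed.
Lemma wtv_ef i n v : wtv i n v ->
  mulmxr (e i) (mulmxr (f i) v) - mulmxr (f i) (mulmxr (e i) v) =
  (qdiff q n / qdiff q (D i)%:Z) *: v.
Proof.
move=> vn /=; rewrite -!mulmxA -mulmxBr ef; apply/rowP => t.
rewrite mul_mx_diag !mxE mulrC; have [->|/vn <-//] := eqVneq (v 0 t) 0.
by rewrite !mulr0.
Qed.

Lemma wtv_e2 i n v : wtv i n v -> wtv i (n + (2 * D i)%:Z) (mulmxr (e i) v).
Proof. by rewrite -a_diag; apply: wtv_e. Qed.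
Lemma wtv_f2 i n v : wtv i n v -> wtv i (n - (2 * D i)%:Z) (mulmxr (f i) v).
Proof. by rewrite -a_diag; apply: wtv_f. Qed.

Lemma chi_dvd i t : ((D i)%:Z %| chi i t)%Z.
Proof.
have dw : wtv i (chi i t) (delta_mx 0 t).
  by move=> s; rewrite mxE /= ; case: (eqVneq s t) => [-> //|_]; rewrite eqxx.
apply/negP => /negP nd.
have := wt_dvd q0 q_nroot (D_gt0 i) (@wtv_e2 i) (@wtv_f2 i) 
   (@wtv_ef i) (@wtv_bound i) dw nd.
by move/rowP => /(_ t) /eqP; rewrite !mxE !eqxx oner_eq0.
Qed.

Let lez0n (n : nat) : 0 <= n%:Z. Proof. by []. Qed.

(** The restrictions of the commuting diagonal [kmx i] to [S] are simultaneously diagonalizable, and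
    a power of [q] determines its exponent. The index [sg t] is a coordinate in the support of the
    [t]-th vector, so its weights are read off from [chi]. *)
Lemma weight_basis (S : 'M[K]_d) : (forall i, stablemx S (kmx i)) ->
  exists r (b : 'M[K]_(r, d)) (sg : 'I_r -> 'I_d),
    [/\ row_free b, (b :=: S)%MS &
        forall i t s, b t s != 0 -> chi i s = chi i (sg t)].
Proof.
move=> Sk; pose r := \rank S; pose b0 := row_base S.
have b0k i : stablemx b0 (kmx i) by rewrite stablemx_row_base.
have /codiagonalizableP [P Pu Pd] : 
   {in [seq conjmx b0 (kmx i) | i <- enum I] &, forall f g, comm_mx f g} /\
   {in [seq conjmx b0 (kmx i) | i <- enum I], forall f, diagonalizable f}.
  split => [_ _ /mapP[i _ ->] /mapP[j _ ->]|_ /mapP[i _ ->]].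
    rewrite /comm_mx -!conjmxM ?inE //; congr conjmx.
    exact: diag_mxC.
  exact: diagonalizable_conj_diag (b0k i) (row_base_free S).
pose b := P *m b0.
have b_free : row_free b by rewrite /row_free mxrankMfree ?row_base_free // mxrank_unit.
have bD i : exists c : 'rV_r, b *m kmx i = diag_mx c *m b.
  have ik : conjmx b0 (kmx i) \in [seq conjmx b0 (kmx i) | i <- enum I].
    by apply/mapP; exists i; rewrite ?mem_enum.
  have /allP /(_ _ ik) /diagonalizable_forPex := Pd; move=> [c /simmxPp cP].
  exists c; rewrite /b -mulmxA -(mulmxKpV (b0k i)).
  rewrite mulmxA -[b0 *m kmx i *m _]/(conjmx b0 (kmx i)) cP ?mulmxA //.
  by rewrite submx_full // row_full_unit.
have b_neq0 t : exists s, b t s != 0.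
  apply: contrapT => /forallNP bt0.
  have /row_freeP[c bc] := b_free.
  have /matrixP /(_ t t) := bc; rewrite !mxE eqxx big1 => [/esym/eqP|s _].
    by rewrite oner_eq0.
  by have /negP := bt0 s; rewrite negbK => /eqP ->; rewrite mul0r.
have [sg sgP] := choice b_neq0.
exists r, b, sg; split=> // [|i t s bts].
  by apply: eqmx_trans (eq_row_base S); apply: eqmxMfull; rewrite row_full_unit.
have [c bc] := bD i.
have cE s' : b t s' != 0 -> q ^ chi i s' = c 0 t.
  move=> bs'; have /matrixP /(_ t s') := bc.
  by move: bs'; rewrite mul_mx_diag mul_diag_mx !mxE mulrC => bs' h; apply: (mulIf bs').
by apply: (expfz_inj q0 q_nroot); rewrite /= !cE.
Qed.

(** * Stability under a single lowering operator *)

Section OneNode.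
Variables (i : I) (S : 'M[K]_d).
Hypothesis Se : stablemx S (e i).
Let E := mulmxr (e i) : 'rV[K]_d -> 'rV[K]_d.

Let iterES k v : (v <= S)%MS -> (iter k E v <= S)%MS.
Proof. by move=> vS; elim: k => //= k IHk; apply: submx_trans (submxMr _ IHk) Se. Qed.

Let iterEB k u v : iter k E (u - v) = iter k E u - iter k E v.
Proof. by elim: k => //= k ->; rewrite /E /= mulmxBl. Qed.

Let inj k (w : nat) v : wtv i (- w%:Z) v -> (0 < w)%N -> (D i * k <= w)%N ->
  iter k E v = 0 -> v = 0.
Proof.
exact: (iterE_inj q0 q_nroot (D_gt0 i) (@wtv_e2 i) (@wtv_f2 i) (@wtv_D i)
         (@wtv_Z i) (@wtv_ef i) (@wtv_bound i)).
Qed.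

(** Downward induction on the weight. Surjectivity inside [S], with injectivity of [E ^ k] on the
    whole space, lets membership in [S] be tested after raising a negative weight to its opposite
    ([lift]). *)
Lemma f_stable :
  (forall k v, (0 < k)%N -> (v <= S)%MS -> wtv i (D i * k)%:Z v ->
     exists u, [/\ (u <= S)%MS, wtv i (- (D i * k)%:Z) u & v = iter k E u]) ->
  forall n v, (v <= S)%MS -> wtv i n v -> (v *m f i <= S)%MS.
Proof.
move=> surj.
have lift k v : (0 < k)%N -> wtv i (- (D i * k)%:Z) v -> (iter k E v <= S)%MS ->
    (v <= S)%MS.
  move=> k_gt0 vk EvS; have Dk : (0 < D i * k)%N by rewrite muln_gt0 D_gt0.
  have wEv : wtv i (D i * k)%:Z (iter k E v).
    have := wt_iterE (@wtv_e2 i) k vk.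
    by rewrite (_ : - _ + _ = (D i * k)%:Z) //; lia.
  have [u [uS uk Evu]] := surj k _ k_gt0 EvS wEv.
  have /eqP : v - u = 0.
    apply: (@inj k (D i * k)); rewrite ?iterEB ?Evu ?subrr //.
    by rewrite -scaleN1r; apply: wtv_D => //; apply: wtv_Z.
  by rewrite subr_eq0 => /eqP ->.
(* Modulo [S], lowering commutes with the powers of [E] on weight vectors of [S], because the
   commutators are scalars there. *)
have comm k n v : (v <= S)%MS -> wtv i n v ->
    (iter k E v *m f i - iter k E (v *m f i) <= S)%MS.
  move=> vS vn; elim: k => [|k IHk]; first by rewrite subrr sub0mx.
  rewrite !iterS; have xn := wt_iterE (@wtv_e2 i) k vn; rewrite -/E in xn.
  set x := iter k E v in IHk xn *; set y := iter k E _ in IHk *.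
  have /eqP := wtv_ef xn; rewrite subr_eq addrC -subr_eq => /eqP /= <-.
  rewrite addrAC /E /= -mulmxBl addmx_sub //.
    by apply: submx_trans (submxMr _ IHk) Se.
  by rewrite -scaleNr scalemx_sub // iterES.
have EFS n v : (v <= S)%MS -> wtv i n v -> (v *m e i *m f i <= S)%MS ->
    (v *m f i *m e i <= S)%MS.
  move=> vS vn FEv; have /eqP := wtv_ef vn; rewrite subr_eq => /eqP /= ->.
  by rewrite addmx_sub // scalemx_sub.
(* [N] bounds the distance from [n] up to [B i], above which weight vectors vanish. *)
suff main N n v : (B i)%:Z - n < N%:Z -> (v <= S)%MS -> wtv i n v ->
    (v *m f i <= S)%MS.
  by move=> n v; apply: (main (`|(B i)%:Z - n|.+1)%N); lia.
elim: N n v => [|N IHN] n v Nn vS vn.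
  by rewrite (wtv_bound vn) ?mul0mx ?sub0mx //; lia.
have [->|v_neq0] := eqVneq v 0; first by rewrite mul0mx sub0mx.
have /dvdzP [k nk] : ((D i)%:Z %| n)%Z.
  have /existsP[t vt] : [exists t, v 0 t != 0].
    apply: contraNT v_neq0 => /existsPn v0; apply/eqP/rowP => t.
    by rewrite mxE; apply/eqP; rewrite -[_ == _]negbK.
  by rewrite -(vn _ vt) chi_dvd.
have Ev : (v *m f i *m e i <= S)%MS.
  apply: (EFS _ _ vS vn); apply: (IHN (n + (2 * D i)%:Z)); last exact: (wtv_e2 vn).
    by have := D_gt0 i; lia.
  by apply: submx_trans (submxMr _ vS) Se.
(* For [k <= 1] the vector [v *m f i] has negative weight [D i * (k - 2)], and raising it [2 - k]
   times lands in [S] because the first step does ([Ev]). *)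
have [k_le1|k_gt1] := lerP k 1.
  have k2 : (0 < `|2 - k|)%N by lia.
  apply: (lift `|2 - k|%N) => //.
    have := wtv_f2 vn; rewrite (_ : n - _ = - (D i * `|2 - k|)%:Z) //.
    by rewrite (PoszM (D i) `|2 - k|%N) (_ : `|2 - k|%N%:Z = 2 - k) ?nk; lia.
  by rewrite -(prednK k2) iterSr; apply: iterES.
have nkE : n = (D i * `|k|)%:Z by rewrite PoszM (_ : `|k|%N%:Z = k) ?nk; lia.
have k_gt0 : (0 < `|k|)%N by lia.
rewrite nkE in vn; have [u [uS un vE]] := surj _ _ k_gt0 vS vn.
have cu := comm `|k|%N _ _ uS un; rewrite -vE in cu.
(* Here [u *m f i] has weight [- D i * (k + 2)]; raised [k + 1] times it agrees modulo [S] with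
   [v *m f i *m e i], which lies in [S]. *)
have Fu : (u *m f i <= S)%MS.
  apply: (lift `|k|.+2) => //.
    have := wtv_f2 un; rewrite (_ : _ - _ = - (D i * `|k|.+2)%:Z) //; lia.
  rewrite iterS; have -> : iter `|k|.+1 E (u *m f i) =
      v *m f i *m e i - (v *m f i - iter `|k| E (u *m f i)) *m e i.
    by rewrite mulmxBl opprB addrC subrK.
  apply: submx_trans (submxMr _ _) Se; rewrite addmx_sub // eqmx_opp.
  by apply: submx_trans (submxMr _ cu) Se.
by rewrite -[v *m f i](subrK (iter `|k| E (u *m f i))) addmx_sub // iterES.
Qed.
End OneNode.

(** The two cardinals are the dimensions of opposite weight spaces of [S]; [E ^ k] embeds the
    negative one into the positive one, hence is onto when they agree. *)
Lemma card_neg_le i (S : 'M[K]_d) r (b : 'M[K]_(r, d)) (w : 'I_r -> int) k :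
  stablemx S (e i) -> row_free b -> (b :=: S)%MS ->
  (forall t s, b t s != 0 -> chi i s = w t) -> (0 < k)%N ->
  (#|[pred t | w t == - (D i * k)%:Z]| <= #|[pred t | w t == (D i * k)%:Z]|)%N /\
  (#|[pred t | w t == - (D i * k)%:Z]| = #|[pred t | w t == (D i * k)%:Z]| ->
   forall v, (v <= S)%MS -> wtv i (D i * k)%:Z v ->
     exists u, [/\ (u <= S)%MS, wtv i (- (D i * k)%:Z) u &
        v = iter k (mulmxr (e i)) u]).
Proof.
move=> Se b_free bS bw k_gt0; set E := mulmxr (e i).
have Dk : (0 < D i * k)%N by rewrite muln_gt0 D_gt0.
pose A (n : int) := [pred t | w t == n].
pose bA n : 'M[K]_(#|A n|, d) := \matrix_(u < #|A n|) row (enum_val u) b.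
have bAS n : (bA n <= S)%MS.
  by apply/row_subP => u; rewrite rowK -bS row_sub.
have wtA n (c : 'rV_#|A n|) : wtv i n (c *m bA n).
  move=> t /mulmx_neq0[u [_]]; rewrite !mxE => /bw ->.
  by have := enum_valP u; rewrite inE => /eqP.
have bA_free n : row_free (bA n).
  apply/row_freeP; have [c bc] := row_freeP b_free.
  exists (\matrix_(s, u) c s (enum_val u)); apply/matrixP => u u'.
  have /matrixP /(_ (enum_val u) (enum_val u')) := bc.
  rewrite !mxE (inj_eq enum_val_inj) => <-.
  by apply: eq_bigr => s _; rewrite !mxE.
have wtA_sub n v : (v <= S)%MS -> wtv i n v -> (v <= bA n)%MS.
  rewrite -bS => /submxP[c ->] vn.
  have cn t : c 0 t != 0 -> t \in A n.
    move=> ct; apply/negPn/negP; rewrite inE => wt_n.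
    (* [c'] keeps the coordinates of [c] off weight [n]; its combination of the rows of [b] vanishes
       by comparing supports, so freeness kills it. *)
    pose c' := \row_t (c 0 t *+ (w t != n)).
    have : c' *m b = 0.
      apply/rowP => s; have [ns|ns] := eqVneq (chi i s) n.
        rewrite !mxE big1 // => t' _; rewrite !mxE.
        have [->|/bw] := eqVneq (b t' s) 0; first by rewrite mulr0.
        by rewrite ns => ->; rewrite eqxx mul0r.
      have := vn s; have [vs0 _|vs /(_ isT) sn] := eqVneq ((c *m b) 0 s) 0; last first.
        by rewrite sn eqxx in ns.
      rewrite !mxE -[RHS]vs0 mxE; apply: eq_bigr => t' _; rewrite !mxE.
      have [->|/bw wt'] := eqVneq (b t' s) 0; first by rewrite !mulr0.
      by rewrite -wt' ns.
    move/eqP; rewrite -(mul0mx _ b) => /eqP /(row_free_inj b_free) /rowP /(_ t).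
    by rewrite !mxE wt_n => /eqP; rewrite (negbTE ct).
  rewrite mulmx_sum_row summx_sub // => t _.
  have [->|/cn tA] := eqVneq (c 0 t) 0; first by rewrite scale0r sub0mx.
  rewrite scalemx_sub //.
  have -> : row t b = row (enum_rank_in tA t) (bA n) by rewrite rowK enum_rankK_in.
  exact: row_sub.
pose Ek := bA (- (D i * k)%:Z) *m (e i) ^+ k.
have iterE (v : 'rV_d) : iter k E v = v *m (e i) ^+ k.
  elim: (k) => [|j IHj]; first by rewrite expr0 mulmx1.
  by rewrite iterS IHj /E /= exprSr mulmxA.
have expS (v : 'rV_d) j : (v <= S)%MS -> (v *m (e i) ^+ j <= S)%MS.
  move=> vS; elim: j => [|j IHj]; first by rewrite expr0 mulmx1.
  by rewrite exprSr mulmxA; apply: submx_trans (submxMr _ IHj) Se.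
have Ek_free : row_free Ek.
  apply: inj_row_free => c; rewrite mulmxA -iterE => Ec.
  apply: (row_free_inj (bA_free (- (D i * k)%:Z))); rewrite /= mul0mx.
  exact: (iterE_inj q0 q_nroot (D_gt0 i) (@wtv_e2 i) (@wtv_f2 i) (@wtv_D i)
    (@wtv_Z i) (@wtv_ef i) (@wtv_bound i) (wtA _ c) Dk (leqnn _) Ec).
have Ek_sub : (Ek <= bA (D i * k)%:Z)%MS.
  apply/row_subP => u; rewrite row_mul -iterE rowE.
  apply: wtA_sub.
    by rewrite iterE -rowE; apply/expS/(submx_trans (row_sub _ _))/bAS.
  have := wt_iterE (@wtv_e2 i) k (wtA (- (D i * k)%:Z) (delta_mx 0 u)).
  by rewrite (_ : - _ + _ = (D i * k)%:Z) //; lia.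
have rkA n : \rank (bA n) = #|A n| by apply/eqP; apply: bA_free.
have [le_rk eq_rk] := mxrank_leqif_sup Ek_sub.
have rkE : \rank Ek = #|A (- (D i * k)%:Z)| by apply/eqP; apply: Ek_free.
rewrite rkE rkA in le_rk eq_rk; split=> // eqA v vS vk.
move: eq_rk; rewrite [X in X == _]eqA eqxx => /esym sub_Ek.
have /submxP[c ->] := submx_trans (wtA_sub _ _ vS vk) sub_Ek.
exists (c *m bA (- (D i * k)%:Z)); split; first exact: mulmx_sub.
  exact: wtA.
by rewrite iterE mulmxA.
Qed.

Theorem borel_irreducible :
  (forall S : 'M[K]_d,
     (forall i, [/\ stablemx S (e i), stablemx S (f i) & stablemx S (kmx i)]) ->
     S != 0 -> row_full S) ->
  forall S : 'M[K]_d,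
    (forall i, stablemx S (e i) /\ stablemx S (kmx i)) -> S != 0 -> row_full S.
Proof.
move=> irr S Sek; apply: irr => i.
have Sk j : stablemx S (kmx j) by case: (Sek j).
have Se j : stablemx S (e j) by case: (Sek j).
have [r [b [sg [b_free bS bsg]]]] := weight_basis Sk.
pose w j t := chi j (sg t).
have sym j : 0 <= \sum_t w j t /\ (\sum_t w j t = 0 -> forall k : nat, (0 < k)%N ->
     #|[pred t | w j t == - k%:Z]| = #|[pred t | w j t == k%:Z]|).
  (* Weights are multiples of [D j], so for any other [k] the multiplicity of [-k] is zero. *)
  apply: sum_int_sym => k k_gt0; have [/dvdnP[m km]|ndk] := boolP (D j %| k)%N.
    have m_gt0 : (0 < m)%N by move: k_gt0; rewrite km muln_gt0 => /andP[].
    rewrite km mulnC.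
    by have [] := card_neg_le (Se j) b_free bS (bsg j) m_gt0.
  rewrite eq_card0 // => t; rewrite !inE; apply/eqP => wt.
  by have := chi_dvd j (sg t); rewrite -/(w j t) wt dvdzE abszN /= (negbTE ndk).
(* Level zero at each basis vector makes the [theta]-weighted sum of these nonnegative integers
   vanish, with positive coefficients. *)
have w0 j : \sum_t w j t = 0.
  have : \sum_j (theta j)%:Z * (\sum_t w j t) = 0.
    under eq_bigr do rewrite mulr_sumr.
    by rewrite exchange_big big1 // => t _; apply: level0.
  move/psumr_eq0P => /(_ (fun j _ => mulr_ge0 (lez0n (theta j)) (sym j).1) j isT).
  by move/eqP; rewrite mulf_eq0 eqz_nat -[_ == 0%N]negbK -lt0n theta_gt0 => /eqP.
split=> //; apply: (submx_trans (submxMr (f i) _)).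
  by rewrite -bS; apply: submx_refl.
apply/row_subP => t; rewrite row_mul.
apply: (f_stable (Se i) _ (n := w i t)); last 2 first.
- by rewrite -bS row_sub.
- by move=> s; rewrite mxE => /bsg.
move=> k v k_gt0 vS vk.
have [_ surj] := card_neg_le (Se i) b_free bS (bsg i) k_gt0.
by apply: surj => //; apply: (sym i).2 => //; rewrite muln_gt0 D_gt0.
Qed.

(** * The adjoint action on endomorphisms *)

Definition cjmx i (phi : 'M[K]_d) := kVmx i *m phi *m kmx i.
(** In operator notation these are $E\phi-K\phi K^{-1}E$ and $(F\phi-\phi F)K$, the adjoint action
    given by the coproduct and its antipode. Products appear reversed because matrices act on row
    vectors. *)
Definition adE i phi := phi *m e i - e i *m cjmx i phi.
Definition adF i phi := kmx i *m (phi *m f i - f i *m phi).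

Fact adE_linear i : linear (adE i).
Proof.
move=> c u v; rewrite /adE /cjmx !(mulmxDl, mulmxDr, =^~ scalemxAl, =^~ scalemxAr).
by rewrite scalerBr opprD addrACA.
Qed.
HB.instance Definition _ i :=
  GRing.isLinear.Build K 'M[K]_d 'M[K]_d _ (adE i) (adE_linear i).

Fact adF_linear i : linear (adF i).
Proof.
move=> c u v.
rewrite /adF !(mulmxDl, mulmxDr, mulmxN, =^~ scalemxAl, =^~ scalemxAr).
by apply/matrixP => s t; rewrite !mxE; ring.
Qed.
HB.instance Definition _ i :=
  GRing.isLinear.Build K 'M[K]_d 'M[K]_d _ (adF i) (adF_linear i).

Let cjmxE i phi s t : cjmx i phi s t = q ^ (chi i t - chi i s) * phi s t.
Proof.
by rewrite /cjmx mul_mx_diag mul_diag_mx !mxE mulrC mulrA -expfzDr.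
Qed.

Lemma cjmx_wt i n phi : wtm i n phi -> cjmx i phi = q ^ n *: phi.
Proof.
move=> phin; apply/matrixP => s t; rewrite cjmxE mxE.
have [->|/phin ->] := eqVneq (phi s t) 0; first by rewrite !mulr0.
by rewrite [chi i s + n]addrC addrK.
Qed.

Lemma wtm_D i n u v : wtm i n u -> wtm i n v -> wtm i n (u + v).
Proof. by move=> un vn s t; rewrite mxE => /add_neq0[/un|/vn]. Qed.
Lemma wtm_Z i n b v : wtm i n v -> wtm i n (b *: v).
Proof. by move=> vn s t; rewrite mxE mulf_eq0 negb_or => /andP[_ /vn]. Qed.

Lemma wtm_adE i j n phi : wtm j n phi -> wtm j (n + a j i) (adE i phi).
Proof.
move=> phin; rewrite /adE -scaleN1r; apply: wtm_D; last apply: wtm_Z.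
  by move=> s t /mulmx_neq0[r [/phin + /chi_e ->]] => ->; rewrite addrA.
move=> s t /mulmx_neq0[r [/chi_e er]]; rewrite cjmxE mulf_eq0 negb_or.
by move=> /andP[_ /phin ->]; rewrite (er j) addrAC addrA.
Qed.

Lemma wtm_adF i j n phi : wtm j n phi -> wtm j (n - a j i) (adF i phi).
Proof.
move=> phin s t; rewrite /adF mul_diag_mx mxE mulf_eq0 negb_or => /andP[_].
move: s t; rewrite -/(wtm j (n - a j i) _) -scaleN1r; apply: wtm_D; last apply: wtm_Z.
  by move=> s t /mulmx_neq0[r [/phin + /chi_f ->]] => ->; rewrite addrA.
by move=> s t /mulmx_neq0[r [/chi_f er /phin ->]]; rewrite (er j) addrAC addrA.
Qed.

Lemma wtm_bound i n phi : wtm i n phi -> (2 * B i < `|n|)%N -> phi = 0.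
Proof.
move=> phin Bn; apply/matrixP => s t; rewrite mxE; apply/eqP; apply: contraTT Bn.
by move=> /phin st; have := leB i s; have := leB i t; lia.
Qed.

(** This makes the string lemmas applicable to endomorphisms, whose weights are differences of
    weights of the module. *)
Lemma ad_ef i n phi : wtm i n phi ->
  adE i (adF i phi) - adF i (adE i phi) = (qdiff q n / qdiff q (D i)%:Z) *: phi.
Proof.
move=> phin; rewrite {1}/adE (cjmx_wt (wtm_adF phin)) a_diag.
have ek : e i *m kmx i = q ^ (2 * D i)%:Z *: (kmx i *m e i).
  apply/matrixP => s t; rewrite mul_mx_diag mul_diag_mx !mxE.
  have [->|/(chi_e i) ->] := eqVneq (e i s t) 0; first by rewrite !(mul0r, mulr0).
  by rewrite a_diag expfzDr //; ring.
rewrite /adF -scalemxAr [e i *m _]mulmxA ek -scalemxAl scalerA -expfzDr // subrK.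
rewrite -mulmxA -[kmx i *m e i *m _]mulmxA scalemxAr -!mulmxBr /adE (cjmx_wt phin).
have h := ef i; set hd := diag_mx _ in h.
have -> : (phi *m f i - f i *m phi) *m e i -
    q ^ n *: (e i *m (phi *m f i - f i *m phi)) -
    ((phi *m e i - e i *m (q ^ n *: phi)) *m f i -
     f i *m (phi *m e i - e i *m (q ^ n *: phi))) = phi *m hd - q ^ n *: (hd *m phi).
  rewrite -h !(mulmxBl, mulmxBr) -!scalemxAr -!scalemxAl !mulmxA !scalerBr.
  by apply/matrixP => s t; rewrite !mxE; ring.
apply/matrixP => s t; rewrite mul_diag_mx /hd mul_mx_diag mul_diag_mx !mxE.
have [->|/phin ->] := eqVneq (phi s t) 0; first by rewrite !(mul0r, mulr0, subr0).
set c := (qdiff q (D i)%:Z)^-1; rewrite /qdiff -!invr_expz !expfzDr //.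
have := expfz_neq0 n q0; have := expfz_neq0 (chi i s) q0 => hs hn.
by field; rewrite hs hn.
Qed.

Let wtm_f2 i n phi : wtm i n phi -> wtm i (n - (2 * D i)%:Z) (adF i phi).
Proof. by rewrite -a_diag; apply: wtm_adF. Qed.

Let ad_lowest i n phi : wtm i n phi -> adF i (adE i phi) = 0 -> n < 0 -> phi = 0.
Proof.
exact: (lowest_eq0 q0 q_nroot (D_gt0 i) (@wtm_f2 i)
  (@ad_ef i) (@wtm_bound i)).
Qed.

(** A singular vector has nonnegative weights by [lowest_eq0]; level zero then forces all of them to
    be zero, and [highest_weight0] applies. *)
Lemma ad_singular (n : I -> int) phi : (forall i, wtm i (n i) phi) ->
  (forall i, adE i phi = 0) -> phi != 0 ->
  (forall i, n i = 0) /\ (forall i, adF i phi = 0).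
Proof.
move=> phin Ephi phi_neq0.
have n_ge0 i : 0 <= n i.
  rewrite leNgt; apply: contra phi_neq0 => n_lt0; apply/eqP.
  by apply: (ad_lowest (phin i)) => //; rewrite Ephi linear0.
have [s [t st]] : exists s t, phi s t != 0.
  apply: contrapT => h; case/eqP: phi_neq0; apply/matrixP => s t; rewrite mxE.
  by apply/eqP/negPn/negP => st; apply: h; exists s, t.
have n0 i : n i = 0.
  have : \sum_i (theta i)%:Z * n i = 0.
    transitivity (\sum_i (theta i)%:Z * chi i t - \sum_i (theta i)%:Z * chi i s).
      rewrite -sumrB; apply: eq_bigr => j _.
      by rewrite (phin j _ _ st) -mulrBr [_ + n j]addrC addrK.
    by rewrite !level0 subrr.
  move/psumr_eq0P => /(_ (fun j _ => mulr_ge0 (lez0n (theta j)) (n_ge0 j)) i isT).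
  by move/eqP; rewrite mulf_eq0 eqz_nat -[_ == 0%N]negbK -lt0n theta_gt0 => /eqP.
split=> // i; have phi0 : wtm i 0 phi by rewrite -[0](n0 i).
exact: (highest_weight0 q0 q_nroot (D_gt0 i) (@wtm_f2 i) (@ad_ef i)
  (@wtm_bound i) phi0 (Ephi i)).
Qed.

(** A nonzero [adE i phi] would be singular, hence of weight zero and killed by [adF i]. Then [phi]
    has [i]-weight [- 2 * D i], so it vanishes by [lowest_eq0]. *)
Lemma ad_socle (n : I -> int) phi : (forall i, wtm i (n i) phi) ->
  (forall i j, adE j (adE i phi) = 0) -> forall i, adE i phi = 0.
Proof.
move=> phin EEphi i; apply/eqP/negPn/negP => Ephi.
have Ephin j : wtm j (n j + a j i) (adE i phi) by apply: wtm_adE.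
have [n0 FE0] := ad_singular Ephin (EEphi i) Ephi.
suff phi0 : phi = 0 by rewrite phi0 linear0 eqxx in Ephi.
apply: (ad_lowest (phin i)) => //.
by have := n0 i; rewrite a_diag; have := D_gt0 i; lia.
Qed.

(** Among matrices whose rows satisfy [P], one of maximal rank absorbs every vector satisfying
    [P]. *)
Lemma subspace_mx (P : 'rV[K]_d -> Prop) : P 0 ->
  (forall c u v, P u -> P v -> P (c *: u + v)) ->
  exists S : 'M[K]_d, forall v, P v <-> (v <= S)%MS.
Proof.
move=> P0 Plin.
pose Q := fun r : nat =>
  `[< exists S : 'M[K]_d, (forall s, P (row s S)) /\ \rank S = r >].
have Q0 : exists r, Q r.
  exists 0%N; apply/asboolP; exists 0; split; last exact: mxrank0.
  by move=> s; rewrite linear0.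
have Qd r : Q r -> (r <= d)%N by move/asboolP => [S [_ <-]]; apply: rank_leq_row.
case: (ex_maxnP Q0 Qd) => r /asboolP[S [PS rS]] Smax.
have PS' u : (u <= S)%MS -> P u.
  move=> /submxP[c ->]; rewrite mulmx_sum_row.
  elim/big_ind: _ => // [x y Px Py|s _]; first by rewrite -[x]scale1r; apply: Plin.
  by rewrite -[_ *: _]addr0; apply: Plin.
exists S => v; split=> [Pv|]; last exact: PS'.
have SvS : (S <= S + v)%MS by rewrite addsmxSl.
have [le_rk eq_rk] := mxrank_leqif_sup SvS.
have Q' : Q (\rank (S + v)%MS).
  apply/asboolP; exists (S + v)%MS; split=> // s.
  have /sub_addsmxP[[u1 u2] ->] : (row s (S + v)%MS <= S + v)%MS by apply: row_sub.
  rewrite -[_ *m S]scale1r; apply: (Plin); first exact/PS'/submxMl.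
  by rewrite [u2]mx11_scalar mul_scalar_mx -[_ *: _]addr0; apply: Plin.
have := Smax _ Q'; rewrite -rS => le_rk'.
have : (S + v <= S)%MS by rewrite -eq_rk eqn_leq le_rk.
by apply: submx_trans; rewrite addsmxSr.
Qed.

Lemma borel_irreducible_pred :
  (forall S : 'M[K]_d,
     (forall i, [/\ stablemx S (e i), stablemx S (f i) & stablemx S (kmx i)]) ->
     S != 0 -> row_full S) ->
  forall P : 'rV[K]_d -> Prop, P 0 ->
    (forall c u v, P u -> P v -> P (c *: u + v)) ->
    (forall i v, P v -> P (v *m e i)) -> (forall i v, P v -> P (v *m kmx i)) ->
    (exists2 v, v != 0 & P v) -> forall v, P v.
Proof.
move=> irr P P0 Plin Pe Pk [v0 v0_neq0 Pv0] v.
have [S SP] := subspace_mx P0 Plin.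
have full : row_full S.
  apply: (borel_irreducible irr) => [i|].
    by split; apply/row_subP => s; rewrite row_mul; apply/SP;
      [apply: Pe|apply: Pk]; apply/SP; apply: row_sub.
  by apply: contra v0_neq0 => /eqP S0; rewrite -submx0 -S0; apply/SP.
by apply/SP; apply: submx_full.
Qed.

Hypothesis irr : forall S : 'M[K]_d,
  (forall i, [/\ stablemx S (e i), stablemx S (f i) & stablemx S (kmx i)]) ->
  S != 0 -> row_full S.

Let kVk i : kVmx i *m kmx i = 1%:M.
Proof.
apply/matrixP => s t; rewrite mul_diag_mx !mxE; case: eqVneq => [->|]; last by rewrite mulr0.
by rewrite -expfzDr // addNr.
Qed.

(* [z : 'M_(p, d)] stands for the tensor [\sum_(s, j) z s j * (y_s (x) v_j)],
   where [y] is a basis, adapted to the length filtration, of a Borel-stable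
   subspace of [X], [eps i] is the matrix of [K_i^-1 E_i] in this basis, and [NM]
   is a subspace stable under [Delta(K_i^-1 E_i)] and [Delta(K_i)]. *)
Section Socle.
Variables (p : nat) (eps : I -> 'M[K]_p) (kap : I -> 'rV[K]_p) (len : 'I_p -> nat).
Variables (n : nat) (NM : 'M[K]_(p, d) -> Prop).
Hypotheses (eps_len : forall i s u, eps i s u != 0 -> (len u < len s)%N)
  (len_le : forall s, (len s <= n)%N)
  (kap_neq0 : forall i s, kap i 0 s != 0)
  (NM_lin : forall c z z', NM z -> NM z' -> NM (c *: z + z'))
  (NM_e : forall i z, NM z ->
     NM ((eps i)^T *m z *m kVmx i + z *m e i *m kVmx i))
  (NM_k : forall i z, NM z -> NM (diag_mx (kap i) *m z *m kmx i))
  (NM_top : forall z, NM z -> (forall s, len s = n -> row s z = 0) -> z = 0)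
  (z0 : 'M[K]_(p, d)) (NMz0 : NM z0) (z0_neq0 : z0 != 0).

Let NM0 : NM 0.
Proof. by rewrite -(addNr z0) -scaleN1r; apply: NM_lin. Qed.

(** The conclusion says that every [K_i^-1 E_i] kills the [X]-coordinates of [z]. The induction runs
    over the endomorphisms [phi s] describing all coordinates of an element in terms of one top
    coordinate. *)
Lemma socle : exists2 z, NM z /\ z != 0 & forall i, (eps i)^T *m z = 0.
Proof.
pose NJ (J : {set 'I_p}) z := NM z /\ forall s, s \in J -> len s = n -> row s z = 0.
pose Q (J : {set 'I_p}) := `[< exists2 z, z != 0 & NJ J z >].
have Q0 : Q set0 by apply/asboolP; exists z0 => //; split=> // s; rewrite inE.
(* A largest set of top coordinates that can vanish on a nonzero element; [NJ J] then plays the role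
   of a minimal submodule. *)
pose J := [arg max_(J > set0 | Q J) #|J|].
have [QJ Jmax] : Q J /\ forall J', Q J' -> (#|J'| <= #|J|)%N.
  by rewrite /J; case: arg_maxnP.
have {Q0 QJ}/asboolP[z1 z1_neq0 NJz1] := QJ.
have [t lent z1t] : exists2 t, len t = n & row t z1 != 0.
  apply: contrapT => h; case/eqP: z1_neq0; apply: NM_top; first by case: NJz1.
  move=> s ls; apply/eqP/negPn/negP => z1s; apply: h; by exists s.
have tJ : t \notin J by apply: contra z1t => tJ; rewrite NJz1.2.
(* By maximality of [J], no further top coordinate can vanish on a nonzero element. *)
have NJ_inj z : NJ J z -> row t z = 0 -> z = 0.
  move=> [NMz zJ] zt; apply/eqP/negPn/negP => z_neq0.
  have : Q (t |: J).
    apply/asboolP; exists z => //; split=> // s; rewrite !inE => /orP[/eqP ->//|].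
    exact: zJ.
  by move/Jmax; rewrite cardsU1 tJ ltnn.
have NJ_lin c z z' : NJ J z -> NJ J z' -> NJ J (c *: z + z').
  move=> [NMz zJ] [NMz' zJ']; split; first exact: NM_lin.
  by move=> s sJ ls; rewrite linearP /= zJ // zJ' // scaler0 addr0.
(* Since [eps i] strictly lowers length, it contributes nothing to top coordinates, where only the
   action on [V] remains. *)
have eps_top i z s : len s = n -> row s ((eps i)^T *m z *m kVmx i) = 0.
  move=> ls; rewrite -mulmxA row_mul -tr_col (_ : col s (eps i) = 0) ?trmx0 ?mul0mx //.
  apply/colP => u; rewrite !mxE; apply/eqP/negPn/negP => /eps_len.
  by rewrite ls ltnNge len_le.
have NJ_e i z : NJ J z -> NJ J ((eps i)^T *m z *m kVmx i + z *m e i *m kVmx i).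
  move=> [NMz zJ]; split=> [|s sJ ls]; first exact: NM_e.
  by rewrite linearD /= eps_top // add0r -mulmxA row_mul zJ ?mul0mx.
have row_kap i s z : row s (diag_mx (kap i) *m z *m kmx i) =
    kap i 0 s *: (row s z *m kmx i).
  by rewrite -mulmxA row_mul row_diag_mx -scalemxAl -rowE -row_mul.
have NJ_k i z : NJ J z -> NJ J (diag_mx (kap i) *m z *m kmx i).
  move=> [NMz zJ]; split=> [|s sJ ls]; first exact: NM_k.
  by rewrite row_kap zJ // mul0mx scaler0.
have onto v : exists z, NJ J z /\ row t z = v.
  move: v; apply: (borel_irreducible_pred irr).
  - by exists 0; split; [split=> // s _ _; rewrite linear0|rewrite linear0].
  - move=> c _ _ [u [NJu <-]] [u' [NJu' <-]]; exists (c *: u + u').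
    by rewrite linearP; split; first exact: NJ_lin.
  - move=> i _ [u [NJu <-]].
    pose u1 := (eps i)^T *m u *m kVmx i + u *m e i *m kVmx i.
    (* Acting further by [Delta(K_i)] and rescaling undoes the factor [K_i^-1] in row [t]. *)
    exists ((kap i 0 t)^-1 *: (diag_mx (kap i) *m u1 *m kmx i)); split.
      rewrite -[_ *: _]addr0; apply: NJ_lin; first exact/NJ_k/NJ_e.
      by split=> // s _ _; rewrite linear0.
    rewrite linearZ /= row_kap scalerA mulVf // scale1r linearD /= eps_top // add0r.
    by rewrite !row_mul -[_ *m kVmx i *m _]mulmxA kVk mulmx1.
  - move=> i _ [u [NJu <-]].
    exists ((kap i 0 t)^-1 *: (diag_mx (kap i) *m u *m kmx i)); split.
      rewrite -[_ *: _]addr0; apply: NJ_lin; first exact/NJ_k.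
      by split=> // s _ _; rewrite linear0.
    by rewrite linearZ /= row_kap scalerA mulVf // scale1r.
  - by exists (row t z1) => //; exists z1.
have [lft lftP] := choice onto.
have lft_uniq z v : NJ J z -> row t z = v -> z = lft v.
  have [NJv tv] := lftP v => NJz zv; apply/eqP; rewrite -subr_eq0; apply/eqP.
  rewrite addrC -scaleN1r; apply: NJ_inj; first exact: NJ_lin.
  by rewrite linearP /= tv zv scaleN1r addNr.
pose phi s : 'M[K]_d := \matrix_j row s (lft (delta_mx 0 j)).
have lftE v s : row s (lft v) = v *m phi s.
  have <- : \sum_j v 0 j *: lft (delta_mx 0 j) = lft v.
    apply: lft_uniq; last first.
      rewrite linear_sum [RHS]row_sum_delta; apply: eq_bigr => j _.
      by rewrite linearZ /= (lftP _).2.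
    elim/big_ind: _ => [|x y xJ yJ|j _].
    - by split=> // s' _ _; rewrite linear0.
    - by rewrite -[x]scale1r; apply: NJ_lin.
    rewrite -[_ *: _]addr0; apply: NJ_lin; first exact: (lftP _).1.
    by split=> // s' _ _; rewrite linear0.
  rewrite linear_sum mulmx_sum_row; apply: eq_bigr => j _.
  by rewrite linearZ /= rowK.
clearbody phi.
(* [Delta(K_i^-1 E_i)] sends [lft v] to the lift of [v *m e i *m kVmx i]; the formula compares the
   [s]-th rows of both. *)
have adE_phi i s : adE i (phi s) = - \sum_u eps i u s *: phi u.
  apply/eqP; rewrite -addr_eq0; apply/eqP/row_matrixP => j; rewrite row0 rowE.
  set v := delta_mx 0 j.
  have := lft_uniq _ (v *m e i *m kVmx i) (NJ_e i _ (lftP v).1).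
  rewrite linearD /= eps_top // add0r !row_mul (lftP v).2 => /(_ erefl).
  move/(congr1 (fun z => row s (z *m kmx i))).
  rewrite mulmxDl -!mulmxA kVk !mulmx1 linearD /= !row_mul lftE.
  rewrite !lftE => h.
  rewrite mulmxDr mulmx_sumr /adE mulmxBr /cjmx.
  have -> : v *m (e i *m (kVmx i *m phi s *m kmx i)) =
      v *m (e i *m kVmx i) *m phi s *m kmx i by rewrite !mulmxA.
  rewrite -h [row s _ *m _]mulmx_sum_row mulmxA opprD addrCA subrr addr0 addrC.
  apply/eqP; rewrite subr_eq0; apply/eqP; apply: eq_bigr => u _.
  by rewrite lftE -scalemxAr !mxE.
(* Compatibility with [Delta(K_i)] makes [phi s] a simultaneous weight vector, whose weights any
   nonzero entry reveals. *)
have phi_wt s : exists w, forall i, wtm i (w i) (phi s).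
  have [->|/eqP phi_neq0] := eqVneq (phi s) 0.
    by exists (fun=> 0) => i s' t'; rewrite mxE eqxx.
  have [s1 [t1 st1]] : exists s1 t1, phi s s1 t1 != 0.
    apply: contrapT => h; apply: phi_neq0; apply/matrixP => s' t'; rewrite [RHS]mxE.
    by apply/eqP/negPn/negP => st; apply: h; exists s', t'.
  have cjphi i : kmx i *m phi s = ((kap i 0 t)^-1 * kap i 0 s) *: (phi s *m kmx i).
    apply/row_matrixP => j; rewrite !rowE; set v := delta_mx 0 j.
    have NJv : NJ J ((kap i 0 t)^-1 *: (diag_mx (kap i) *m lft v *m kmx i)).
      rewrite -[_ *: _]addr0; apply: NJ_lin; first exact/NJ_k/(lftP v).1.
      by split=> // s' _ _; rewrite linear0.
    have := lft_uniq _ (v *m kmx i) NJv.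
    rewrite linearZ /= row_kap (lftP v).2 scalerA mulVf // scale1r => /(_ erefl).
    move/(congr1 (row s)); rewrite linearZ /= row_kap !lftE scalerA.
    by rewrite -scalemxAr !mulmxA => ->.
  exists (fun i => chi i t1 - chi i s1) => i s' t' st'.
  have cE s2 t2 : phi s s2 t2 != 0 ->
      q ^ (chi i s2 - chi i t2) = (kap i 0 t)^-1 * kap i 0 s.
    move=> st2; have /matrixP /(_ s2 t2) := cjphi i.
    rewrite mul_diag_mx mul_mx_diag !mxE mulrCA mulrC => /(mulfI st2).
    by move=> h; rewrite expfzDr // h -invr_expz mulfK // expfz_neq0.
  have := cE _ _ st'; rewrite -(cE _ _ st1) => /(expfz_inj q0 q_nroot).
  by lia.
(* Downward induction on length: [adE i (phi s)] involves only [phi u] with [u] longer than [s],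
   which are already singular, so [ad_socle] applies. *)
have ad_phi0 k s : (n - len s < k)%N -> forall i, adE i (phi s) = 0.
  elim: k s => // k IHk s ks.
  have [w wP] := phi_wt s; apply: (ad_socle wP) => i j.
  rewrite adE_phi linearN linear_sum big1 ?oppr0 // => u _.
  have [->|/eps_len su] := eqVneq (eps i u s) 0; first by rewrite scale0r linear0.
  rewrite linearZ /= IHk ?scaler0 //.
  by have := len_le u; have := len_le s; lia.
exists z1; first by case: NJz1.
(* [z1] is the lift of its own row [t], so the [s]-th row below is minus that row times
   [adE i (phi s)]. *)
move=> i; rewrite (lft_uniq _ _ NJz1 erefl); apply/row_matrixP => s.
rewrite row0 row_mul mulmx_sum_row.
rewrite (eq_bigr (fun u => row t z1 *m (eps i u s *: phi u))); last first.
  by move=> u _; rewrite lftE -scalemxAr !mxE.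
rewrite -mulmx_sumr -[X in _ *m X]opprK -adE_phi.
by rewrite (ad_phi0 (n - len s).+1) // oppr0 mulmx0.
Qed.
End Socle.
End LevelZero.

(** * Tensor products of a highest weight and a level zero module *)

Section LinearFamilies.
Variables (K : fieldType) (Z : lmodType K).

Definition lfree n (y : 'I_n -> Z) :=
  forall c : 'I_n -> K, \sum_i c i *: y i = 0 -> forall i, c i = 0.

Lemma lfree_inj n (y : 'I_n -> Z) (b c : 'I_n -> K) : lfree y ->
  \sum_i b i *: y i = \sum_i c i *: y i -> forall i, b i = c i.
Proof.
move=> y_free /eqP; rewrite -subr_eq0 -sumrB => /eqP bc i; apply/eqP.
rewrite -subr_eq0; apply/eqP; apply: (y_free (fun i => b i - c i)).
by rewrite -[RHS]bc; apply: eq_bigr => j _; rewrite scalerBl.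
Qed.

(** The basis is returned through its labels, so that basis vectors of [X] keep their [F]-words. *)
Lemma basis_extraction (L : eqType) (ev : L -> Z) (s : seq L) :
  exists n (w : 'I_n -> L), [/\ forall i, w i \in s, lfree (ev \o w) &
    forall x, x \in s -> exists c : 'I_n -> K, ev x = \sum_i c i *: ev (w i)].
Proof.
elim: s => [|x s [n [w [ws wfree wspan]]]].
  by exists 0%N, (fun i : 'I_0 => False_rect L (notF (ltn_ord i)));
    split=> [[]//|c _ []//|].
have [[b xb]|x_nspan] := pselect (exists c : 'I_n -> K, ev x = \sum_i c i *: ev (w i)).
  exists n, w; split=> // [i|z]; first by rewrite inE ws orbT.
  by rewrite inE => /orP[/eqP ->|/wspan//]; exists b.
exists n.+1, (fun i => oapp w x (unlift ord0 i)); split.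
- by move=> i; case: unliftP => [j|] _ /=; rewrite inE ?ws ?orbT ?eqxx.
- move=> c; rewrite big_ord_recl /= unlift_none /=.
  under eq_bigr do rewrite liftK /=.
  move=> c0; have c00 : c ord0 = 0.
    apply: contrapT => /eqP c_neq0; apply: x_nspan.
    exists (fun i => - (c ord0)^-1 * c (lift ord0 i)).
    move: c0 => /eqP; rewrite addr_eq0 => /eqP c0.
    rewrite -[LHS]scale1r -(mulVf c_neq0) -scalerA c0 scalerN -scaleNr scaler_sumr.
    by apply: eq_bigr => i _; rewrite scalerA.
  move: c0; rewrite c00 scale0r add0r => /wfree c0 i.
  by case: (unliftP ord0 i) => [j ->|-> //]; apply: c0.
move=> z; rewrite inE => /orP[/eqP ->|/wspan [c zc]].
  exists (fun i => (i == ord0)%:R); rewrite big_ord_recl unlift_none scale1r /=.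
  by rewrite big1 ?addr0 // => i _; rewrite scale0r.
exists (fun i => oapp c 0 (unlift ord0 i)).
rewrite big_ord_recl unlift_none scale0r add0r zc.
by apply: eq_bigr => i _; rewrite liftK.
Qed.

Lemma linear_sumZ (Z' : lmodType K) (f : Z -> Z') (J : Type) (r : seq J)
    (c : J -> K) (y : J -> Z) : linear f ->
  f (\sum_(j <- r) c j *: y j) = \sum_(j <- r) c j *: f (y j).
Proof.
move=> lin_f; have f0 : f 0 = 0.
  by have := lin_f (-1) 0 0; rewrite !scaleN1r !addNr.
by elim/big_rec2: _ => // j u v _ <-; rewrite lin_f.
Qed.
End LinearFamilies.

Section TensorSimple.
Variables (K : fieldType) (q : K).
Hypotheses (q0 : q != 0) (q_nroot : forall n, (0 < n)%N -> q ^+ n != 1).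
Variables (I : finType) (D theta : I -> nat) (a : I -> I -> int).
Hypotheses (D_gt0 : forall i, (0 < D i)%N) (theta_gt0 : forall i, (0 < theta i)%N)
  (a_diag : forall i, a i i = (2 * D i)%:Z).

Variables (V : lmodType K) (EV FV KV KVV : I -> {linear V -> V}).
Variables (d : nat) (v : 'I_d -> V) (chi : I -> 'I_d -> int).
Hypotheses (v_free : lfree v)
  (v_span : forall x, exists c : 'I_d -> K, x = \sum_t c t *: v t)
  (KV_v : forall i t, KV i (v t) = q ^ chi i t *: v t)
  (KVV_v : forall i t, KVV i (v t) = q ^ (- chi i t) *: v t)
  (KEV : forall i j x, KV i (EV j x) = q ^ a i j *: EV j (KV i x))
  (KFV : forall i j x, KV i (FV j x) = q ^ (- a i j) *: FV j (KV i x))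
  (EFV : forall i x, EV i (FV i x) - FV i (EV i x) =
     (qdiff q (D i)%:Z)^-1 *: (KV i x - KVV i x))
  (level0 : forall t, \sum_i (theta i)%:Z * chi i t = 0)
  (V_irr : forall P : V -> Prop, P 0 -> (forall c x y, P x -> P y -> P (c *: x + y)) ->
     (forall i x, P x -> [/\ P (EV i x), P (FV i x), P (KV i x) & P (KVV i x)]) ->
     (exists2 x, x != 0 & P x) -> forall x, P x).

(** * Matrices of the action on [V] *)

Let rho (c : 'rV[K]_d) : V := \sum_t c 0 t *: v t.

Let rho_linear : linear rho.
Proof.
move=> b x y; rewrite /rho scaler_sumr -big_split; apply: eq_bigr => t _ /=.
by rewrite !mxE scalerDl scalerA.
Qed.

Let rho0 : rho 0 = 0.
Proof. by apply: big1 => t _; rewrite mxE scale0r. Qed.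

Let rhoZ b x : rho (b *: x) = b *: rho x.
Proof. by rewrite -[b *: x]addr0 rho_linear rho0 addr0. Qed.

Let rhoB x y : rho (x - y) = rho x - rho y.
Proof.
have -> : x - y = -1 *: y + x by rewrite scaleN1r addrC.
by rewrite rho_linear scaleN1r addrC.
Qed.

Let rho_inj : injective rho.
Proof. by move=> x y /(lfree_inj v_free) xy; apply/rowP. Qed.

Let coP : exists co : V -> 'rV[K]_d, forall x, rho (co x) = x.
Proof.
suff /choice[co coP] : forall x, exists c, rho c = x by exists co.
move=> x; have [c ->] := v_span x; exists (\row_t c t).
by apply: eq_bigr => t _; rewrite mxE.
Qed.

Let co := projT1 (cid coP).
Let coK x : rho (co x) = x. Proof. exact: (projT2 (cid coP)). Qed.
Let rhoK c : co (rho c) = c. Proof. by apply: rho_inj; rewrite coK. Qed.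
Let co_linear : linear co.
Proof. by move=> b x y; apply: rho_inj; rewrite rho_linear !coK. Qed.

Let e i : 'M[K]_d := \matrix_t co (EV i (v t)).
Let f i : 'M[K]_d := \matrix_t co (FV i (v t)).

Let rho_mul (A : {linear V -> V}) c :
  rho (c *m \matrix_t co (A (v t))) = A (rho c).
Proof.
rewrite mulmx_sum_row (linear_sumZ _ _ _ rho_linear) {2}/rho.
rewrite (linear_sumZ _ _ _ (fun b x y => linearP A b x y)).
by apply: eq_bigr => t _; rewrite rowK coK.
Qed.

Let k := kmx q chi.
Let kV := kVmx q chi.

Let kE i : k i = \matrix_t co (KV i (v t)).
Proof.
apply/row_matrixP => t; rewrite rowK KV_v row_diag_mx mxE; apply: rho_inj.
rewrite coK /rho (bigD1 t) //= big1 ?addr0 => [|s /negbTE st].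
  by rewrite !mxE !eqxx mulr1.
by rewrite !mxE st andbF mulr0 scale0r.
Qed.

Let kVE i : kV i = \matrix_t co (KVV i (v t)).
Proof.
apply/row_matrixP => t; rewrite rowK KVV_v row_diag_mx mxE; apply: rho_inj.
rewrite coK /rho (bigD1 t) //= big1 ?addr0 => [|s /negbTE st].
  by rewrite !mxE !eqxx mulr1.
by rewrite !mxE st andbF mulr0 scale0r.
Qed.

Let rho_e c i : rho (c *m e i) = EV i (rho c). Proof. exact: rho_mul. Qed.
Let rho_f c i : rho (c *m f i) = FV i (rho c). Proof. exact: rho_mul. Qed.
Let rho_k c i : rho (c *m k i) = KV i (rho c). Proof. by rewrite kE rho_mul. Qed.
Let rho_kV c i : rho (c *m kV i) = KVV i (rho c). Proof. by rewrite kVE rho_mul. Qed.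

Let mx_eq (A B : 'M[K]_d) : (forall c, rho (c *m A) = rho (c *m B)) -> A = B.
Proof.
by move=> AB; apply/row_matrixP => t; rewrite !rowE; apply: rho_inj; apply: AB.
Qed.

Let chi_e i j s t : e j s t != 0 -> chi i t = chi i s + a i j.
Proof.
move=> est; have ek : e j *m k i = q ^ a i j *: (k i *m e j).
  apply: mx_eq => c; rewrite mulmxA rho_k rho_e KEV -rho_k -rho_e -scalemxAr mulmxA.
  by rewrite rhoZ.
have /matrixP /(_ s t) := ek; move: est; rewrite mul_mx_diag mul_diag_mx !mxE.
move=> est h; apply: (expfz_inj q0 q_nroot); rewrite expfzDr //.
by apply: (mulfI est); rewrite h; ring.
Qed.

Let chi_f i j s t : f j s t != 0 -> chi i t = chi i s - a i j.
Proof.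
move=> est; have ek : f j *m k i = q ^ (- a i j) *: (k i *m f j).
  apply: mx_eq => c; rewrite mulmxA rho_k rho_f KFV -rho_k -rho_f -scalemxAr mulmxA.
  by rewrite rhoZ.
have /matrixP /(_ s t) := ek; move: est; rewrite mul_mx_diag mul_diag_mx !mxE.
move=> est h; apply: (expfz_inj q0 q_nroot); rewrite expfzDr //.
by apply: (mulfI est); rewrite h; ring.
Qed.

Let ef i : f i *m e i - e i *m f i =
  diag_mx (\row_t (qdiff q (chi i t) / qdiff q (D i)%:Z)).
Proof.
have -> : diag_mx (\row_t (qdiff q (chi i t) / qdiff q (D i)%:Z)) =
    (qdiff q (D i)%:Z)^-1 *: (k i - kV i).
  apply/matrixP => s t; rewrite !mxE /qdiff -mulrnBl mulrnAr.
  by rewrite [_^-1 * _]mulrC.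
apply: mx_eq => c; rewrite -scalemxAr rhoZ !mulmxBr !rhoB !mulmxA.
by rewrite !(rho_e, rho_f) EFV rho_k rho_kV.
Qed.

Let kkV i : k i *m kV i = 1%:M.
Proof.
apply/matrixP => s t; rewrite mul_diag_mx !mxE; case: eqVneq => [->|]; last by rewrite mulr0.
by rewrite -expfzDr // subrr.
Qed.

Let irr (S : 'M[K]_d) :
  (forall i, [/\ stablemx S (e i), stablemx S (f i) & stablemx S (kmx q chi i)]) ->
  S != 0 -> row_full S.
Proof.
move=> Sst S_neq0; pose P x := (co x <= S)%MS.
have PV x : P x.
  apply: (V_irr (P := P)).
  - by rewrite /P -rho0 rhoK sub0mx.
  - by move=> b y z Py Pz; rewrite /P co_linear addmx_sub ?scalemx_sub.
  - move=> i y Py; have [Se Sf Sk] := Sst i.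
    (* [k i] maps [S] into itself without loss of rank, hence onto itself, so its inverse preserves
       [S]. *)
    have SkV : stablemx S (kV i).
      have Sk' : (S <= S *m k i)%MS.
        have [_ <-] := mxrank_leqif_sup Sk; rewrite mxrankMfree //.
        by apply/row_freeP; exists (kV i); apply: kkV.
      by apply: submx_trans (submxMr _ Sk') _; rewrite -mulmxA kkV mulmx1.
    by rewrite /P -(coK y) -rho_e -rho_f -rho_k -rho_kV !rhoK; split;
      apply: submx_trans (submxMr _ Py) _.
  have [t St] : exists t, row t S != 0.
    apply: contrapT => /forallNP h; case/eqP: S_neq0; apply/row_matrixP => t.
    by rewrite row0; apply/eqP/negPn/negP/h.
  exists (rho (row t S)); last by rewrite /P rhoK row_sub.
  by apply: contra St => /eqP r0; rewrite -(rhoK (row t S)) r0 -rho0 rhoK.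
rewrite -sub1mx; apply/row_subP => t.
by rewrite -(rhoK (row t 1%:M)); apply: PV.
Qed.

(** * The highest weight factor and its filtration by word length *)

Variables (X : lmodType K) (EX FX KX KVX : I -> {linear X -> X}) (HX : {linear X -> X}).
Variables (m : X) (kap : I -> seq I -> K) (hh : K) (N0 : nat).

Definition Fword (w : seq I) : X := foldr (fun i => FX i) m w.

Definition XL (n : nat) (x : X) : Prop := exists r : seq (K * seq I),
  (forall b, b \in r -> (size b.2 <= n)%N) /\ x = \sum_(b <- r) b.1 *: Fword b.2.

Hypotheses (X_span : forall x, exists n, XL n x)
  (KX_word : forall i w, KX i (Fword w) = kap i w *: Fword w)
  (kap_neq0 : forall i w, kap i w != 0)
  (KVKX : forall i x, KVX i (KX i x) = x) (KKVX : forall i x, KX i (KVX i x) = x)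
  (hh_neq0 : hh != 0) (N0_gt0 : (0 < N0)%N)
  (HX_word : forall w, HX (Fword w) = (hh * q ^ (- (N0 * size w)%:Z)) *: Fword w)
  (HX_E : forall i x, HX (EX i x) = q ^ N0%:Z *: EX i (HX x))
  (HX_KV : forall i x, HX (KVX i x) = KVX i (HX x))
  (EX_m : forall i, EX i m = 0)
  (EX_word : forall i w, XL (size w) (EX i (Fword w)))
  (X_singular : forall x, (forall i, EX i x = 0) -> exists b, x = b *: m)
  (m_neq0 : m != 0).

Lemma XL_lin n c x y : XL n x -> XL n y -> XL n (c *: x + y).
Proof.
move=> [r [rn ->]] [r' [rn' ->]].
exists ([seq (c * b.1, b.2) | b <- r] ++ r'); split=> [b|].
  by rewrite mem_cat => /orP[/mapP[b' /rn + ->]|/rn'].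
rewrite big_cat big_map scaler_sumr; congr (_ + _).
by apply: eq_bigr => b _; rewrite scalerA.
Qed.

Lemma XL0 n : XL n 0.
Proof. by exists [::]; rewrite big_nil. Qed.

Lemma XL_word n w : (size w <= n)%N -> XL n (Fword w).
Proof.
by move=> wn; exists [:: (1, w)]; split=> [b|]; rewrite ?inE ?big_seq1 ?scale1r // => /eqP ->.
Qed.

Lemma XL_sum n (J : eqType) (r : seq J) (c : J -> K) (y : J -> X) :
  (forall j, j \in r -> c j != 0 -> XL n (y j)) -> XL n (\sum_(j <- r) c j *: y j).
Proof.
elim: r => [|j r IHr] yn; first by rewrite big_nil; apply: XL0.
have tl : XL n (\sum_(j <- r) c j *: y j).
  by apply: IHr => i ir; apply: yn; rewrite inE ir orbT.
rewrite big_cons; have [->|cj] := eqVneq (c j) 0; first by rewrite scale0r add0r.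
by apply: XL_lin => //; apply: yn; rewrite ?inE ?eqxx.
Qed.

Lemma XL_le n n' x : (n <= n')%N -> XL n x -> XL n' x.
Proof.
by move=> nn' [r [rn ->]]; exists r; split=> // b /rn /leq_trans; apply.
Qed.

Lemma XL_EX n i x : XL n x -> XL n (EX i x).
Proof.
move=> [r [rn ->]]; rewrite (linear_sumZ _ _ _ (fun b x y => linearP (EX i) b x y)).
by apply: XL_sum => b br _; apply: (XL_le (rn b br)); apply: EX_word.
Qed.

Lemma KVX_word i w : KVX i (Fword w) = (kap i w)^-1 *: Fword w.
Proof.
by rewrite -[in RHS](KVKX i (Fword w)) KX_word linearZ scalerA mulVf // scale1r.
Qed.

Lemma XL_KVX n i x : XL n x -> XL n (KVX i x).
Proof.
move=> [r [rn ->]]; rewrite (linear_sumZ _ _ _ (fun b x y => linearP (KVX i) b x y)).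
apply: XL_sum => b br _; rewrite KVX_word -[_ *: _]addr0.
by apply: XL_lin; [exact: XL_word (rn b br)|exact: XL0].
Qed.

Lemma XL_basis n : exists p (w : 'I_p -> seq I),
  [/\ forall s, (size (w s) <= n)%N, lfree (Fword \o w) &
   forall x, XL n x -> exists c : 'I_p -> K, x = \sum_s c s *: Fword (w s)].
Proof.
pose ws := flatten [seq [seq val t | t <- enum {: j.-tuple I}] | j <- iota 0 n.+1].
have wsP w : (w \in ws) = (size w <= n)%N.
  apply/flatten_mapP/idP => [[j]|wn].
    by rewrite mem_iota ltnS => jn /mapP[t _ ->]; rewrite size_tuple.
  exists (size w); first by rewrite mem_iota ltnS.
  by apply/mapP; exists (in_tuple w); rewrite ?mem_enum.
have [p [w [w_ws w_free w_span]]] := basis_extraction Fword ws.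
exists p, w; split=> // [s|x [r [rn ->]]]; first by rewrite -wsP.
elim: r rn => [|b r IHr] rn.
  by exists (fun=> 0); rewrite big_nil big1 // => s _; rewrite scale0r.
have [|c cP] := IHr; first by move=> b' br; apply: rn; rewrite inE br orbT.
have [|c' c'P] := w_span b.2; first by rewrite wsP rn // inE eqxx.
exists (fun s => b.1 * c' s + c s); rewrite big_cons cP c'P scaler_sumr -big_split.
by apply: eq_bigr => s _; rewrite scalerDl scalerA.
Qed.

(** * The tensor product in coordinates *)

Variables (T : lmodType K) (tau : X -> V -> T) (ET FT KT KVT : I -> {linear T -> T}).
Hypotheses (T_tensor : tensor_product tau)
  (ET_tau : forall i x y, ET i (tau x y) = tau (EX i x) y + tau (KX i x) (EV i y))
  (FT_tau : forall i x y, FT i (tau x y) = tau (FX i x) (KVV i y) + tau x (FV i y))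
  (KT_tau : forall i x y, KT i (tau x y) = tau (KX i x) (KV i y))
  (KVT_tau : forall i x y, KVT i (tau x y) = tau (KVX i x) (KVV i y)).

Let tau_r x : linear (tau x). Proof. by case: T_tensor => [[]]. Qed.
Let tau_l y : linear (tau^~ y). Proof. by case: T_tensor => [[]]. Qed.
Let tau_r0 x : tau x 0 = 0.
Proof. by have := tau_r x (-1) 0 0; rewrite !scaleN1r !addNr. Qed.
Let tau_l0 y : tau 0 y = 0.
Proof. by have := tau_l y (-1) 0 0; rewrite !scaleN1r !addNr. Qed.
Let tau_rZ x b y : tau x (b *: y) = b *: tau x y.
Proof. by rewrite -[b *: y]addr0 tau_r tau_r0 addr0. Qed.
Let tau_lZ x b y : tau (b *: x) y = b *: tau x y.
Proof. by rewrite -[b *: x]addr0 tau_l tau_l0 addr0. Qed.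

(** [T] is known only through its universal property, which here yields the component in [X] along
    the basis vector [v t]. *)
Let coord_exists t : exists ft : {linear T -> X}, forall x y, ft (tau x y) = co y 0 t *: x.
Proof.
have [_ /(_ X (fun x y => co y 0 t *: x))] := T_tensor.
case=> [|ft [ftP _]]; last by exists ft.
split=> [x b y z|y b x z]; first by rewrite co_linear !mxE scalerDl scalerA.
by rewrite scalerDr !scalerA mulrC.
Qed.

Let ft t := projT1 (cid (coord_exists t)).
Let ft_tau t x y : ft t (tau x y) = co y 0 t *: x.
Proof. exact: (projT2 (cid (coord_exists t))). Qed.

Let recon_fun z := \sum_t tau (ft t z) (v t).
Let recon_linear : linear recon_fun.
Proof.
move=> b z z'; rewrite /recon_fun scaler_sumr -big_split; apply: eq_bigr => t _ /=.
by rewrite linearP tau_l.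
Qed.
HB.instance Definition _ := GRing.isLinear.Build K T T _ recon_fun recon_linear.

(** The reassembled map and the identity agree on pure tensors, so both are the unique linear map
    induced by [tau]. *)
Let recon z : \sum_t tau (ft t z) (v t) = z.
Proof.
have [_ /(_ T tau)] := T_tensor; case=> [|g [gP g_uniq]]; first by case: T_tensor.
have -> : \sum_t tau (ft t z) (v t) = g z.
  apply: (g_uniq recon_fun) => x y /=; rewrite /recon_fun.
  rewrite -[in RHS](coK y) /rho (linear_sumZ _ _ _ (tau_r x)).
  by apply: eq_bigr => t _; rewrite ft_tau tau_lZ.
by rewrite -(g_uniq idfun).
Qed.

Lemma tau_neq0 x y : x != 0 -> y != 0 -> tau x y != 0.
Proof.
move=> x_neq0 y_neq0; have [t yt] : exists t, co y 0 t != 0.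
  apply: contrapT => /forallNP h; case/eqP: y_neq0; rewrite -(coK y) -rho0.
  congr rho; apply/rowP => t; rewrite [RHS]mxE.
  by apply/eqP/negPn/negP/h.
apply/negP => /eqP xy; have := ft_tau t x y; rewrite xy linear0 => /esym/eqP.
by rewrite scaler_eq0 (negbTE yt) (negbTE x_neq0).
Qed.

Variable N : T -> Prop.
Hypotheses (N_lin : forall b z z', N z -> N z' -> N (b *: z + z'))
  (N_st : forall i z, N z -> [/\ N (ET i z), N (FT i z), N (KT i z) & N (KVT i z)])
  (N_neq0 : exists2 z, z != 0 & N z).

Let N0' : N 0.
Proof. by have [z _ Nz] := N_neq0; rewrite -(addNr z) -scaleN1r; apply: N_lin. Qed.

(** The extra [K_i^-1] removes the torus operator on [X] from the second summand, which thus acts on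
    [V] alone. *)
Let KVET_tau i x y : KVT i (ET i (tau x y)) =
  tau (KVX i (EX i x)) (KVV i y) + tau x (KVV i (EV i y)).
Proof. by rewrite ET_tau linearD !KVT_tau KVKX. Qed.

Section Coordinates.
Variables (p : nat) (y : 'I_p -> X) (y_free : lfree y).

Let theta_T (z : 'M[K]_(p, d)) : T := \sum_s \sum_t z s t *: tau (y s) (v t).

Let theta_linear : linear theta_T.
Proof.
move=> b z z'; rewrite /theta_T scaler_sumr -big_split; apply: eq_bigr => s _ /=.
rewrite scaler_sumr -big_split; apply: eq_bigr => t _ /=.
by rewrite !mxE scalerDl scalerA.
Qed.

Let coV t s : co (v t) 0 s = (s == t)%:R.
Proof.
rewrite (_ : v t = rho (delta_mx 0 t)) ?rhoK ?mxE ?eqxx //.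
rewrite /rho (bigD1 t) //= big1 ?addr0 ?mxE ?eqxx ?scale1r // => r /negbTE rt.
by rewrite mxE rt andbF scale0r.
Qed.

Let ft_theta t z : ft t (theta_T z) = \sum_s z s t *: y s.
Proof.
rewrite linear_sum; apply: eq_bigr => s _; rewrite linear_sum (bigD1 t) //=.
rewrite big1 ?addr0 => [|r /negbTE rt]; rewrite linearZ /= ft_tau coV.
  by rewrite eqxx scale1r.
by rewrite eq_sym rt scale0r scaler0.
Qed.

Let thetaE z : theta_T z = \sum_t tau (\sum_s z s t *: y s) (v t).
Proof. by rewrite -[LHS]recon; apply: eq_bigr => t _; rewrite ft_theta. Qed.

Let theta_eq0 z : theta_T z = 0 -> z = 0.
Proof.
move=> z0; apply/matrixP => s t; rewrite [RHS]mxE; move: s.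
have /y_free : \sum_s z s t *: y s = 0 by rewrite -ft_theta z0 linear0.
exact.
Qed.

Let theta_eps i (eps : 'M[K]_p) z :
  (forall s, KVX i (EX i (y s)) = \sum_u eps s u *: y u) ->
  theta_T (eps^T *m z *m kV i + z *m e i *m kV i) = KVT i (ET i (theta_T z)).
Proof.
move=> epsP; rewrite -[X in X + _]scale1r theta_linear scale1r.
rewrite [theta_T z]thetaE !linear_sum /= thetaE.
under [RHS]eq_bigr do rewrite KVET_tau.
rewrite big_split; congr (_ + _).
  apply: eq_bigr => t _; rewrite KVV_v tau_rZ -tau_lZ; congr tau.
  rewrite (linear_sumZ _ _ _ (fun b x y => linearP (EX i) b x y)).
  rewrite (linear_sumZ _ _ _ (fun b x y => linearP (KVX i) b x y)).
  under [in RHS]eq_bigr do rewrite epsP scaler_sumr.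
  rewrite exchange_big scaler_sumr; apply: eq_bigr => u _ /=.
  rewrite scaler_sumr /kV /kVmx mul_mx_diag !mxE mulr_suml scaler_suml.
  apply: eq_bigr => s _; rewrite !mxE !scalerA; congr (_ *: _); ring.
transitivity (\sum_t \sum_r (e i *m kV i) t r *: tau (\sum_s z s t *: y s) (v r)).
  rewrite thetaE [RHS]exchange_big; apply: eq_bigr => r _ /=.
  rewrite -(linear_sumZ _ _ _ (tau_l (v r))); congr tau.
  under eq_bigr do rewrite -mulmxA mxE scaler_suml.
  rewrite exchange_big; apply: eq_bigr => t _; rewrite scaler_sumr.
  by apply: eq_bigr => s _; rewrite scalerA mulrC.
apply: eq_bigr => t _; rewrite -(linear_sumZ _ _ _ (tau_r _)); congr tau.
rewrite -[v t]coK -rho_e -rho_kV -mulmxA.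
have -> : co (v t) = delta_mx 0 t by apply/rowP => r; rewrite coV !mxE eqxx.
by rewrite -rowE; apply: eq_bigr => r _; rewrite [in RHS]mxE.
Qed.

Let theta_kap i (kp : 'rV[K]_p) z : (forall s, KX i (y s) = kp 0 s *: y s) ->
  theta_T (diag_mx kp *m z *m k i) = KT i (theta_T z).
Proof.
move=> kpP; rewrite [theta_T z]thetaE linear_sum /= thetaE.
apply: eq_bigr => t _; rewrite KT_tau KV_v tau_rZ -tau_lZ; congr tau.
rewrite (linear_sumZ _ _ _ (fun b x y => linearP (KX i) b x y)) scaler_sumr.
apply: eq_bigr => s _; rewrite kpP !scalerA /k /kmx mul_mx_diag mul_diag_mx !mxE.
by congr (_ *: _); ring.
Qed.

Hypothesis y_span_N : exists z, z != 0 /\ N (theta_T z).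
Variables (w : 'I_p -> seq I) (n : nat).
Hypotheses (yE : forall s, y s = Fword (w s)) (w_le : forall s, (size (w s) <= n)%N)
  (y_span : forall x, XL n x -> exists c : 'I_p -> K, x = \sum_s c s *: y s)
  (n_min : forall n' z, (n' < n)%N -> N z -> (forall t, XL n' (ft t z)) -> z = 0).

Lemma highest_vector_coord : exists2 x, x != 0 & N (tau m x).
Proof.
have epsP i : exists eps : 'M[K]_p, forall s,
    KVX i (EX i (y s)) = \sum_u eps s u *: y u.
  have /choice[c cP] : forall s, exists c : 'I_p -> K,
      KVX i (EX i (y s)) = \sum_u c u *: y u.
    by move=> s; apply/y_span/XL_KVX/XL_EX; rewrite yE; apply: XL_word.
  exists (\matrix_(s, u) c s u) => s; rewrite cP; apply: eq_bigr => u _.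
  by rewrite mxE.
have [eps {}epsP] := choice epsP.
(* [K_i^-1 E_i] multiplies [HX]-eigenvalues by [q ^ N0]; comparing them on independent words shows
   that a nonzero entry lowers the length by exactly one. *)
have eps_len i s u : eps i s u != 0 -> (size (w u) < size (w s))%N.
  move=> eps0; have hy r : HX (y r) = (hh * q ^ (- (N0 * size (w r))%:Z)) *: y r.
    by rewrite yE HX_word.
  have := congr1 HX (epsP i s); rewrite HX_KV HX_E hy !linearZ /= epsP.
  rewrite (linear_sumZ _ _ _ (fun b x y => linearP HX b x y)) !scaler_sumr.
  under eq_bigr do rewrite !scalerA; under [RHS]eq_bigr do rewrite hy scalerA.
  move/(lfree_inj y_free)/(_ u); rewrite mulrC => /(mulfI eps0).
  rewrite mulrCA => /(mulfI hh_neq0); rewrite -expfzDr // => /(expfz_inj q0 q_nroot).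
  by nia.
pose NM z := N (theta_T z).
have [z0 [z0_neq0 Nz0]] := y_span_N.
have NM_top z : NM z -> (forall s, size (w s) = n -> row s z = 0) -> z = 0.
  move=> Nz ztop; have ztop' s t : size (w s) = n -> z s t = 0.
    by move=> /ztop /rowP /(_ t); rewrite !mxE.
  (* For [n = 0] every word has top length; otherwise the tensor lies in filtration degree [n - 1],
     where minimality of [n] makes it vanish. *)
  case: (posnP n) => [n0|n_gt0].
    apply/matrixP => s t; rewrite [RHS]mxE ztop' //.
    by have := w_le s; rewrite n0 leqn0 => /eqP.
  apply/theta_eq0/(n_min (n' := n.-1)) => //; first by rewrite prednK.
  move=> t; rewrite ft_theta; apply: XL_sum => s _ zs.
  rewrite yE; apply: XL_word; have := w_le s; have : size (w s) <> n.
    by move=> sn; rewrite ztop' ?eqxx in zs.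
  by lia.
have [z [Nz z_neq0] epsz] := socle q0 q_nroot D_gt0 theta_gt0 a_diag chi_e chi_f ef
  level0 irr (eps := eps) (kap := fun i => \row_s kap i (w s)) (NM := NM)
  eps_len w_le (fun i s => ltac:(by rewrite mxE))
  (fun b z z' Nz Nz' => ltac:(by rewrite /NM theta_linear; apply: N_lin))
  (fun i z Nz => ltac:(by rewrite /NM theta_eps //;
     case: (N_st i Nz) => NE _ _ _; case: (N_st i NE)))
  (fun i z Nz => ltac:(by rewrite /NM theta_kap;
     [case: (N_st i Nz)|move=> s; rewrite mxE yE]))
  NM_top Nz0 z0_neq0.
(* Each component of the tensor is killed by all [EX i], hence is a multiple of the highest weight
   vector. *)
have /choice[b bP] : forall t, exists b, ft t (theta_T z) = b *: m.
  move=> t; apply: X_singular => i; rewrite -[EX i _](KKVX i) ft_theta.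
  rewrite (linear_sumZ _ _ _ (fun b x y => linearP (EX i) b x y)).
  rewrite (linear_sumZ _ _ _ (fun b x y => linearP (KVX i) b x y)).
  under eq_bigr do rewrite epsP scaler_sumr.
  rewrite exchange_big big1 ?linear0 // => u _ /=.
  have /matrixP /(_ u t) := epsz i; rewrite !mxE => h.
  rewrite -[RHS](scale0r (y u)) -h scaler_suml; apply: eq_bigr => s _.
  by rewrite mxE scalerA mulrC.
have zE : theta_T z = tau m (\sum_t b t *: v t).
  rewrite -[LHS]recon (linear_sumZ _ _ _ (tau_r m)); apply: eq_bigr => t _.
  by rewrite bP tau_lZ.
exists (\sum_t b t *: v t); last by rewrite -zE.
by apply: contra z_neq0 => /eqP b0; apply/eqP/theta_eq0; rewrite zE b0 tau_r0.
Qed.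
End Coordinates.

Let highest_vector : exists2 x, x != 0 & N (tau m x).
Proof.
pose Q n := `[< exists z, [/\ z != 0, N z & forall t, XL n (ft t z)] >].
have Qex : exists n, Q n.
  have [z z_neq0 Nz] := N_neq0; have /choice[n nP] : forall t, exists n, XL n (ft t z).
    by move=> t; apply: X_span.
  exists (\max_t n t)%N; apply/asboolP; exists z; split=> // t.
  by apply: XL_le (nP t); apply: leq_bigmax.
case: (ex_minnP Qex) => n /asboolP[z [z_neq0 Nz zn]] n_min.
have [p [w [w_le w_free w_span]]] := XL_basis n.
apply: (highest_vector_coord w_free _ (fun s => erefl) w_le w_span) => //.
  have /choice[c cP] : forall t, exists c : 'I_p -> K, ft t z = \sum_s c s *: Fword (w s).
    by move=> t; apply: w_span.
  pose zm : 'M[K]_(p, d) := \matrix_(s, t) c t s.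
  have zE : \sum_s \sum_t zm s t *: tau (Fword (w s)) (v t) = z.
    rewrite -[RHS]recon exchange_big; apply: eq_bigr => t _ /=.
    rewrite cP (linear_sumZ _ _ _ (tau_l (v t))); apply: eq_bigr => s _.
    by rewrite mxE.
  exists zm; rewrite /= zE; split=> //; apply: contra z_neq0 => /eqP zm0.
  by rewrite -zE zm0 big1 // => s _; rewrite big1 // => t _; rewrite mxE scale0r.
move=> n' z' n'n Nz' z'n'; apply/eqP/negPn/negP => z'_neq0.
have : Q n' by apply/asboolP; exists z'.
by move/n_min; rewrite leqNgt n'n.
Qed.

Theorem tensor_simple z : N z.
Proof.
(* As the [EX i] kill [m], the vectors [y] with [N (tau m y)] form a Borel-stable subspace of
   [V]. *)
have Ntau_m x : N (tau m x).
  rewrite -(coK x); move: (co x).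
  apply: (borel_irreducible_pred q0 q_nroot D_gt0 theta_gt0 a_diag chi_e chi_f ef
    level0 irr).
  - by rewrite rho0 tau_r0.
  - by move=> b y y' Ny Ny'; rewrite rho_linear tau_r; apply: N_lin.
  - move=> i y Ny; have [NE _ _ _] := N_st i Ny.
    move: NE; rewrite ET_tau EX_m tau_l0 add0r [KX i m](KX_word i [::]) tau_lZ -rho_e.
    move/(N_lin (kap i [::])^-1)/(_ N0').
    by rewrite addr0 scalerA mulVf // scale1r.
  - move=> i y Ny; have [_ _ NK _] := N_st i Ny.
    move: NK; rewrite KT_tau [KX i m](KX_word i [::]) tau_lZ -rho_k.
    move/(N_lin (kap i [::])^-1)/(_ N0').
    by rewrite addr0 scalerA mulVf // scale1r.
  have [x0 x0_neq0 Nx0] := highest_vector.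
  exists (co x0); last by rewrite coK.
  by apply: contra x0_neq0 => /eqP x00; rewrite -(coK x0) x00 rho0.
have Ntau_w w x : N (tau (Fword w) x).
  elim: w x => [|j w IHw] x; first exact: Ntau_m.
  (* Starting from [KV j x] cancels the [K_j^-1] that the coproduct of [F_j] puts on [V]; the other
     summand is in [N] by induction. *)
  have [_ NF _ _] := N_st j (IHw (KV j x)).
  move: NF; rewrite FT_tau => NF.
  have KVKV : KVV j (KV j x) = x.
    by rewrite -(coK x) -rho_k -rho_kV -mulmxA kkV mulmx1.
  rewrite KVKV in NF.
  have := N_lin (-1) (IHw (FV j (KV j x))) NF.
  by rewrite scaleN1r addrCA addNr addr0.
rewrite -(recon z).
elim/big_ind: _ => [||t _]; first exact: N0'.
  by move=> u u' Nu Nu'; rewrite -[u]scale1r; apply: N_lin.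
have [n [r [_ ->]]] := X_span (ft t z).
rewrite (linear_sumZ _ _ _ (tau_l (v t))).
elim/big_ind: _ => [||b _]; first exact: N0'.
  by move=> u u' Nu Nu'; rewrite -[u]scale1r; apply: N_lin.
by rewrite -[_ *: _]addr0; apply: N_lin.
Qed.
End TensorSimple.

(** * Modules over the quantum affine algebra *)

Section Action.
Variables (K : fieldType) (A : algType K) (M : lmodType A).

Definition act (u : A) : vect A M -> vect A M := fun x => u *: (x : M).

Lemma vect_scale (b : K) (x : vect A M) : b *: x = b%:A *: (x : M).
Proof. by []. Qed.

Fact act_linear u : linear (act u).
Proof.
move=> b x y; rewrite /act !vect_scale scalerDr !scalerA.
by rewrite -scalerAl mul1r -scalerAr mulr1.
Qed.
HB.instance Definition _ u :=
  GRing.isLinear.Build K (vect A M) (vect A M) _ (act u) (act_linear u).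

Lemma actM u v x : act (u * v) x = act u (act v x).
Proof. by rewrite /act scalerA. Qed.
Lemma actZ b u x : act (b *: u) x = b *: act u x.
Proof. by rewrite /act vect_scale scalerA -scalerAl mul1r. Qed.
Lemma actB u v x : act (u - v) x = act u x - act v x.
Proof. by rewrite /act scalerBl. Qed.
Lemma act1 x : act 1 x = x.
Proof. by rewrite /act scale1r. Qed.
End Action.

(** * Generated subalgebras and the generators of the quantum affine algebra *)

Section Generation.
Variables (K : fieldType) (U : algType K) (G : Type) (g : G -> U).

Definition subalg_emb (u : subalg g) : U := subalg_val u.
Fact subalg_emb_linear : linear subalg_emb.
Proof. by []. Qed.
HB.instance Definition _ := GRing.isLinear.Build K (subalg g) U _ subalg_emb
  subalg_emb_linear.
Fact subalg_emb_monoid : monoid_morphism subalg_emb.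
Proof. by []. Qed.
HB.instance Definition _ := GRing.isMonoidMorphism.Build (subalg g) U subalg_emb
  subalg_emb_monoid.

Lemma subalg_ind (P : subalg g -> Prop) : P 1 ->
  (forall b u v, P u -> P v -> P (b *: u + v)) ->
  (forall u v, P u -> P v -> P (u * v)) ->
  (forall y, P (subalg_gen g y)) -> forall u, P u.
Proof.
move=> P1 Plin PM Pg u; pose S := [pred x | `[< exists2 z : subalg g, \val z = x & P z >]].
have Scl : subalg_closed S.
  split; first by apply/asboolP; exists 1; rewrite ?rmorph1.
    move=> b x y /asboolP[x' <- Px] /asboolP[y' <- Py]; apply/asboolP.
    by exists (b *: x' + y'); rewrite ?linearP //; apply: Plin.
  move=> x y /asboolP[x' <- Px] /asboolP[y' <- Py]; apply/asboolP.
  by exists (x' * y'); rewrite ?rmorphM //; apply: PM.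
have Sg y : g y \in S by apply/asboolP; exists (subalg_gen g y).
have /asboolP := subalg_valP u.
by move=> /(_ S Scl Sg) /asboolP[z /val_inj <-].
Qed.

Lemma subalg_stable (M : lmodType (subalg g)) (P : vect (subalg g) M -> Prop) :
  (forall b x y, P x -> P y -> P (b *: x + y)) ->
  (forall y x, P x -> P (act (subalg_gen g y) x)) ->
  forall u x, P x -> P (act u x).
Proof.
move=> Plin Pg u; apply: (subalg_ind (P := fun u => forall x, P x -> P (act u x))) => //.
- by move=> x; rewrite act1.
- move=> b u1 u2 P1 P2 x Px; rewrite /act scalerDl -/(act _ x) -/(act u2 x) actZ.
  by apply: Plin; [apply: P1|apply: P2].
- by move=> u1 u2 P1 P2 x Px; rewrite actM; apply/P1/P2.
Qed.
End Generation.

Section QuantumAffineGen.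
Variables (l : nat) (g : simple_datum l) (K : fieldType) (q : K).

Lemma rmorph_zpow (A B : algType K) (phi : {rmorphism A -> B}) x y n :
  phi (zpow x y n) = zpow (phi x) (phi y) n.
Proof. by case: n => n; rewrite /zpow rmorphXn. Qed.

Lemma chevalley_relations_inj (A B : algType K) (phi : {lrmorphism A -> B})
    (f : cgen l -> A) : injective phi ->
  chevalley_relations g q (phi \o f) -> chevalley_relations g q f.
Proof.
move=> phi_inj [[h1 h2 h3 h4 h5] [h6 h7 h8 h9] h10 h11 h12]; split.
- split=> [i||||].
  + by case: (h1 i) => a1 a2; split; apply: phi_inj; rewrite rmorphM rmorph1.
  + by case: h2 => a1 a2; split; apply: phi_inj; rewrite rmorphM rmorph1.
  + by case: h3 => a1 a2; split; apply: phi_inj; rewrite rmorphM rmorph1.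
  + by move=> y; apply: phi_inj; rewrite !rmorphM; apply: h4.
  + apply: phi_inj; rewrite rmorphXn rmorphM rmorph_prod.
    by under eq_bigr do rewrite rmorph_zpow.
- split=> [i j|i|i j|i j]; apply: phi_inj; rewrite ?linearZ !rmorphM;
    by [apply: h6|apply: h7|apply: h8|apply: h9].
- by move=> j; case: (h10 j) => a1 a2; split; apply: phi_inj; rewrite linearZ !rmorphM.
- move=> i j; apply: phi_inj; rewrite /comm_br rmorphB !rmorphM.
  have := h11 i j; rewrite /comm_br /= => ->.
  by case: ifP => _; rewrite ?raddf0 // linearZ rmorphB.
- move=> i j ij; case: (h12 i j ij) => a1 a2.
  by split; apply: phi_inj; rewrite raddf0 linear_sum;
    [rewrite -[RHS]a1|rewrite -[RHS]a2]; apply: eq_bigr => n _;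
    rewrite linearZ !rmorphM !rmorphXn.
Qed.

(** The relations hold in the generated subalgebra, so the universal property maps [U] into it;
    followed by the inclusion this fixes the generators, hence is the identity by uniqueness. *)
Lemma quantum_affine_gen (U : algType K) (c : cgen l -> U) :
  quantum_affine g q c -> forall u, u \in gen_subalg c.
Proof.
move=> [c_rel c_univ].
pose vl : {lrmorphism subalg c -> U} := subalg_emb (g := c).
have vl_inj : injective vl by apply: val_inj.
have sub_rel : chevalley_relations g q (subalg_gen c).
  exact: (chevalley_relations_inj vl_inj).
have [phi [phiP _]] := c_univ _ _ sub_rel.
have [psi [_ psi_uniq]] := c_univ U c c_rel.
move=> u; have phi_u : vl (phi u) = psi u.
  by apply: (psi_uniq (vl \o phi)) => y /=; rewrite phiP.
have -> : u = psi u by apply: (psi_uniq idfun).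
by rewrite -phi_u; apply: subalg_valP.
Qed.
End QuantumAffineGen.

Inductive Fspan (K : fieldType) (Y : lmodType K) (I : Type) (F : I -> Y -> Y)
    (S : Y -> Prop) : Y -> Prop :=
| Fspan_base y : S y -> Fspan F S y
| Fspan_F i y : Fspan F S y -> Fspan F S (F i y)
| Fspan_lin b x y : Fspan F S x -> Fspan F S y -> Fspan F S (b *: x + y).

(** * Singular vectors of simple highest weight modules *)

Section HighestWeight.
Variables (K : fieldType) (q : K).
Hypotheses (q0 : q != 0) (q_nroot : forall n, (0 < n)%N -> q ^+ n != 1).
Variables (I : finType) (J : Type) (Y : lmodType K) (E F : I -> {linear Y -> Y}).

(* The [tor j] are the operators of a torus, closed under inverses. *)
Variables (tor : J -> {linear Y -> Y}) (inv : J -> J) (eps : J -> I -> int).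
Variables (kj kVj : I -> J) (cc : I -> K) (m : Y) (chi : J -> K).
Hypotheses (torK : forall j x, tor (inv j) (tor j x) = x)
  (torE : forall j i x, tor j (E i x) = q ^ eps j i *: E i (tor j x))
  (torF : forall j i x, tor j (F i x) = q ^ (- eps j i) *: F i (tor j x))
  (torC : forall j j' x, tor j (tor j' x) = tor j' (tor j x))
  (EF : forall i i' x, E i (F i' x) - F i' (E i x) =
     if i == i' then cc i *: (tor (kj i) x - tor (kVj i) x) else 0)
  (E_m : forall i, E i m = 0) (tor_m : forall j, tor j m = chi j *: m)
  (m_neq0 : m != 0)
  (simple : forall P : Y -> Prop, P 0 -> (forall b x y, P x -> P y -> P (b *: x + y)) ->
     (forall i x, P x -> P (E i x) /\ P (F i x)) -> (forall j x, P x -> P (tor j x)) ->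
     (exists2 x, x != 0 & P x) -> forall x, P x).

Lemma chi_neq0 j : chi j != 0.
Proof.
apply: contra m_neq0 => /eqP c0; rewrite -(torK j m) tor_m c0 scale0r linear0 //.
Qed.

Lemma scale_q_eq0 (n : int) (x : Y) : q ^ n *: x = 0 -> x = 0.
Proof. by move/eqP; rewrite scaler_eq0 (negbTE (expfz_neq0 n q0)) => /eqP. Qed.

Definition wkap (j : J) (w : seq I) : K := chi j * \prod_(i <- w) q ^ (- eps j i).

Lemma wkap_neq0 j w : wkap j w != 0.
Proof.
by rewrite mulf_neq0 ?chi_neq0 // prodf_seq_neq0; apply/allP => i _; rewrite expfz_neq0.
Qed.

Lemma tor_word j w : tor j (Fword F m w) = wkap j w *: Fword F m w.
Proof.
elim: w => [|i w IHw]; first by rewrite /wkap big_nil mulr1 tor_m.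
rewrite /= torF IHw linearZ scalerA /wkap big_cons.
by congr (_ *: _); rewrite mulrCA.
Qed.

Lemma XL_F n i x : XL F m n x -> XL F m n.+1 (F i x).
Proof.
move=> [r [rn ->]]; rewrite (linear_sumZ _ _ _ (fun b x y => linearP (F i) b x y)).
by apply: XL_sum => b br _; apply: (XL_word F m (w := i :: b.2)); apply: rn.
Qed.

(** Moving [E i] through a word leaves only commutators, which are torus elements and act on words
    by scalars. *)
Lemma E_word i w : XL F m (size w) (E i (Fword F m w)).
Proof.
elim: w => [|i' w IHw] /=; first by rewrite E_m; apply: XL0.
have /eqP := EF i i' (Fword F m w); rewrite subr_eq => /eqP ->.
rewrite -[X in XL _ _ _ (X + _)]scale1r; apply: XL_lin; last exact: XL_F.
case: ifP => _; last exact: XL0.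
rewrite !tor_word -scalerBl scalerA -[_ *: _]addr0; apply: XL_lin; last exact: XL0.
exact: XL_word.
Qed.

Lemma word_span x : exists n, XL F m n x.
Proof.
apply: (simple (P := fun x => exists n, XL F m n x)).
- by exists 0%N; apply: XL0.
- move=> b y z [n yn] [n' zn]; exists (maxn n n'); apply: XL_lin.
    exact: XL_le (leq_maxl _ _) yn.
  exact: XL_le (leq_maxr _ _) zn.
- move=> i y [n [r [rn ->]]]; split.
    exists n; rewrite (linear_sumZ _ _ _ (fun b x y => linearP (E i) b x y)).
    by apply: XL_sum => b br _; apply: (XL_le (rn b br)); apply: E_word.
  by exists n.+1; apply: XL_F; exists r.
- move=> j y [n [r [rn ->]]]; exists n.
  rewrite (linear_sumZ _ _ _ (fun b x y => linearP (tor j) b x y)).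
  apply: XL_sum => b br _; rewrite tor_word -[_ *: _]addr0.
  by apply: XL_lin; [exact: XL_word (rn b br)|exact: XL0].
by exists m => //; exists 0%N; apply: (XL_word F m (w := [::])).
Qed.

(** By the commutation relations, a torus-stable set of singular vectors generates a submodule using
    the [F i] alone, and simplicity makes it everything. *)
Lemma Fspan_stable (S : Y -> Prop) : S 0 ->
  (forall i x, S x -> E i x = 0) -> (forall j x, S x -> S (tor j x)) ->
  (exists2 x, x != 0 & S x) -> forall x, Fspan F S x.
Proof.
move=> S0 SE Stor [x0 x0_neq0 Sx0].
have st_tor j x : Fspan F S x -> Fspan F S (tor j x).
  elim=> {x} [x Sx|i x _ IHx|b x y _ IHx _ IHy].
  - by apply: Fspan_base; apply: Stor.
  - rewrite torF -[_ *: _]addr0; apply: Fspan_lin; first exact: Fspan_F.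
    exact: Fspan_base.
  by rewrite linearP; apply: Fspan_lin.
apply: simple => //.
- exact: Fspan_base.
- exact: Fspan_lin.
- move=> i x Sx; split; last exact: Fspan_F.
  elim: Sx => {x} [x Sx|i' x Sx IHx|b x y _ IHx _ IHy].
  + by rewrite SE //; apply: Fspan_base.
  + have /eqP := EF i i' x; rewrite subr_eq => /eqP ->.
    rewrite -[X in Fspan _ _ (X + _)]scale1r; apply: Fspan_lin; last exact: Fspan_F.
    case: ifP => _; last exact: Fspan_base.
    rewrite -[_ *: _]addr0; apply: Fspan_lin; last exact: Fspan_base.
    by rewrite addrC -scaleN1r; apply: Fspan_lin; apply: st_tor.
  by rewrite linearP; apply: Fspan_lin.
by exists x0 => //; apply: Fspan_base.
Qed.

Variables (s : seq J) (N : nat).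
Hypotheses (N_gt0 : (0 < N)%N) (sN : forall i, \sum_(j <- s) eps j i = N%:Z).

(* [Hop] acts by [q ^ (- N * height)], up to a scalar. *)
Definition Hop (x : Y) : Y := foldr (fun j => tor j) x s.

Fact Hop_linear : linear Hop.
Proof. by move=> b x y; rewrite /Hop; elim: s => //= j t ->; rewrite linearP. Qed.
HB.instance Definition _ := GRing.isLinear.Build K Y Y _ Hop Hop_linear.

Definition hchi : K := \prod_(j <- s) chi j.

Lemma hchi_neq0 : hchi != 0.
Proof.
rewrite /hchi; elim/big_ind: _ => [|x y x0 y0|j _]; first exact: oner_neq0.
  exact: mulf_neq0.
exact: chi_neq0.
Qed.

Lemma Hop_m : Hop m = hchi *: m.
Proof.
rewrite /Hop /hchi; elim: s => [|j t IHt] /=; first by rewrite big_nil scale1r.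
by rewrite IHt linearZ /= tor_m scalerA big_cons mulrC.
Qed.

Lemma Hop_tor j x : Hop (tor j x) = tor j (Hop x).
Proof. by rewrite /Hop; elim: s => //= j' t ->; rewrite torC. Qed.

Lemma Hop_E i x : Hop (E i x) = q ^ N%:Z *: E i (Hop x).
Proof.
rewrite -(sN i) /Hop; elim: s => [|j t IHt] /=; first by rewrite big_nil scale1r.
by rewrite IHt linearZ /= torE scalerA big_cons addrC expfzDr.
Qed.

Lemma Hop_F i x : Hop (F i x) = q ^ (- N%:Z) *: F i (Hop x).
Proof.
rewrite -(sN i) /Hop; elim: s => [|j t IHt] /=.
  by rewrite big_nil oppr0 scale1r.
by rewrite IHt linearZ /= torF scalerA big_cons opprD addrC expfzDr.
Qed.

Definition hev (n : nat) : K := hchi * q ^ (- (N * n)%:Z).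

Lemma hev_inj : injective hev.
Proof.
move=> n n' /(mulfI hchi_neq0) /(expfz_inj q0 q_nroot) h.
by apply/eqP; rewrite -(eqn_pmul2l N_gt0); apply/eqP; lia.
Qed.

Lemma hev_F n i x : Hop x = hev n *: x -> Hop (F i x) = hev n.+1 *: F i x.
Proof.
move=> Hx; rewrite Hop_F Hx linearZ scalerA /hev mulrCA -expfzDr //.
by congr (_ * q ^ _ *: _); lia.
Qed.

Lemma Hop_word w : Hop (Fword F m w) = hev (size w) *: Fword F m w.
Proof.
elim: w => [|i w IHw] /=; last exact: hev_F.
by rewrite Hop_m /hev muln0 mulr1.
Qed.

(* [Fspan F S] for [S] the singular vectors of height [n > 0] would be a proper
   submodule, all of whose heights are at least [n]. *)
Lemma singular_height_eq0 n y : (0 < n)%N -> (forall i, E i y = 0) ->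
  Hop y = hev n *: y -> y = 0.
Proof.
move=> n_gt0 Ey Hy; apply/eqP/negPn/negP => y_neq0.
pose S x := (forall i, E i x = 0) /\ Hop x = hev n *: x.
have span : forall x, Fspan F S x.
  apply: Fspan_stable.
  - by split=> [i|]; rewrite !linear0 ?scaler0.
  - by move=> i x [].
  - move=> j x [Ex Hx]; split=> [i|]; last by rewrite Hop_tor Hx linearZ.
    by apply: (@scale_q_eq0 (eps j i)); rewrite -torE Ex linear0.
  by exists y.
have [r [rn rm]] : exists r : seq (nat * Y),
    (forall z, z \in r -> (0 < z.1)%N /\ Hop z.2 = hev z.1 *: z.2) /\
    m = \sum_(z <- r) z.2.
  elim: (span m) => {y Ey Hy y_neq0}
    [y [_ Hy]|i y _ [r [rn ->]]|b x y _ [r [rn ->]] _ [r' [rn' ->]]].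
  - exists [:: (n, y)]; rewrite big_seq1; split=> // z.
    by rewrite inE => /eqP ->.
  - exists [seq (z.1.+1, F i z.2) | z <- r]; split.
      by move=> _ /mapP[z /rn[_ Hz] ->]; split=> //; apply: hev_F.
    by rewrite linear_sum big_map.
  exists ([seq (z.1, b *: z.2) | z <- r] ++ r'); split=> [z|].
    rewrite mem_cat => /orP[/mapP[z' /rn[z'0 Hz] ->]|/rn' //].
    by split=> //=; rewrite linearZ /= Hz !scalerA mulrC.
  by rewrite big_cat big_map scaler_sumr.
(* The product of all [Hop - hev k] over the heights in [r] kills the right-hand side but scales
   [m], of height 0, by a nonzero factor. *)
pose R (ks : seq nat) (x : Y) := foldr (fun k z => Hop z - hev k *: z) x ks.
have R_ev ks k x : Hop x = hev k *: x ->
    R ks x = (\prod_(k' <- ks) (hev k - hev k')) *: x.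
  move=> Hx; elim: ks => [|k' ks IHks] /=; first by rewrite big_nil scale1r.
  by rewrite IHks linearZ /= Hx !scalerA -scalerBl big_cons; congr (_ *: _); ring.
have R_sum ks (t : seq (nat * Y)) :
    R ks (\sum_(z <- t) z.2) = \sum_(z <- t) R ks z.2.
  elim: ks => //= k ks ->.
  by rewrite linear_sum scaler_sumr -sumrB.
have Hm : Hop m = hev 0 *: m by rewrite Hop_m /hev muln0 mulr1.
have := R_ev [seq z.1 | z <- r] _ _ Hm; rewrite {1}rm R_sum big_seq big1.
  move=> /esym/eqP; rewrite scaler_eq0 (negbTE m_neq0) orbF prodf_seq_eq0.
  move=> /hasP[_ /mapP[z /rn[z_gt0 _] ->]] /=; rewrite subr_eq0 => /eqP/hev_inj z0.
  by rewrite -z0 in z_gt0.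
move=> z zr; have [_ /(R_ev [seq z.1 | z <- r]) ->] := rn z zr.
apply/eqP; rewrite scaler_eq0 prodf_seq_eq0; apply/orP; left.
by apply/hasP; exists z.1; rewrite ?map_f //= subrr eqxx.
Qed.

(** Induction on the filtration: [Hop - hev n.+1] preserves singular vectors and lowers the
    filtration degree. *)
Lemma singular_highest x : (forall i, E i x = 0) -> exists b, x = b *: m.
Proof.
have [n xn] := word_span x.
elim: n x xn => [|n IHn] x xn Ex.
  have [r [r0 ->]] := xn; exists (\sum_(b <- r) b.1).
  rewrite scaler_suml [LHS]big_seq [RHS]big_seq; apply: eq_bigr => b /r0.
  by rewrite leqn0 => /nilP ->.
have xn' : XL F m n (Hop x - hev n.+1 *: x).
  have [r [rn ->]] := xn; rewrite linear_sum scaler_sumr -sumrB.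
  rewrite (eq_bigr (fun b : K * seq I =>
    (b.1 * (hev (size b.2) - hev n.+1)) *: Fword F m b.2)).
    apply: XL_sum => b /rn; rewrite leq_eqVlt => /orP[/eqP ->|bn _].
      by rewrite subrr mulr0 eqxx.
    exact: XL_word.
  by move=> b _; rewrite linearZ /= Hop_word !scalerA -scalerBl; congr (_ *: _); ring.
have [|b bm] := IHn _ xn'.
  move=> i; rewrite linearB linearZ /= Ex scaler0 subr0.
  by apply: (@scale_q_eq0 N%:Z); rewrite -Hop_E Ex linear0.
have ev0 : hev 0 - hev n.+1 != 0 by rewrite subr_eq0; apply/eqP => /hev_inj.
(* Chosen so that [x - b' *: m] is a [Hop]-eigenvector of positive height [n.+1]. *)
pose b' := b / (hev 0 - hev n.+1).
exists b'; apply/eqP; rewrite -subr_eq0; apply/eqP.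
apply: (@singular_height_eq0 n.+1) => // [i|].
  by rewrite linearB linearZ /= Ex E_m scaler0 subrr.
rewrite linearB linearZ /= Hop_m.
have /eqP := bm; rewrite subr_eq => /eqP ->.
have hE : hev 0 = hchi by rewrite /hev muln0 mulr1.
have -> : b = b' * (hev 0 - hev n.+1) by rewrite /b' divfK.
rewrite hE scalerBr !scalerA mulrBr scalerBl [hev _ * b']mulrC.
by rewrite addrAC [_ - _ - _]addrAC subrr sub0r addrC.
Qed.
End HighestWeight.

(** * Affine Cartan data and a height coweight *)

Section Coweight.
Variables (l : nat) (g : simple_datum l).
Local Notation a := (acartan g).

Definition aexp (i j : 'I_l.+1) : int := (symd g i)%:Z * a i j.

(** The marks of the affine diagram, that is, the exponents of the [K_i] in the central element [C],
    with 1 at node 0. *)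
Definition thetan (i : 'I_l.+1) : nat :=
  if unlift ord0 i is Some i' then `|theta g ord0 i'|%N else 1%N.

Lemma symd_gt0 i : (0 < symd g i)%N.
Proof. by case: (simple_datum_symd g). Qed.

Lemma theta_ge1 i : 1 <= theta g 0 i.
Proof.
have [_ /(_ _ _ (root_simple (cartan g) i) i)] := simple_datum_theta g.
by rewrite mxE !eqxx.
Qed.

Lemma thetan_gt0 i : (0 < thetan i)%N.
Proof.
rewrite /thetan; case: unliftP => [j _|//].
by rewrite absz_gt0 gt_eqF //; apply: lt_le_trans ltr01 (theta_ge1 j).
Qed.

Lemma aexp_diag i : aexp i i = (2 * symd g i)%:Z.
Proof.
have [_ a2 _ _ _] := simple_datum_cartan g.
rewrite /aexp /acartan mxE; case: unliftP => [j _|_]; rewrite ?a2; lia.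
Qed.

Lemma acartan_lift i j : a (lift ord0 i) (lift ord0 j) = cartan g i j.
Proof. by rewrite /acartan mxE !liftK. Qed.

(* The finite Cartan matrix is nondegenerate and [alpha_0(d) = 1], so that some
   element of the coroot lattice plus [Z d] takes the same positive value on all
   simple roots. *)
Lemma height_coweight : exists (n : 'I_l -> int) (nD : int) (N : nat),
  (0 < N)%N /\ forall j, \sum_i n i * aexp (lift ord0 i) j + nD * (j == ord0)%:Z = N%:Z.
Proof.
pose S : 'M[int]_l := \matrix_(i, j) aexp (lift ord0 i) (lift ord0 j).
(* A kernel vector of the symmetric matrix [S] would be a null vector of the positive definite form
   of the finite Cartan matrix. *)
have detS : \det S != 0.
  apply/negP => /det0P [v v_neq0 vS].
  have [_ _ _ _ [d' [_ pos]]] := simple_datum_cartan g.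
  have := pos v v_neq0; rewrite big1 ?ltxx // => j _.
  have vA : \sum_i cartan g j i * v 0 i = 0.
    have /rowP /(_ j) := vS; rewrite !mxE.
    have -> : \sum_i v 0 i * S i j =
        (symd g (lift ord0 j))%:Z * \sum_i cartan g j i * v 0 i.
      rewrite mulr_sumr; apply: eq_bigr => i _; rewrite mxE /aexp.
      have [_ ->] := simple_datum_symd g; rewrite -/(acartan g) acartan_lift.
      by ring.
    move/eqP; rewrite mulf_eq0 eqz_nat => /orP[|/eqP //].
    by rewrite eqn0Ngt symd_gt0.
  transitivity ((d' j)%:Z * v 0 j * \sum_i cartan g j i * v 0 i).
    by rewrite mulr_sumr; apply: eq_bigr => i _; ring.
  by rewrite vA mulr0.
(* The adjugate clears denominators, and the further factor [\det S] makes the common value a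
   square, hence positive. *)
pose n0 : 'rV[int]_l := \det S *: (const_mx 1 *m \adj S).
have n0S j : \sum_i n0 0 i * aexp (lift ord0 i) (lift ord0 j) = \det S ^+ 2.
  transitivity ((n0 *m S) 0 j).
    by rewrite [RHS]mxE; apply: eq_bigr => i _; rewrite [S i j]mxE.
  by rewrite /n0 -scalemxAl -mulmxA mul_adj_mx mul_mx_scalar !mxE mulr1 expr2.
have N_gt0 : 0 < \det S ^+ 2 by rewrite exprn_even_gt0.
exists (n0 0), (\det S ^+ 2 - \sum_i n0 0 i * aexp (lift ord0 i) ord0), `|\det S ^+ 2|%N.
split=> [|j]; first by rewrite absz_gt0 gt_eqF.
rewrite gez0_abs ?ltW //; case: (unliftP ord0 j) => [j' ->|->]; last first.
  by rewrite mulr1 addrC subrK.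
by rewrite n0S mulr0 addr0.
Qed.
End Coweight.

Variant tgen (l : nat) := TK of bool & 'I_l.+1 | TC of bool | TD of bool.
Arguments TC {l}.
Arguments TD {l}.

Section HeightWord.
Variables (l : nat) (g : simple_datum l).

Definition teps (j : tgen l) (i : 'I_l.+1) : int :=
  match j with
  | TK b i' => sgn_int b * aexp g i' i
  | TC _ => 0
  | TD b => sgn_int b * (i == ord0)%:Z
  end.

(** The coweight becomes a word in torus generators: the sign of a coefficient selects the generator
    or its inverse, and its absolute value the number of repetitions. *)
Lemma height_seq : exists (s : seq (tgen l)) (N : nat), (0 < N)%N /\
  forall i, \sum_(j <- s) teps j i = N%:Z.
Proof.
have [n [nD [N [N_gt0 nN]]]] := height_coweight g.
exists (flatten [seq nseq `|n i|%N (TK (0 <= n i) (lift ord0 i)) | i <- enum 'I_l] ++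
   nseq `|nD|%N (TD (0 <= nD))), N; split=> // i.
rewrite -(nN i) big_cat big_flatten big_map big_enum.
have nseqE b (k : int) : \sum_(j <- nseq `|k|%N b) teps j i = `|k|%N%:Z * teps b i.
  by rewrite big_nseq iter_addr_0 -mulr_natl natz.
rewrite nseqE; congr (_ + _).
  by apply: eq_bigr => k _; rewrite nseqE /=; case: (lerP 0 (n k)) => ?;
    rewrite /sgn_int mulrA; congr (_ * _); lia.
by rewrite /= /sgn_int mulrA; congr (_ * _); case: (lerP 0 nD) => ?; lia.
Qed.
End HeightWord.

(** * Torus and commutation relations of the quantum affine algebra *)

Section Relations.
Variables (l : nat) (g : simple_datum l) (K : fieldType) (q : K).
Hypotheses (q0 : q != 0).
Variables (U : algType K) (c : cgen l -> U) (HU : quantum_affine g q c).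

Definition tinv (j : tgen l) : tgen l :=
  match j with TK b i => TK (~~ b) i | TC b => TC (~~ b) | TD b => TD (~~ b) end.

Definition telt (j : tgen l) : U :=
  match j with
  | TK b i => c (G' (if b then GK i else GKV i))
  | TC b => c (G' (if b then GC else GCV))
  | TD b => c (if b then GD else GDV)
  end.

Lemma teltVK j : telt (tinv j) * telt j = 1.
Proof.
have [[h1 [h2 h2'] [h3 h3'] _ _] _ _ _ _] := HU.1.
by case: j => [[] i|[]|[]] //=; case: (h1 i).
Qed.

Lemma teltKV j : telt j * telt (tinv j) = 1.
Proof.
have [[h1 [h2 h2'] [h3 h3'] _ _] _ _ _ _] := HU.1.
by case: j => [[] i|[]|[]] //=; case: (h1 i).
Qed.

(** Relations are checked on the positive generators and passed to their inverses by
    [mulV_qcomm]. *)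
Definition tpos (j : tgen l) : tgen l :=
  match j with TK _ i => TK true i | TC _ => TC true | TD _ => TD true end.

Lemma tpos_dec j : j = tpos j \/ j = tinv (tpos j).
Proof. by case: j => [[] i|[]|[]]; [left|right|left|right|left|right]. Qed.

Lemma mulV_qcomm (t tV x : U) (z : K) : t * tV = 1 -> tV * t = 1 -> z != 0 ->
  t * x = z *: (x * t) -> tV * x = z^-1 *: (x * tV).
Proof.
move=> ttV tVt z0 tx; have := congr1 (fun y => tV * y * tV) tx.
rewrite /= mulrA tVt mul1r -scalerAr -scalerAl mulrA -[_ * t * tV]mulrA ttV mulr1.
by move=> ->; rewrite scalerA mulVf // scale1r.
Qed.

Let qq_exp i j : (q ^+ symd g i) ^ acartan g i j = q ^ aexp g i j.
Proof. by rewrite exprnP exprz_exp. Qed.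

Lemma telt_E j i : telt j * c (G' (GE i)) = q ^ teps g j i *: (c (G' (GE i)) * telt j).
Proof.
have [[h1 [h2 h2'] [h3 h3'] h4 _] [_ _ h8 _] h10 _ _] := HU.1.
have pos j' : telt (tpos j') * c (G' (GE i)) =
    q ^ teps g (tpos j') i *: (c (G' (GE i)) * telt (tpos j')).
  case: j' => [b i'|b|b]; rewrite /= ?scale1r ?mul1r.
  - have [kkV kVk] := h1 i'; rewrite scalerAl -qq_exp -h8 -!mulrA kVk mulr1.
    by [].
  - by rewrite h4.
  - have [DE _] := h10 i; rewrite scalerAl -exprnP -DE -!mulrA h2' mulr1.
    by [].
have [->|->] := tpos_dec j; first exact: pos.
rewrite (mulV_qcomm (teltKV (tpos j)) (teltVK (tpos j)) (expfz_neq0 _ q0) (pos j)).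
by rewrite invr_expz; congr (_ ^ _ *: _); case: (j) => [b i'|b|b] //=; lia.
Qed.

Lemma telt_F j i : telt j * c (G' (GF i)) = q ^ (- teps g j i) *: (c (G' (GF i)) * telt j).
Proof.
have [[h1 [h2 h2'] [h3 h3'] h4 _] [_ _ _ h8] h10 _ _] := HU.1.
have pos j' : telt (tpos j') * c (G' (GF i)) =
    q ^ (- teps g (tpos j') i) *: (c (G' (GF i)) * telt (tpos j')).
  case: j' => [b i'|b|b]; rewrite /= ?scale1r ?mul1r.
  - have [kkV kVk] := h1 i'; rewrite scalerAl.
    rewrite -invr_expz -qq_exp invr_expz -h8 -!mulrA kVk mulr1.
    by [].
  - by rewrite h4.
  - have [_ DE] := h10 i; rewrite scalerAl -invr_expz -exprnP -DE -!mulrA h2' mulr1.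
    by [].
have [->|->] := tpos_dec j; first exact: pos.
rewrite (mulV_qcomm (teltKV (tpos j)) (teltVK (tpos j)) (expfz_neq0 _ q0) (pos j)).
by rewrite invr_expz; congr (_ ^ _ *: _); case: (j) => [b i'|b|b] //=; lia.
Qed.

Lemma telt_comm j j' : telt j * telt j' = telt j' * telt j.
Proof.
have [[_ _ _ h4 _] [h6 h7 _ _] _ _ _] := HU.1.
have V (t : tgen l) x : telt t * x = x * telt t -> telt (tinv t) * x = x * telt (tinv t).
  move=> tx; have tx1 : telt t * x = 1 *: (x * telt t) by rewrite scale1r.
  by have := mulV_qcomm (teltKV t) (teltVK t) (oner_neq0 K) tx1; rewrite invr1 scale1r.
have pos : telt (tpos j) * telt (tpos j') = telt (tpos j') * telt (tpos j).
  by case: (j) => [? ?|?|?]; case: (j') => [? ?|?|?] //=;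
    first [exact: h4 | exact: h6 | exact: h7 |
           exact: (esym (h7 _)) | exact: (esym (h4 _))].
have [->|->] := tpos_dec j; have [->|->] := tpos_dec j' => //.
- by apply/esym/V/esym.
- exact: V.
- by apply/V/esym/V/esym.
Qed.

Lemma EF_rel i j : c (G' (GE i)) * c (G' (GF j)) - c (G' (GF j)) * c (G' (GE i)) =
  if i == j then (qdiff q (symd g i)%:Z)^-1 *:
    (telt (TK true i) - telt (TK false i)) else 0.
Proof. by have [_ _ _ /(_ i j)] := HU.1; rewrite /comm_br /qdiff -invr_expz. Qed.

Lemma C_rel : telt (TC true) ^+ 2 = telt (TK true ord0) *
  \prod_i zpow (telt (TK true (lift ord0 i))) (telt (TK false (lift ord0 i))) (theta g 0 i).
Proof. by case: HU.1 => [[]]. Qed.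
End Relations.

Lemma gen_subalg_stable (K : fieldType) (U : algType K) (G : Type) (g : G -> U)
    (M : lmodType U) (P : M -> Prop) :
  (forall (b : K) x y, P x -> P y -> P (b%:A *: x + y)) ->
  (forall y x, P x -> P (g y *: x)) ->
  forall u, u \in gen_subalg g -> forall x, P x -> P (u *: x).
Proof.
move=> Plin Pg u /asboolP ug.
pose S := [pred u : U | `[< forall x, P x -> P (u *: x) >]].
suff /ug h : subalg_closed S.
  by apply/asboolP/h => y; apply/asboolP => x; apply: Pg.
split.
- by apply/asboolP => x; rewrite scale1r.
- move=> b v w /asboolP Pv /asboolP Pw; apply/asboolP => x Px.
  rewrite scalerDl -[b *: v]mul1r -scalerAr scalerAl -scalerA.
  by apply: Plin; [apply: Pv|apply: Pw].
- move=> v w /asboolP Pv /asboolP Pw; apply/asboolP => x Px.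
  by rewrite -scalerA; apply/Pv/Pw.
Qed.

(** * The highest weight factor over the quantum affine algebra *)

Section HighestWeightModule.
Variables (l : nat) (g : simple_datum l) (K : fieldType) (q : K).
Hypotheses (q0 : q != 0).
Variables (U : algType K) (c : cgen l -> U) (HU : quantum_affine g q c).
Variables (X : lmodType U) (HX : simple_module X).

(* [X] as the [K]-space on which [tau] is defined; all of [U] still acts on it. *)
Definition xsp : lmodType K := vect (Uprime c) (restr (incl c) X).
Local Notation XX := xsp.

Definition ract (u : U) : XX -> XX := fun x => u *: (x : X).

Lemma ract_scale (b : K) (x : XX) : b *: x = b%:A *: (x : X).
Proof. by []. Qed.

Fact ract_linear u : linear (ract u).
Proof.
move=> b x y; rewrite /ract ract_scale [in RHS]ract_scale scalerDr !scalerA.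
by rewrite -scalerAl mul1r -scalerAr mulr1.
Qed.
HB.instance Definition _ u := GRing.isLinear.Build K XX XX _ (ract u) (ract_linear u).
Definition xact (u : U) : {linear XX -> XX} := ract u.

Lemma xactE u (x : XX) : xact u x = u *: (x : X).
Proof. by []. Qed.
Lemma xactM u v x : xact (u * v) x = xact u (xact v x).
Proof. by rewrite !xactE scalerA. Qed.
Lemma xactZ b u x : xact (b *: u) x = b *: xact u x.
Proof. by rewrite ract_scale !xactE scalerA -scalerAl mul1r. Qed.
Lemma xactB u v x : xact (u - v) x = xact u x - xact v x.
Proof. by rewrite !xactE scalerBl. Qed.

Lemma xact_E j i x : xact (telt c j) (xact (c (G' (GE i))) x) =
  q ^ teps g j i *: xact (c (G' (GE i))) (xact (telt c j) x).
Proof. by rewrite -xactM (telt_E q0 HU) xactZ xactM. Qed.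
Lemma xact_F j i x : xact (telt c j) (xact (c (G' (GF i))) x) =
  q ^ (- teps g j i) *: xact (c (G' (GF i))) (xact (telt c j) x).
Proof. by rewrite -xactM (telt_F q0 HU) xactZ xactM. Qed.
Lemma xact_comm j j' x :
  xact (telt c j) (xact (telt c j') x) = xact (telt c j') (xact (telt c j) x).
Proof. by rewrite -!xactM (telt_comm HU). Qed.
Lemma xact_VK j x : xact (telt c (tinv j)) (xact (telt c j) x) = x.
Proof. by rewrite -xactM (teltVK HU) xactE scale1r. Qed.
Lemma xact_KV j x : xact (telt c j) (xact (telt c (tinv j)) x) = x.
Proof. by rewrite -xactM (teltKV HU) xactE scale1r. Qed.
Lemma xact_EF i i' x : xact (c (G' (GE i))) (xact (c (G' (GF i'))) x) -
    xact (c (G' (GF i'))) (xact (c (G' (GE i))) x) =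
  if i == i' then (qdiff q (symd g i)%:Z)^-1 *:
     (xact (telt c (TK true i)) x - xact (telt c (TK false i)) x) else 0.
Proof.
rewrite -!xactM -xactB (EF_rel HU); case: ifP => _; first by rewrite xactZ xactB.
by rewrite xactE scale0r.
Qed.

Lemma xact_simple (P : XX -> Prop) : P 0 ->
  (forall b x y, P x -> P y -> P (b *: x + y)) ->
  (forall i x, P x -> P (xact (c (G' (GE i))) x) /\ P (xact (c (G' (GF i))) x)) ->
  (forall j x, P x -> P (xact (telt c j) x)) ->
  (exists2 x, x != 0 & P x) -> forall x, P x.
Proof.
move=> P0 Plin PEF Ptor [x0 x0_neq0 Px0].
have Pst u x : P x -> P (xact u x).
  apply: (gen_subalg_stable (g := c) (P := (P : X -> Prop))) => //.
  - move=> [[i|i|i|i||]||] y Py.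
    + exact: (PEF i y Py).1.
    + exact: (PEF i y Py).2.
    + exact: (Ptor (TK true i) y Py).
    + exact: (Ptor (TK false i) y Py).
    + exact: (Ptor (TC true) y Py).
    + exact: (Ptor (TC false) y Py).
    + exact: (Ptor (TD true) y Py).
    + exact: (Ptor (TD false) y Py).
  exact: quantum_affine_gen HU u.
have [_ simp] := HX.
have [|Pz|Pall] := simp [pred x : X | `[< P x >]].
- split; first exact/asboolP.
  move=> u x y /asboolP Px /asboolP Py; apply/asboolP.
  by have := Plin 1 _ _ (Pst u x Px) Py; rewrite scale1r.
- by rewrite (Pz x0) ?eqxx // in x0_neq0; apply/asboolP.
by move=> x; apply/asboolP/Pall.
Qed.

(** The relators fix the eigenvalues of [K_i], [D] and [C^(1/2)]; those of the inverses follow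
    because [x] is nonzero. *)
Lemma tor_weight (L : weight l) (s : K) (x : XX) : x != 0 ->
  (forall u, verma_relator g q c L s u -> xact u x = 0) ->
  exists chi : tgen l -> K, forall j, xact (telt c j) x = chi j *: x.
Proof.
move=> x_neq0 rel.
have eig u b : verma_relator g q c L s (u - b%:A) -> xact u x = b *: x.
  by move/rel => /eqP; rewrite xactB subr_eq0 => /eqP.
have pos j : exists b, xact (telt c (tpos j)) x = b *: x.
  case: j => [b i|b|b]; eexists; apply: eig; by constructor.
suff /choice[chi chiP] : forall j, exists b, xact (telt c j) x = b *: x by exists chi.
move=> j; have [b bP] := pos j; have [->|->] := tpos_dec j; first by exists b.
exists b^-1; have := congr1 (xact (telt c (tinv (tpos j)))) bP.
rewrite xact_VK linearZ /= => xE.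
have b0 : b != 0.
  by apply: contra x_neq0 => /eqP b0; rewrite xE b0 scale0r.
by rewrite [in RHS]xE scalerA mulVf // scale1r.
Qed.
End HighestWeightModule.
Arguments xact {l K U c X} u.

(** * The finite-dimensional factor and its weights *)

Section LevelZeroModule.
Variables (l : nat) (g : simple_datum l) (K : fieldType) (q : K).
Hypotheses (q0 : q != 0) (q_nroot : forall n, (0 < n)%N -> q ^+ n != 1).
Variables (U : algType K) (c : cgen l -> U) (HU : quantum_affine g q c).
Variables (V : lmodType (Uprime c)) (HV : simple_module V) (HVfin : fin_dim V).

Definition vsp : lmodType K := vect (Uprime c) V.
Local Notation VV := vsp.
Definition vact (u : Uprime c) : {linear VV -> VV} := act (M := V) u.
Lemma vactE u (x : VV) : vact u x = u *: (x : V).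
Proof. by []. Qed.
Lemma vactM u v x : vact (u * v) x = vact u (vact v x).
Proof. exact: (@actM K (Uprime c) V). Qed.
Lemma vactZ b u x : vact (b *: u) x = b *: vact u x.
Proof. exact: (@actZ K (Uprime c) V). Qed.
Lemma vactB u v x : vact (u - v) x = vact u x - vact v x.
Proof. exact: (@actB K (Uprime c) V). Qed.
Lemma vact1 x : vact 1 x = x.
Proof. exact: (@act1 K (Uprime c) V). Qed.

Definition Kelt (b : bool) i : Uprime c := cU' c (if b then GK i else GKV i).
Local Notation E i := (vact (cU' c (GE i))).
Local Notation F i := (vact (cU' c (GF i))).
Local Notation k b i := (vact (Kelt b i)).
Local Notation Ch b := (vact (cU' c (if b then GC else GCV))).

Lemma Vk_E b i j (x : VV) : k b i (E j x) = q ^ (sgn_int b * aexp g i j) *: E j (k b i x).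
Proof.
rewrite -[LHS]vactM (_ : Kelt b i * cU' c (GE j) =
   q ^ (sgn_int b * aexp g i j) *: (cU' c (GE j) * Kelt b i)).
  by rewrite vactZ vactM.
apply: val_inj; exact: (telt_E q0 HU (TK b i) j).
Qed.

Lemma Vk_F b i j (x : VV) :
  k b i (F j x) = q ^ (- (sgn_int b * aexp g i j)) *: F j (k b i x).
Proof.
rewrite -[LHS]vactM (_ : Kelt b i * cU' c (GF j) =
   q ^ (- (sgn_int b * aexp g i j)) *: (cU' c (GF j) * Kelt b i)).
  by rewrite vactZ vactM.
apply: val_inj; exact: (telt_F q0 HU (TK b i) j).
Qed.

Lemma Vk_inv b i (x : VV) : k (~~ b) i (k b i x) = x.
Proof.
rewrite -[LHS]vactM -[RHS]vact1; congr (vact _ _).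
apply: val_inj; exact: (teltVK HU (TK b i)).
Qed.

Lemma V_EF i (x : VV) : E i (F i x) - F i (E i x) =
  (qdiff q (symd g i)%:Z)^-1 *: (k true i x - k false i x).
Proof.
rewrite -![E i _]vactM -![F i _]vactM -[LHS]vactB.
rewrite (_ : cU' c (GE i) * cU' c (GF i) - cU' c (GF i) * cU' c (GE i) =
   (qdiff q (symd g i)%:Z)^-1 *: (Kelt true i - Kelt false i)).
  by rewrite vactZ vactB.
by apply: val_inj; have := EF_rel HU i i; rewrite eqxx.
Qed.

Lemma V_C_central y (x : VV) :
  Ch true (vact (cU' c y) x) = vact (cU' c y) (Ch true x).
Proof.
rewrite -[LHS]vactM -[RHS]vactM; congr (vact _ _).
by apply: val_inj; have [[_ _ _ h _] _ _ _ _] := HU.1; apply: (h (G' y)).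
Qed.

Lemma V_C_inv (x : VV) : Ch false (Ch true x) = x.
Proof.
rewrite -[LHS]vactM -[RHS]vact1; congr (vact _ _).
apply: val_inj; exact: (teltVK HU (TC true)).
Qed.

Lemma V_C_rel (x : VV) : Ch true (Ch true x) = k true ord0
  (vact (\prod_i zpow (Kelt true (lift ord0 i)) (Kelt false (lift ord0 i))
    (theta g 0 i)) x).
Proof.
rewrite -[LHS]vactM -[RHS]vactM; congr (vact _ _).
apply: val_inj; rewrite -[RHS]/(subalg_emb _) !rmorphM rmorph_prod.
under eq_bigr do rewrite rmorph_zpow.
exact: (C_rel HU).
Qed.

Variables (v0 : VV) (n0 : 'I_l -> int).
Hypotheses (v0_neq0 : v0 != 0) (v0_gen : forall x : V, exists u, x = u *: (v0 : V))
  (v0_K : forall i, k true (lift ord0 i) v0 = q ^ n0 i *: v0)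
  (v0_C : Ch true v0 = v0).

Let V_stable (P : VV -> Prop) : (forall b x y, P x -> P y -> P (b *: x + y)) ->
  (forall y x, P x -> P (vact (cU' c y) x)) -> P v0 -> forall x, P x.
Proof.
move=> Plin Pg Pv0 x; have [u ->] := v0_gen x.
exact: (subalg_stable (g := c \o @G' l) (M := V) Plin Pg).
Qed.

(** A central element fixing a generating vector acts as the identity. *)
Lemma V_C1 (x : VV) : Ch true x = x.
Proof.
apply: (V_stable (P := fun x => Ch true x = x)) => //.
  by move=> b y z yC zC; rewrite linearP yC zC.
by move=> y z zC; rewrite V_C_central zC.
Qed.

Lemma zpow_eigen i (mu : int) n (x : VV) : k true i x = q ^ mu *: x ->
  vact (zpow (Kelt true i) (Kelt false i) n) x = q ^ (mu * n) *: x.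
Proof.
move=> kx; have kVx : k false i x = q ^ (- mu) *: x.
  have := Vk_inv true i x; rewrite kx linearZ /= => h.
  by rewrite -[in RHS]h scalerA -expfzDr // addNr scale1r.
have pow b nu r : k b i x = q ^ nu *: x ->
    vact (Kelt b i ^+ r) x = q ^ (nu * r%:Z) *: x.
  move=> bx; elim: r => [|r IHr]; first by rewrite expr0 vact1 mulr0 scale1r.
  rewrite exprS vactM IHr linearZ /= [vact _ x]bx scalerA -expfzDr //.
  by congr (_ ^ _ *: _); lia.
case: n => r /=; first exact: pow.
by rewrite (pow _ _ _ kVx); congr (_ ^ _ *: _); lia.
Qed.

Let thetaprod := \prod_i zpow (Kelt true (lift ord0 i)) (Kelt false (lift ord0 i))
    (theta g 0 i).

Lemma theta_eigen (mu : 'I_l -> int) (x : VV) :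
  (forall i, k true (lift ord0 i) x = q ^ mu i *: x) ->
  vact thetaprod x = q ^ (\sum_i mu i * theta g 0 i) *: x.
Proof.
move=> kx; rewrite /thetaprod; elim/big_rec2: _ => [|i n u _ IH].
  by rewrite vact1 scale1r.
rewrite vactM IH linearZ /= (zpow_eigen _ (kx i)) scalerA -expfzDr //.
by rewrite addrC.
Qed.

Definition wtvec (mu : 'I_l.+1 -> int) (x : VV) : Prop :=
  forall i, k true i x = q ^ mu i *: x.

Lemma wtvec_V mu x i : wtvec mu x -> k false i x = q ^ (- mu i) *: x.
Proof.
move=> wx; have := Vk_inv true i x; rewrite wx linearZ /= => h.
by rewrite -[in RHS]h scalerA -expfzDr // addNr scale1r.
Qed.

Lemma wtvec_v0 : exists mu, wtvec mu v0.
Proof.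
(* The weight at node 0 is forced by [C = 1] from those at the finite nodes. *)
exists (fun i => if unlift ord0 i is Some i' then n0 i' else - \sum_j n0 j * theta g 0 j).
move=> i; case: unliftP => [i' ->|->]; first exact: v0_K.
have := V_C_rel v0; rewrite !v0_C (theta_eigen v0_K) linearZ /= => h.
by rewrite [in RHS]h scalerA -expfzDr // addNr scale1r.
Qed.

(** On a weight vector [C] acts by [q] to this sum; as [C = 1] and [q] is not a root of unity, the
    exponent is zero. *)
Lemma wtvec_level mu x : wtvec mu x -> x != 0 ->
  \sum_i (thetan g i)%:Z * mu i = 0.
Proof.
move=> wx x_neq0; have := V_C_rel x; rewrite !V_C1.
rewrite (theta_eigen (fun i => wx (lift ord0 i))) linearZ /= wx scalerA -expfzDr //.
move/eqP; rewrite -subr_eq0 -{1}[x]scale1r -scalerBl scaler_eq0 (negbTE x_neq0) orbF.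
rewrite subr_eq0 eq_sym expfz_eq1 // => /eqP h; rewrite -[RHS]h big_ord_recl.
rewrite addrC; congr (_ + _); last by rewrite /thetan unlift_none mul1r.
apply: eq_bigr => i _; rewrite /thetan liftK mulrC; congr (_ * _).
by rewrite gez0_abs // (le_trans _ (theta_ge1 g i)).
Qed.

Lemma weight_span (x : VV) : exists r : seq VV,
  (forall z, z \in r -> exists mu, wtvec mu z) /\ x = \sum_(z <- r) z.
Proof.
have wE i mu z : wtvec mu z -> wtvec (fun j => mu j + aexp g j i) (E i z).
  move=> wz j; rewrite Vk_E wz linearZ scalerA mul1r -expfzDr //.
  by rewrite addrC.
have wF i mu z : wtvec mu z -> wtvec (fun j => mu j - aexp g j i) (F i z).
  move=> wz j; rewrite Vk_F wz linearZ scalerA mul1r -expfzDr //.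
  by rewrite addrC.
have wZ b mu z : wtvec mu z -> wtvec mu (b *: z).
  by move=> wz j; rewrite linearZ /= wz !scalerA mulrC.
pose P x := exists r : seq VV,
  (forall z, z \in r -> exists mu, wtvec mu z) /\ x = \sum_(z <- r) z.
have Pmap (A : {linear VV -> VV}) y :
    (forall mu z, wtvec mu z -> exists mu', wtvec mu' (A z)) ->
    P y -> P (A y).
  move=> AP [r [rw ->]]; exists (map A r); split; last by rewrite linear_sum big_map.
  by move=> _ /mapP[z /rw[mu /AP h] ->].
apply: (V_stable (P := P)).
- move=> b y z [r [rw ->]] [r' [rw' ->]].
  exists (map (GRing.scale b) r ++ r').
  split; last by rewrite big_cat big_map scaler_sumr.
  move=> t; rewrite mem_cat => /orP[/mapP[y' /rw[mu wy] ->]|/rw' //].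
  by exists mu; apply: wZ.
- move=> [i|i|i|i||] y Py.
  + by apply: (Pmap (E i)) => // mu z wz; exists (fun j => mu j + aexp g j i); apply: wE.
  + by apply: (Pmap (F i)) => // mu z wz; exists (fun j => mu j - aexp g j i); apply: wF.
  + apply: (Pmap (k true i)) => // mu z wz; exists mu; rewrite wz; exact: wZ.
  + apply: (Pmap (k false i)) => // mu z wz; exists mu; rewrite (wtvec_V i wz); exact: wZ.
  + by rewrite [vact _ y]V_C1.
  + by rewrite -[y in vact _ y]V_C1 [vact _ _]V_C_inv.
have [mu w0] := wtvec_v0.
by exists [:: v0]; rewrite big_seq1; split=> // z; rewrite inE => /eqP ->; exists mu.
Qed.

Lemma weight_basis_V : exists d (v : 'I_d -> VV) (chi : 'I_l.+1 -> 'I_d -> int),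
  [/\ lfree v, forall x, exists b : 'I_d -> K, x = \sum_t b t *: v t,
      forall i t, k true i (v t) = q ^ chi i t *: v t,
      forall i t, k false i (v t) = q ^ (- chi i t) *: v t &
      forall t, \sum_i (thetan g i)%:Z * chi i t = 0].
Proof.
have [n [e eP]] := HVfin.
have /choice[r rP] : forall j, exists r : seq VV,
    (forall z, z \in r -> exists mu, wtvec mu z) /\ (e j : VV) = \sum_(z <- r) z.
  by move=> j; apply: weight_span.
pose s := flatten [seq r j | j <- enum 'I_n].
have [d [v [vs v_free v_span]]] := basis_extraction (Z := VV) id s.
have v_wt t : exists mu, wtvec mu (v t).
  by have /flatten_mapP[j _ /(rP j).1] := vs t.
have [chi chiP] := choice v_wt.
exists d, v, (fun i t => chi t i); split=> //.
- move=> x; have [b ->] := eP x.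
  suff /choice[cf cfP] : forall j, exists cf : 'I_d -> K, (e j : VV) = \sum_t cf t *: v t.
    exists (fun t => \sum_j b j * cf j t).
    transitivity (\sum_j b j *: (e j : VV)) => //.
    under eq_bigr do rewrite cfP scaler_sumr.
    rewrite exchange_big; apply: eq_bigr => t _; rewrite scaler_suml.
    by apply: eq_bigr => j _; rewrite scalerA.
  move=> j; have [_ ->] := rP j.
  have : {subset r j <= s}.
    by move=> z zr; apply/flatten_mapP; exists j; rewrite ?mem_enum.
  elim: (r j) => [|z t IHt] ts.
    by exists (fun=> 0); rewrite big_nil big1 // => i _; rewrite scale0r.
  have [|b2 b2P] := IHt; first by move=> y yt; apply: ts; rewrite inE yt orbT.
  have [|b1 b1P] := v_span z; first by apply: ts; rewrite inE eqxx.
  exists (fun i => b1 i + b2 i); rewrite big_cons b2P [z in LHS]b1P -big_split.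
  by apply: eq_bigr => i _; rewrite scalerDl.
- by move=> i t; apply: chiP.
- by move=> i t; apply: (wtvec_V i (chiP t)).
move=> t; apply: (wtvec_level (chiP t)); apply/eqP => vt0.
have := v_free (fun i => (i == t)%:R); rewrite /= (bigD1 t) //= eqxx scale1r vt0 add0r.
rewrite big1 => [/(_ erefl t)/eqP|i /negbTE ->]; last by rewrite scale0r.
by rewrite eqxx oner_eq0.
Qed.

(** [C^(1/2)] acts as the identity, so stability under the other generators already gives a
    submodule. *)
Lemma V_irreducible (P : VV -> Prop) : P 0 ->
  (forall b x y, P x -> P y -> P (b *: x + y)) ->
  (forall i x, P x -> [/\ P (E i x), P (F i x), P (k true i x) & P (k false i x)]) ->
  (exists2 x, x != 0 & P x) -> forall x, P x.
Proof.
move=> P0 Plin Pst [x0 x0_neq0 Px0].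
have Pact u x : P x -> P (vact u x).
  apply: (subalg_stable (g := c \o @G' l) (M := V) Plin) => [[i|i|i|i||] y Py].
  - by case: (Pst i y Py).
  - by case: (Pst i y Py).
  - by case: (Pst i y Py).
  - by case: (Pst i y Py).
  - by rewrite [vact _ y]V_C1.
  - by rewrite -[y in vact _ y]V_C1 [vact _ _]V_C_inv.
have [_ simp] := HV.
have [|Pz|Pall] := simp [pred x : V | `[< P x >]].
- split; first exact/asboolP.
  move=> u x y /asboolP Px /asboolP Py; apply/asboolP.
  by have := Plin 1 _ _ (Pact u x Px) Py; rewrite scale1r.
- by rewrite (Pz x0) ?eqxx // in x0_neq0; apply/asboolP.
by move=> x; apply/asboolP/Pall.
Qed.
End LevelZeroModule.
Arguments vact {l K U c V} u.

(** * Simplicity of the tensor product *)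

Lemma qvar_nroot (R : realType) (n : nat) : (0 < n)%N -> qvar R ^+ n != 1.
Proof.
move=> n_gt0; rewrite /qvar -rmorphXn -tofrac1 tofrac_eq.
apply/negP => /eqP/(congr1 (fun p : {poly _} => size p)).
by rewrite size_polyXn size_poly1; lia.
Qed.

Lemma relator_act (K : fieldType) (A : algType K) (rel : A -> Prop) (M X : lmodType A)
    (m : M) (p : {linear M -> X}) u :
  presented_module rel m -> rel u -> u *: p m = 0.
Proof.
move=> [_ rel0] ru; rewrite -linearZ (_ : u *: m = 0) ?linear0 //; apply/rel0.
exists 1%N, (fun=> 1), (fun=> u); split=> //.
by rewrite big_ord1 mul1r.
Qed.

Lemma quotient_gen (K : fieldType) (A : algType K) (rel : A -> Prop) (M X : lmodType A)
    (m : M) (p : {linear M -> X}) : presented_module rel m ->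
  (forall x, exists y, p y = x) -> forall x, exists u, x = u *: p m.
Proof.
move=> [gen _] p_surj x; have [y <-] := p_surj x; have [u ->] := gen y.
by exists u; rewrite linearZ.
Qed.

Lemma quotient_gen_neq0 (A : pzRingType) (X : lmodType A) (x0 : X) :
  (exists x : X, x != 0) -> (forall x, exists u, x = u *: x0) -> x0 != 0.
Proof.
move=> [x x_neq0] gen; apply: contra x_neq0 => /eqP x00.
by have [u ->] := gen x; rewrite x00 scaler0.
Qed.

(** The abstract [tensor_simple] is applied with node set ['I_l.+1], exponents [aexp], marks
    [thetan], and as height operator the torus word of [height_seq]. *)
Lemma highest_weight_tensor (l : nat) (g : simple_datum l) (K : fieldType) (q : K)
    (U : algType K) (c : cgen l -> U) (L : weight l) (s : K)
    (X : lmodType U) (m0 : xsp c X) (V : lmodType (Uprime c)) (v0 : vsp V)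
    (n0 : 'I_l -> int) (T : lmodType (Uprime c))
    (tau : restr (incl c) X -> V -> T) :
  q != 0 -> (forall n, (0 < n)%N -> q ^+ n != 1) -> quantum_affine g q c ->
  simple_module X -> m0 != 0 ->
  (forall u, verma_relator g q c L s u -> xact u m0 = 0) ->
  simple_module V -> fin_dim V -> v0 != 0 ->
  (forall y : V, exists u, y = u *: (v0 : V)) ->
  (forall i, vact (Kelt c true (lift ord0 i)) v0 = q ^ n0 i *: v0) ->
  vact (cU' c GC) v0 = v0 ->
  tensor_module tau -> simple_module T.
Proof.
move=> q0 q_nroot HU simpX m0_neq0 relX simpV HVfin v0_neq0 v0_gen v0_K v0_C.
move=> [T_tensor ET FT KT CT].
have [d [v [chi [v_free v_span KV_v KVV_v lev]]]] :=
  weight_basis_V q0 q_nroot HU HVfin v0_neq0 v0_gen v0_K v0_C.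
have [tchi tor_m] := tor_weight HU m0_neq0 relX.
have E_m (i : 'I_l.+1) : xact (c (G' (GE i))) m0 = 0 by apply/relX/verma_E.
have [sq [N [N_gt0 sqN]]] := height_seq g.
pose tau' : xsp c X -> vsp V -> vsp T := tau.
have T_tensor' : tensor_product tau' := T_tensor.
split.
  exists (tau m0 v0).
  exact: (tau_neq0 v_free v_span T_tensor' m0_neq0 v0_neq0).
move=> S [S0 Slin].
have [Sz|] := pselect (forall z, z \in S -> z = 0); first by left.
move=> Snz; right.
have S_neq0 : exists2 z : vsp T, z != 0 & (z : T) \in S.
  apply: contrapT => nS; apply: Snz => z zS; apply/eqP/negPn/negP => z0.
  by apply: nS; exists z.
have S_act u (z : vsp T) : (z : T) \in S -> (vact u z : T) \in S.
  by move=> zS; rewrite vactE -[_ *: _]addr0; apply: Slin.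
have S_lin b (y z : vsp T) : (y : T) \in S -> (z : T) \in S -> (b *: y + z : T) \in S.
  by apply: Slin.
have X_simple := xact_simple HU simpX.
have X_tE := @xact_E l g K q q0 U c HU X.
have X_tF := @xact_F l g K q q0 U c HU X.
have X_tC := @xact_comm l g K q U c HU X.
have X_VK := @xact_VK l g K q U c HU X.
have X_KV := @xact_KV l g K q U c HU X.
have X_EF := @xact_EF l g K q U c HU X.
have X_span := word_span X_tF X_EF E_m tor_m m0_neq0 X_simple.
have KEV i j x : vact (Kelt c true i) (vact (cU' c (GE j)) x) =
    q ^ aexp g i j *: vact (cU' c (GE j)) (vact (V := V) (Kelt c true i) x).
  by rewrite (Vk_E q0 HU) mul1r.
have KFV i j x : vact (Kelt c true i) (vact (cU' c (GF j)) x) =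
    q ^ (- aexp g i j) *: vact (cU' c (GF j)) (vact (V := V) (Kelt c true i) x).
  by rewrite (Vk_F q0 HU) mul1r.
have V_irr := V_irreducible HU simpV v0_gen v0_C.
have X_word i := tor_word X_tF tor_m (TK true i).
have X_word0 i := wkap_neq0 q0 (teps g) X_VK tor_m m0_neq0 (TK true i).
have X_H0 := hchi_neq0 X_VK tor_m m0_neq0 sq.
have X_Hw := Hop_word q0 X_tF tor_m m0_neq0 N_gt0 sqN.
have X_HE := Hop_E q0 X_tE sqN.
have X_HKV i := Hop_tor X_tC sq (TK false i).
have X_Ew := E_word X_tF X_EF E_m tor_m.
have X_sing := singular_highest q0 q_nroot X_VK X_tE X_tF X_tC X_EF E_m tor_m m0_neq0
  X_simple N_gt0 sqN.
have T_E i (y : xsp c X) (z : vsp V) : vact (cU' c (GE i)) (tau' y z) =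
    tau' (xact (c (G' (GE i))) y) z +
    tau' (xact (telt c (TK true i)) y) (vact (cU' c (GE i)) z) := ET i y z.
have T_F i (y : xsp c X) (z : vsp V) : vact (cU' c (GF i)) (tau' y z) =
    tau' (xact (c (G' (GF i))) y) (vact (Kelt c false i) z) +
    tau' y (vact (cU' c (GF i)) z) := FT i y z.
have T_K i (y : xsp c X) (z : vsp V) : vact (Kelt c true i) (tau' y z) =
    tau' (xact (telt c (TK true i)) y) (vact (Kelt c true i) z) := (KT i y z).1.
have T_KV i (y : xsp c X) (z : vsp V) : vact (Kelt c false i) (tau' y z) =
    tau' (xact (telt c (TK false i)) y) (vact (Kelt c false i) z) := (KT i y z).2.
have S_st i z (zS : (z : T) \in S) := And4 (S_act (cU' c (GE i)) z zS)
  (S_act (cU' c (GF i)) z zS) (S_act (Kelt c true i) z zS) (S_act (Kelt c false i) z zS).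
exact: (tensor_simple q0 q_nroot (symd_gt0 g) (thetan_gt0 g) (aexp_diag g)
  v_free v_span KV_v KVV_v KEV KFV (V_EF HU (V := V)) lev V_irr X_span X_word X_word0
  (fun i => X_VK (TK true i)) (fun i => X_KV (TK true i)) X_H0 N_gt0 X_Hw X_HE X_HKV
  E_m X_Ew X_sing m0_neq0 T_tensor' T_E T_F T_K T_KV
  (N := fun z : vsp T => (z : T) \in S) S_lin S_st S_neq0).
Qed.

Theorem theorem1
  (R : realType) (l : nat) (g : simple_datum l)
  (L : weight l)
  (K : fieldType) (iota : {rmorphism Cq R -> K}) (s : K)
  (Hs : adjoins_sqrt iota (C_scalar g (qvar R) L) s)
  (U : algType K) (c : cgen l -> U)
  (HU : quantum_affine g (iota (qvar R)) c)
  (x : bool -> 'I_l -> int -> Uprime c) (h : 'I_l -> int -> Uprime c)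
  (Hxh : drinfeld_realization g (iota (qvar R)) x h)
  (M : lmodType U) (m : M)
  (HM : verma_module g (iota (qvar R)) c L s m)
  (X : lmodType U) (HX : simple_quotient M X)
  (pi : 'I_l -> {poly Cq R}) (Hpi : forall i, (pi i)`_0 = 1)
  (W : lmodType (Uprime c)) (w : W)
  (HW : weyl_module g (iota (qvar R)) x h (fun i => map_poly iota (pi i)) w)
  (V : lmodType (Uprime c)) (HV : simple_quotient W V) (HVfin : fin_dim V)
  (T : lmodType (Uprime c)) (tau : restr (incl c) X -> V -> T)
  (HT : tensor_module tau) :
  simple_module T.
Proof.
set q := iota (qvar R) in HU HM HW *.
have q_nroot n : (0 < n)%N -> q ^+ n != 1.
  by move=> n_gt0; rewrite -rmorphXn fmorph_eq1 qvar_nroot.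
have q0 : q != 0 by rewrite fmorph_eq0 tofrac_eq0 polyX_eq0.
have [simpX [pX pX_surj]] := HX.
have [simpV [pV pV_surj]] := HV.
set m0 : X := pX m; set v0 : V := pV w.
have m0_neq0 : (m0 : xsp c X) != 0.
  by apply: (quotient_gen_neq0 simpX.1); apply: quotient_gen HM pX_surj.
have v0_gen : forall y, exists u, y = u *: v0 by apply: quotient_gen HW pV_surj.
have v0_neq0 : v0 != 0 by apply: (quotient_gen_neq0 simpV.1).
have relX u : verma_relator g q c L s u -> u *: m0 = 0 by apply: relator_act HM.
have relV u : weyl_relator g q x h (fun i => map_poly iota (pi i)) u -> u *: v0 = 0.
  by apply: relator_act HW.
(* [K_i] acts on [v0] by $q_i$ to the degree of the [i]-th polynomial, and $q_i=q^{d_i}$. *)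
pose n0 i := (symd g (lift ord0 i) * (size (map_poly iota (pi i))).-1)%N%:Z.
have v0_K i : act (M := V) (Kelt c true (lift ord0 i)) v0 =
    q ^ n0 i *: (v0 : vect (Uprime c) V).
  have := relV _ (weyl_K g q x h _ i) => /eqP; rewrite scalerBl subr_eq0 => /eqP.
  by rewrite -exprM.
have v0_C : act (M := V) (cU' c GC) v0 = v0.
  have := relV _ (weyl_C g q x h _) => /eqP; rewrite scalerBl subr_eq0 scale1r.
  by move=> /eqP.
exact: (highest_weight_tensor q0 q_nroot HU simpX m0_neq0 relX simpV HVfin v0_neq0
  v0_gen v0_K v0_C HT).
Qed.
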